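(* Let $T$ be a triangle and $n$ a positive integer. (a) If $T$ is right angled, then $h(n,T)\le \frac{n^3}{16}$, and if moreover $4\mid n$ then $h(n,T)=\frac{n^3}{16}$. (b) If $T$ is of type $(120^\circ,30^\circ,30^\circ)$, then $h(n,T)\le\frac{4}{81}n^3$, and if moreover $9\mid n$ then $h(n,T)=\frac{4}{81}n^3$. (c) If $T$ is of type $\left(\frac{4\cdot 180}{7}^\circ,\frac{2\cdot 180}{7}^\circ,\frac{180}{7}^\circ\right)$, then $h(n,T)\le\frac{2}{49}n^3$, and if moreover $7\mid n$ then $h(n,T)=\frac{2}{49}n^3$. (d) If $T$ is of type $(108^\circ,36^\circ,36^\circ)$ or $(72^\circ,72^\circ,36^\circ)$, then $h(n,T)\le\frac{n^3}{25}$, and if moreover $5\mid n$ then $h(n,T)=\frac{n^3}{25}$. (e) If $T$ is not right angled and not of any of the types $(120^\circ,30^\circ,30^\circ)$, $\left(\frac{4\cdot 180}{7}^\circ,\frac{2\cdot 180}{7}^\circ,\frac{180}{7}^\circ\right)$, $(108^\circ,36^\circ,36^\circ)$, $(72^\circ,72^\circ,36^\circ)$, then $h(n,T)\le\frac{n^3}{27}$, and if moreover $3\mid n$ then $h(n,T)=\frac{n^3}{27}$.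
   Context: Let $T$ be a triangle with side lengths $a,b,c$, let $\varepsilon>0$ and $\varepsilon'=\varepsilon\cdot\min\{a,b,c\}$. A triangle $A'B'C'$ is $\varepsilon$-congruent to $T$ if there exist points $A,B,C\in\mathbb{R}^2$ such that $ABC$ is congruent to $T$ and $A',B',C'$ lie in the closed disks of radius $\varepsilon'$ around $A,B,C$ respectively. $h(n,T,\varepsilon)$ denotes the maximum, over all point sets $P\subseteq\mathbb{R}^2$ with $|P|=n$, of the number of 3-element subsets of $P$ forming a triangle $\varepsilon$-congruent to $T$, and $h(n,T):=\min_{\varepsilon>0}h(n,T,\varepsilon)$. A triangle is of type $(\alpha,\beta,\gamma)$ if $\alpha\ge\beta\ge\gamma$ are its interior angles (in degrees). *)

(* Defs.v *)
From Stdlib Require Import Reals ClassicalEpsilon.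
From mathcomp Require Import all_boot.
Set Implicit Arguments. Unset Strict Implicit. Unset Printing Implicit Defensive.

Local Open Scope R_scope.

Definition point := (R * R)%type.
Definition dist (p q : point) : R :=
  sqrt ((fst p - fst q) * (fst p - fst q) + (snd p - snd q) * (snd p - snd q)).

Definition is_triangle (a b c : R) : Prop :=
  0 < a /\ 0 < b /\ 0 < c /\ a < b + c /\ b < c + a /\ c < a + b.

Definition congruent_to (a b c : R) (A B C : point) : Prop :=
  dist B C = a /\ dist C A = b /\ dist A B = c.

Definition eps_congruent (a b c eps : R) (A' B' C' : point) : Prop :=
  let eps' := eps * Rmin a (Rmin b c) in
  exists A B C : point, congruent_to a b c A B C /\
    dist A' A <= eps' /\ dist B' B <= eps' /\ dist C' C <= eps'.

Definition pb (P : Prop) : bool := if excluded_middle_informative P then true else false.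

(* number of 3-element subsets of the point set {p i | i < n} (p injective)
   forming a triangle eps-congruent to T *)
Definition count_cong (n : nat) (p : 'I_n -> point) (a b c eps : R) : nat :=
  #|[set S : {set 'I_n} | (#|S| == 3)%N &&
     pb (exists i j k : 'I_n, S = [set i; j; k] /\
                              eps_congruent a b c eps (p i) (p j) (p k))]|.

(* h(n,T,eps): maximum over all n-point sets (all counts are <= 'C(n,3)) *)
Definition h_eps (n : nat) (a b c eps : R) : nat :=
  \max_(m < ('C(n, 3)).+1 |
        pb (exists p : 'I_n -> point, injective p /\ count_cong p a b c eps = m)) m.

Definition h (n : nat) (a b c : R) : nat :=
  \big[minn/('C(n, 3))]_(m < ('C(n, 3)).+1 |
        pb (exists eps : R, 0 < eps /\ h_eps n a b c eps = m)) m.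

Definition angleA (a b c : R) : R := acos ((b * b + c * c - a * a) / (2 * b * c)).
Definition angleB (a b c : R) : R := angleA b c a.
Definition angleC (a b c : R) : R := angleA c a b.

Definition deg (x : R) : R := x * PI / 180.

Definition of_type (a b c al be ga : R) : Prop :=
  al >= be /\ be >= ga /\
  (let A := angleA a b c in let B := angleB a b c in let C := angleC a b c in
   (A = al /\ B = be /\ C = ga) \/ (A = al /\ B = ga /\ C = be) \/
   (A = be /\ B = al /\ C = ga) \/ (A = be /\ B = ga /\ C = al) \/
   (A = ga /\ B = al /\ C = be) \/ (A = ga /\ B = be /\ C = al)).

Definition right_angled (a b c : R) : Prop :=
  angleA a b c = deg 90 \/ angleB a b c = deg 90 \/ angleC a b c = deg 90.

(* Main.v *)
(* By compactness, [h n T] is the largest number of triples congruent to [T] in a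
   configuration of [n] points that may coincide. That number is a cubic form in
   the multiplicities of the points. If two points lie in no common copy of [T],
   the form is affine along the exchange of weight between them, so one of them
   can be absorbed by the other; hence all pairs of distinct points may be assumed
   to lie in a copy of [T]. Then all distances are sides of [T].

   The copies of [T] over a given pair have their third vertex at one of the four
   corners of a rectangle. If every pair has only one third vertex, the copies form
   a linear space and the Lagrangian is at most 1/27. Otherwise two third vertices
   c, d over uv form with u, v a kite, a parallelogram or a trapezoid, and the copy
   through cd fixes the shape of [T]: either [T] is right angled, or it is the
   120-30-30 triangle and the configuration is a triangle with its centre, or it is
   inscribed in the regular pentagon or heptagon and the configuration is part of
   that polygon. For right angled [T] the copies form a linear space with blocks of
   size at most 4, unless the configuration lies on a regular hexagon. Each of these
   cases is an explicit inequality between cubic forms. *)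

From Stdlib Require Import Reals Lra Psatz ClassicalEpsilon.
From mathcomp Require Import all_boot all_order all_algebra.
From mathcomp Require ring lra.
Require Import Defs.
Set Implicit Arguments. Unset Strict Implicit. Unset Printing Implicit Defensive.

(** * Lagrangians of 3-uniform hypergraphs *)

(** The cubic form is summed over ordered triples, so each constant of the theorem appears
    multiplied by 6: 2/9, 3/8, 8/27, 6/25, 12/49. Each is the value of the form at an optimal
    weighting of total 1: equal weights on a triangle, on a rectangle, on the pentagon (5 edges) or
    on the heptagon (14 edges); for the star, 1/3 at the centre and 2/9 at each of the three other
    points. The obstacle is that covering only asserts the existence of copies, so the configuration
    is not known in advance. But once a few points are placed, each further point has one of only
    three possible distances to each of them. With two points normalized to (-1,0) and (1,0), every
    case becomes a system of polynomial equations in one vertex (x,y) and at most two further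
    points, which is either refuted or solved by ideal membership. For this reason squared distances
    replace distances throughout. An exceptional configuration need not be the full polygon: it is
    enough to label its points by template vertices so that edges go to edges, since pushing weights
    forward cannot decrease the form. *)

Section Lagrangian.
Import Order.TTheory GRing.Theory Num.Theory.
Import mathcomp.algebra_tactics.ring mathcomp.algebra_tactics.lra.
Local Open Scope ring_scope.
Variables (K : realFieldType) (I : finType) (t : I -> I -> I -> bool).
Hypothesis tC12 : forall i j k, t i j k = t j i k.
Hypothesis tC23 : forall i j k, t i j k = t i k j.
Hypothesis tirr : forall i k, t i i k = false.

(** The polarized form: three separate arguments make the expansion along a line a matter of
    symmetry and linearity. On the diagonal each edge is counted six times. *)
Definition trilin (x y z : I -> K) : K :=
  \sum_i \sum_j \sum_k x i * y j * z k * (t i j k)%:R.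

Definition covered (S : {set I}) :=
  forall i j, i \in S -> j \in S -> i != j -> exists2 k, k \in S & t i j k.

Lemma trilin_swap12 x y z : trilin x y z = trilin y x z.
Proof.
rewrite /trilin exchange_big; apply: eq_bigr => i _; apply: eq_bigr => j _.
by apply: eq_bigr => k _; rewrite tC12 (mulrC (x j)).
Qed.

Lemma trilin_swap23 x y z : trilin x y z = trilin x z y.
Proof.
rewrite /trilin; apply: eq_bigr => i _; rewrite exchange_big.
apply: eq_bigr => j _; apply: eq_bigr => k _.
by rewrite tC23 -!mulrA; congr (_ * _); rewrite mulrCA.
Qed.

Lemma trilinDl a x x' y z :
  trilin (fun i => x i + a * x' i) y z = trilin x y z + a * trilin x' y z.
Proof.
rewrite /trilin mulr_sumr -big_split; apply: eq_bigr => i _.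
rewrite mulr_sumr -big_split; apply: eq_bigr => j _.
rewrite mulr_sumr -big_split; apply: eq_bigr => k _ /=; ring.
Qed.

Lemma cubic_line w u a :
  let v i := w i + a * u i in
  trilin v v v = trilin w w w + a * (trilin u w w *+ 3)
                 + a ^+ 2 * (trilin u u w *+ 3) + a ^+ 3 * trilin u u u.
Proof.
move=> v; rewrite trilinDl.
rewrite (trilin_swap12 w) (trilin_swap12 u) !trilinDl.
rewrite !(trilin_swap23 _ _ v) !(trilin_swap12 _ v) !trilinDl.
rewrite (trilin_swap12 w u w) (trilin_swap23 u w u).
rewrite (trilin_swap12 w u u) (trilin_swap23 u w u) (trilin_swap23 w w u).
rewrite (trilin_swap12 w u w).
ring.
Qed.

(* Moving all the weight of one vertex of an uncovered pair to the other is a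
   linear perturbation of the cubic form, so one of the two directions does not
   decrease it: only supports in which every pair is covered matter. *)
Lemma cubic_le_covered (C : K) :
  (forall (S : {set I}) (w : I -> K), covered S -> (forall i, 0 <= w i) ->
     (forall i, i \notin S -> w i = 0) ->
     trilin w w w <= C * (\sum_i w i) ^+ 3) ->
  forall w : I -> K, (forall i, 0 <= w i) ->
    trilin w w w <= C * (\sum_i w i) ^+ 3.
Proof.
move=> hC w; have [n] := ubnP #|[set i | w i != 0]|.
elim: n w => // n IHn w; rewrite ltnS => lewn w0.
set S := [set i | w i != 0] in lewn *.
have wS i : i \notin S -> w i = 0 by rewrite inE negbK => /eqP.
pose bad := [pred p : I * I | [&& p.1 \in S, p.2 \in S, p.1 != p.2 &
   [forall k in S, ~~ t p.1 p.2 k]]].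
case: (pickP bad) => [[i j] /=|nobad]; last first.
  apply: (hC S) => // i j iS jS ij.
  have := nobad (i, j); rewrite /= iS jS ij /= => /negbT.
  by rewrite negb_forall_in => /exists_inP[k kS]; rewrite negbK => tk; exists k.
case/and4P=> iS jS ij /forall_inP tij.
have tw k : (t i j k)%:R * w k = 0.
  have [kS|/wS->] := boolP (k \in S); last by rewrite mulr0.
  by rewrite (negbTE (tij k kS)) mul0r.
pose u (k : I) : K := (k == i)%:R - (k == j)%:R.
have uE k : u k != 0 -> (k = i) \/ (k = j).
  rewrite /u; have [->|_] := eqVneq k i; first by left.
  by have [->|_] := eqVneq k j; [right|rewrite subrr eqxx].
have ui : u i = 1 by rewrite /u eqxx (negbTE ij) subr0.
have uj : u j = -1 by rewrite /u eqxx eq_sym (negbTE ij) sub0r.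
have uo k : k != i -> k != j -> u k = 0.
  by move=> /negbTE ki /negbTE kj; rewrite /u ki kj subrr.
have sumu : \sum_k u k = 0.
  rewrite /u sumrB (bigD1 i) //= eqxx big1 => [|k /negbTE->//].
  by rewrite (bigD1 j) //= eqxx big1 ?subrr // => k /negbTE->.
have tiiz a b : t a b a = false by rewrite tC23 tirr.
have tizz a b : t a b b = false by rewrite tC12 tiiz.
(* An edge whose first two vertices lie in {i, j} has them equal to i and j in some order, and then
   its third vertex has weight 0 by [tw]. *)
have Buuw : trilin u u w = 0.
  rewrite /trilin big1 // => a _; rewrite big1 // => b _; rewrite big1 // => c _.
  have [->|/uE ua] := eqVneq (u a) 0; first by rewrite !mul0r.
  have [->|/uE ub] := eqVneq (u b) 0; first by rewrite mulr0 !mul0r.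
  have tw' : w c * (t i j c)%:R = 0 by rewrite mulrC tw.
  by case: ua ub => -> [] ->; rewrite ?tirr ?mulr0 // -mulrA ?(tC12 j) tw' mulr0.
have Buuu : trilin u u u = 0.
  rewrite /trilin big1 // => a _; rewrite big1 // => b _; rewrite big1 // => c _.
  have [->|/uE ua] := eqVneq (u a) 0; first by rewrite !mul0r.
  have [->|/uE ub] := eqVneq (u b) 0; first by rewrite mulr0 !mul0r.
  have [->|/uE uc] := eqVneq (u c) 0; first by rewrite mulr0 !mul0r.
  by case: ua ub uc => -> [] -> [] ->; rewrite ?tirr ?tiiz ?tizz mulr0.
(* Going along [u] until a weight of the support vanishes shrinks the support and keeps the total;
   the form is affine along the way, so a nonnegative increment is enough. *)
have step a : (forall k, 0 <= w k + a * u k) ->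
    (exists2 k, k \in S & w k + a * u k == 0) ->
    0 <= a * trilin u w w -> trilin w w w <= C * (\sum_i w i) ^+ 3.
  move=> v0 [k kS vk0] da; set v := fun k => w k + a * u k.
  have -> : \sum_i w i = \sum_i v i.
    by rewrite /v big_split /= -mulr_sumr sumu mulr0 addr0.
  apply: le_trans (IHn v _ v0); last first.
    apply: leq_trans lewn; apply: proper_card; apply/properP; split; last first.
      by exists k => //; rewrite inE negbK.
    apply/subsetP => l; rewrite inE /v; apply: contraR => lS.
    have -> : u l = 0.
      by apply: uo; apply: contraNneq lS => ->.
    by rewrite wS // mulr0 addr0.
  rewrite cubic_line Buuw Buuu mul0rn !mulr0 !addr0 lerDl mulrnAr.
  by rewrite mulrn_wge0.
have [d0|d0] := leP 0 (trilin u w w).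
  apply: (step (w j)); [|exists j|by rewrite mulr_ge0] => //; last first.
    by rewrite uj mulrN1 subrr.
  move=> k; have [->|ki] := eqVneq k i; first by rewrite ui mulr1 addr_ge0.
  have [->|kj] := eqVneq k j; first by rewrite uj mulrN1 subrr.
  by rewrite uo // mulr0 addr0.
apply: (step (- w i)); [|exists i|] => //; last first.
- by rewrite mulNr oppr_ge0 mulr_ge0_le0 // ltW.
- by rewrite ui mulr1 subrr.
move=> k; have [->|ki] := eqVneq k i; first by rewrite ui mulr1 subrr.
have [->|kj] := eqVneq k j; first by rewrite uj mulrN1 opprK addr_ge0.
by rewrite uo // mulr0 addr0.
Qed.

(** * Weights on linear spaces with small blocks *)

Section LinearSpace.
Variables (S : {set I}) (w : I -> K).
Hypothesis w0 : forall i, 0 <= w i.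
Hypothesis wS : forall i, i \notin S -> w i = 0.
Hypothesis closedS : forall u v c d, u \in S -> v \in S -> c \in S -> d \in S ->
  t u v c -> t u v d -> c != d -> t u c d.

(** The line spanned by a pair of points: under [closedS], being a third vertex behaves like
    collinearity, and any three distinct points of a block form an edge. *)
Definition block (p : I * I) : {set I} :=
  [set c in S | [|| c == p.1, c == p.2 | t p.1 p.2 c]].
Definition weight (B : {set I}) : K := \sum_(c in B) w c.
Definition in_pairs (B : {set I}) (p : I * I) :=
  [&& p.1 \in B, p.2 \in B & p.1 != p.2].
Definition pair_sum (B : {set I}) : K :=
  \sum_(p | in_pairs B p) w p.1 * w p.2.
Definition triple_sum (B : {set I}) : K :=
  \sum_(p | in_pairs B p) w p.1 * w p.2 * (weight B - w p.1 - w p.2).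

Lemma block_sub p c : in_pairs S p -> c \in block p -> c != p.1 ->
  block p \subset block (p.1, c).
Proof.
case: p => u v /and3P[/= uS vS uv] cB cu.
have cS : c \in S by move: cB; rewrite inE => /andP[].
apply/subsetP => y yB; have yS : y \in S by move: yB; rewrite inE => /andP[].
move: cB yB; rewrite !inE cS yS (negbTE cu) /=.
have [-> _|cv /= tc] := eqVneq c v; first by case/or3P=> ->; rewrite ?orbT.
have [->//|yu] := eqVneq y u; have [->|yc] := eqVneq y c; first by rewrite orbT.
have [-> _|yv /=] := eqVneq y v; first by rewrite tC23 tc !orbT.
by move=> ty; apply: (closedS uS vS) => //; rewrite eq_sym.
Qed.

Lemma block_eq_left p c : in_pairs S p -> c \in block p -> c != p.1 ->
  block (p.1, c) = block p.
Proof.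
move=> hp cB cu; apply/eqP; rewrite eqEsubset block_sub // andbT.
case: p hp cB cu => u v hp cB cu; case/and3P: (hp) => /= uS vS uv.
have cS : c \in S by move: cB; rewrite inE => /andP[].
apply: (@block_sub (u, c)); rewrite ?[_ == u]eq_sym //=.
  by rewrite /in_pairs /= uS cS eq_sym.
move/subsetP: (block_sub hp cB cu) => /(_ v); apply.
by rewrite inE vS eqxx orbT.
Qed.

Lemma blockC u v : block (u, v) = block (v, u).
Proof. by apply/setP => c; rewrite !inE tC12 orbCA. Qed.

(** The axiom of a linear space: a pair inside a block spans that same block. Hence the blocks
    partition the pairs of [S], which justifies [sum_blocks]. *)
Lemma blockP p q : in_pairs S p ->
  (in_pairs S q && (block q == block p)) = in_pairs (block p) q.
Proof.
case: p q => u v [x y] hp; case/and3P: (hp) => /= uS vS uv.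
apply/andP/idP => [[/and3P[/= xS yS xy] /eqP<-]|/and3P[/= xB yB xy]].
  by rewrite /in_pairs /= !inE xS yS !eqxx orbT xy.
have xS : x \in S by move: xB; rewrite inE => /andP[].
have yS : y \in S by move: yB; rewrite inE => /andP[].
rewrite /in_pairs xS yS xy; split=> //.
have [xu|xu] := eqVneq x u.
  by rewrite xu; apply/eqP/(block_eq_left hp) => //=; rewrite eq_sym -xu.
have e1 : block (u, x) = block (u, v) by apply: (block_eq_left hp).
have e2 : block (x, u) = block (u, v) by rewrite blockC.
rewrite -e2; apply/eqP; apply: (@block_eq_left (x, u)).
- by rewrite /in_pairs /= xS uS.
- by rewrite e2.
- by rewrite /= eq_sym.
Qed.

Definition blocks : {set {set I}} := [set block p | p in in_pairs S].

Lemma sum_blocks (g : I * I -> K) :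
  \sum_(p | in_pairs S p) g p = \sum_(B in blocks) \sum_(p | in_pairs B p) g p.
Proof.
rewrite (partition_big block (mem blocks)) => [|p hp]; last first.
  by apply/imsetP; exists p.
apply: eq_bigr => _ /imsetP[p hp ->]; apply: eq_bigl => q.
exact: blockP.
Qed.

Lemma trilin_blocks : trilin w w w = \sum_(B in blocks) triple_sum B.
Proof.
pose g p := w p.1 * w p.2 * (weight (block p) - w p.1 - w p.2).
have -> : \sum_(B in blocks) triple_sum B =
    \sum_(B in blocks) \sum_(p | in_pairs B p) g p.
  apply: eq_bigr => _ /imsetP[p hp ->]; apply: eq_bigr => q.
  by rewrite -blockP // /g => /andP[_ /eqP->].
rewrite -sum_blocks /trilin.
have e i j : \sum_k w i * w j * w k * (t i j k)%:R =
    w i * w j * \sum_k w k * (t i j k)%:R.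
  by rewrite mulr_sumr; apply: eq_bigr => k _; rewrite mulrA.
under eq_bigr => i _ do under eq_bigr => j _ do rewrite e.
rewrite pair_bigA /= (bigID (in_pairs S)) /= [X in _ + X]big1 ?addr0; last first.
  case=> i j /=; rewrite /in_pairs /=.
  have [iS|/wS->] := boolP (i \in S); last by rewrite !mul0r.
  have [jS|/wS->] := boolP (j \in S); last by rewrite mulr0 mul0r.
  rewrite negbK => /= /eqP->; rewrite big1 ?mulr0 // => k _.
  by rewrite tirr mulr0.
apply: eq_bigr => -[i j] /and3P[/= iS jS ij]; rewrite /g /=; congr (_ * _).
rewrite /weight.
rewrite [in RHS](bigD1 i) /=; last by rewrite inE iS eqxx.
rewrite [in RHS](bigD1 j) /=; last by rewrite inE jS eqxx orbT eq_sym ij.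
set s := (X in _ = _ + (_ + X) - _ - _).
have -> : w i + (w j + s) - w i - w j = s by ring.
rewrite /s [RHS]big_mkcond /=; apply: eq_bigr => k _; rewrite inE /=.
have [kS|/wS->] := boolP (k \in S); last by rewrite ?mul0r ?if_same.
have [->|ki] := eqVneq k i; first by rewrite tC23 tirr mulr0 /= ?andbF.
have [->|kj] := eqVneq k j; first by rewrite tC12 tC23 tirr mulr0 /= ?andbF.
by rewrite /=; case: (t i j k); rewrite ?mulr1 ?mulr0.
Qed.

Lemma pair_sumE B : pair_sum B = weight B ^+ 2 - \sum_(i in B) w i ^+ 2.
Proof.
have -> : pair_sum B = \sum_(i in B) \sum_(j in B | i != j) w i * w j.
  rewrite pair_big_dep; apply: eq_bigl => -[i j] /=.
  by rewrite /in_pairs /=.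
have e i : i \in B -> \sum_(j in B | i != j) w i * w j = w i * weight B - w i ^+ 2.
  move=> iB; rewrite /weight mulr_sumr [in RHS](bigD1 i iB) /= -expr2.
  rewrite addrC addrK; apply: eq_bigl => j.
  by rewrite eq_sym.
rewrite (eq_bigr _ e) sumrB -mulr_suml -expr2 //.
Qed.

(** Newton's identity [6 e3 = p1^3 - 3 p1 p2 + 2 p3] between the elementary symmetric polynomial and
    the power sums of the weights in the block. *)
Lemma triple_sumE B : triple_sum B =
  weight B ^+ 3 - (weight B * \sum_(i in B) w i ^+ 2) *+ 3
  + (\sum_(i in B) w i ^+ 3) *+ 2.
Proof.
have -> : triple_sum B =
   \sum_(i in B) \sum_(j in B | i != j) w i * w j * (weight B - w i - w j).
  rewrite pair_big_dep; apply: eq_bigl => -[i j] /=.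
  by rewrite /in_pairs /=.
set s := weight B; set p2 := \sum_(i in B) w i ^+ 2.
have e i : i \in B -> \sum_(j in B | i != j) w i * w j * (s - w i - w j) =
   w i * s ^+ 2 - (w i ^+ 2 * s) *+ 2 - w i * p2 + w i ^+ 3 *+ 2.
  move=> iB.
  have -> : \sum_(j in B | i != j) w i * w j * (s - w i - w j) =
     \sum_(j in B) w i * w j * (s - w i - w j) - w i ^+ 2 * (s - w i - w i).
    rewrite [in RHS](bigD1 i iB) /= -expr2 addrC addrK.
    by apply: eq_bigl => j; rewrite eq_sym.
  have -> : \sum_(j in B) w i * w j * (s - w i - w j) =
     w i * (s - w i) * s - w i * p2.
    rewrite [in X in _ * _ * X]/s /weight /p2 !mulr_sumr -sumrB.
    by apply: eq_bigr => j _; ring.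
  ring.
rewrite (eq_bigr _ e) big_split !sumrB /= !sumrMnl -!mulr_suml.
rewrite -/(weight B) -/s -/p2; ring.
Qed.

Lemma weight_sub (B : {set I}) : B \subset S -> weight B <= \sum_i w i.
Proof.
move=> BS; rewrite [leRHS](bigID (mem B)) /= lerDl; exact: sumr_ge0.
Qed.

(* With x the weight of the heaviest block, its triples are estimated by x ^ 3 and
   those of the other blocks by x times the weight of the remaining pairs. *)
Lemma linear_space_le (a k C : K) : 0 <= k -> 0 <= C ->
  (forall x s : K, 0 <= x -> x <= s ->
     a * x ^+ 3 + k * x * (s ^+ 2 - x ^+ 2) <= C * s ^+ 3) ->
  (forall B : {set I}, B \in blocks -> triple_sum B <= a * weight B ^+ 3) ->
  (forall B : {set I}, B \in blocks -> triple_sum B <= k * weight B * pair_sum B) ->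
  trilin w w w <= C * (\sum_i w i) ^+ 3.
Proof.
move=> k0 C0 fin h1 h2; rewrite trilin_blocks.
have s0 : 0 <= \sum_i w i by apply: sumr_ge0.
have ps0 (B : {set I}) : 0 <= pair_sum B.
  by apply: sumr_ge0 => p _; apply: mulr_ge0.
case: (pickP (mem blocks)) => [B1 B1L|L0]; last first.
  by rewrite big_pred0 // mulr_ge0 // exprn_ge0.
case: (@Order.TotalTheory.arg_maxP _ _ _ B1 (mem blocks) weight B1L) => B0 B0L maxB.
have BS (B : {set I}) : B \in blocks -> B \subset S.
  by case/imsetP=> p _ ->; apply/subsetP => c; rewrite inE => /andP[].
have wB0 : 0 <= weight B0 by apply: sumr_ge0.
apply: le_trans (fin (weight B0) (\sum_i w i) wB0 (weight_sub (BS _ B0L))).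
rewrite (bigD1 B0) //= lerD //; first exact: h1.
apply: (@le_trans _ _ (k * weight B0 * \sum_(B in blocks | B != B0) pair_sum B)).
  rewrite mulr_sumr; apply: ler_sum => B /andP[BL _].
  apply: le_trans (h2 B BL) _; rewrite ler_wpM2r // ler_wpM2l //.
  exact: maxB.
rewrite ler_wpM2l ?mulr_ge0 //.
have -> : \sum_(B in blocks | B != B0) pair_sum B = pair_sum S - pair_sum B0.
  have -> : pair_sum S = \sum_(B in blocks) pair_sum B by exact: sum_blocks.
  by rewrite [in RHS](bigD1 B0) //= [RHS]addrAC subrr add0r.
rewrite !pair_sumE.
have -> : weight S = \sum_i w i.
  rewrite [RHS](bigID (mem S)) /= [X in _ + X]big1 ?addr0 // => i /wS//.
(* The pair sums carry the squares of the weights with a minus sign; as those of [B0] are among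
   those of [S], the difference of the pair sums is at most [s ^+ 2 - x ^+ 2]. *)
have : \sum_(i in B0) w i ^+ 2 <= \sum_(i in S) w i ^+ 2.
  rewrite [leRHS](big_setID B0) /= (setIidPr (BS _ B0L)) lerDl.
  by apply: sumr_ge0 => i _; rewrite sqr_ge0.
move: (\sum_(i in B0) _) (\sum_(i in S) _) (_ ^+ 2) (_ ^+ 2) => p q x y; lra.
Qed.

(** Zeros do not change power sums of positive exponent, so a block with at most m points can be
    treated as m variables in a fixed polynomial inequality. *)
Lemma padded_weights (B : {set I}) m : (#|B| <= m)%N ->
  exists2 s : seq K, size s = m /\ all (fun x => 0 <= x) s &
  forall k, \sum_(i in B) w i ^+ k.+1 = \sum_(x <- s) x ^+ k.+1.
Proof.
move=> Bm; exists (map w (enum B) ++ nseq (m - #|B|) 0).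
  rewrite size_cat size_map size_nseq -cardE subnKC // all_cat all_nseq lexx orbT.
  by rewrite andbT all_map; split=> //; apply/allP => i _; apply: w0.
move=> k; rewrite big_cat big_map big_enum /= [X in _ = _ + X]big1_seq ?addr0 //.
by move=> x /=; rewrite mem_nseq => /andP[_ /eqP->]; rewrite exprS mul0r.
Qed.

Lemma weightE1 (B : {set I}) : weight B = \sum_(i in B) w i ^+ 1.
Proof. by []. Qed.

(** As [triple_sum] is 6 e3 and [pair_sum] is 2 e2, these are the Maclaurin inequalities 27 e3 <=
    e1^3 and 9 e3 <= e1 e2, with equality at equal weights. *)
Lemma triple_sum_le3 (B : {set I}) : (#|B| <= 3)%N ->
  triple_sum B <= 2 / 9 * weight B ^+ 3 /\
  triple_sum B <= 1 / 3 * weight B * pair_sum B.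
Proof.
move/padded_weights=> [s [ss s0] e]; rewrite triple_sumE pair_sumE weightE1 !e.
case: s ss s0 {e} => [|x [|y [|z []]]] //= _ /and4P[x0 y0 z0 _].
rewrite !big_cons !big_nil !addr0.
have := mulr_ge0 x0 (sqr_ge0 (y - z)); have := mulr_ge0 y0 (sqr_ge0 (x - z)).
have := mulr_ge0 z0 (sqr_ge0 (y - x)).
have := mulr_ge0 x0 (sqr_ge0 (y - x)); have := mulr_ge0 y0 (sqr_ge0 (x - y)).
have := mulr_ge0 z0 (sqr_ge0 (z - x)); have := mulr_ge0 z0 (sqr_ge0 (z - y)).
have := mulr_ge0 x0 (sqr_ge0 (z - x)); have := mulr_ge0 y0 (sqr_ge0 (z - y)).
by move=> ? ? ? ? ? ? ? ? ?; split; lra.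
Qed.

(** For four numbers the inequalities are 16 e3 <= e1^3 and 6 e3 <= e1 e2; the first follows from
    the second and 8 e2 <= 3 e1^2. *)
Lemma triple_sum_le4 (B : {set I}) : (#|B| <= 4)%N ->
  triple_sum B <= 3 / 8 * weight B ^+ 3 /\
  triple_sum B <= 1 / 2 * weight B * pair_sum B.
Proof.
move/padded_weights=> [s [ss s0] e]; rewrite triple_sumE pair_sumE weightE1 !e.
case: s ss s0 {e} => [|x [|y [|z [|t' []]]]] //= _ /and5P[x0 y0 z0 t0 _].
rewrite !big_cons !big_nil !addr0.
have h (a b c : K) : 0 <= a -> 0 <= a * (b - c) ^+ 2.
  by move=> a0; rewrite mulr_ge0 // sqr_ge0.
have e2 : (x ^+ 1 + (y ^+ 1 + (z ^+ 1 + t' ^+ 1))) ^+ 3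
   - ((x ^+ 1 + (y ^+ 1 + (z ^+ 1 + t' ^+ 1))) *
      (x ^+ 2 + (y ^+ 2 + (z ^+ 2 + t' ^+ 2)))) *+ 3
   + (x ^+ 3 + (y ^+ 3 + (z ^+ 3 + t' ^+ 3))) *+ 2 <=
   1 / 2 * (x ^+ 1 + (y ^+ 1 + (z ^+ 1 + t' ^+ 1))) *
   ((x ^+ 1 + (y ^+ 1 + (z ^+ 1 + t' ^+ 1))) ^+ 2 -
     (x ^+ 2 + (y ^+ 2 + (z ^+ 2 + t' ^+ 2)))).
  have := h x y z x0; have := h x y t' x0; have := h x z t' x0.
  have := h y x z y0; have := h y x t' y0; have := h y z t' y0.
  have := h z x y z0; have := h z x t' z0; have := h z y t' z0.
  have := h t' x y t0; have := h t' x z t0; have := h t' y z t0.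
  by move=> ? ? ? ? ? ? ? ? ? ? ? ?; lra.
split=> //; apply: le_trans e2 _.
have p0 : 0 <= x + y + z + t' by rewrite !addr_ge0.
have := h _ x y p0; have := h _ x z p0; have := h _ x t' p0.
have := h _ y z p0; have := h _ y t' p0; have := h _ z t' p0.
by move=> ? ? ? ? ? ?; lra.
Qed.

End LinearSpace.

Lemma cubic_linear3 (S : {set I}) (w : I -> K) : (forall i, 0 <= w i) ->
  (forall i, i \notin S -> w i = 0) ->
  (forall u v c d, u \in S -> v \in S -> c \in S -> d \in S ->
    t u v c -> t u v d -> c = d) ->
  trilin w w w <= 2 / 9 * (\sum_i w i) ^+ 3.
Proof.
move=> w0 wS one.
have hB (B : {set I}) : B \in blocks S -> (#|B| <= 3)%N.
  case/imsetP=> -[u v] /and3P[/= uS vS uv] ->.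
  have sub : block S (u, v) \subset [set u; v] :|: [set c in S | t u v c].
    by apply/subsetP => c; rewrite !inE => /andP[->]; rewrite /= orbA.
  apply: leq_trans (subset_leq_card sub) _; apply: leq_trans (leq_card_setU _ _) _.
  rewrite cards2 uv add2n !ltnS; apply/card_le1_eqP => c d.
  by rewrite !inE => /andP[cS tc] /andP[dS td]; apply: (one u v d c).
apply: (@linear_space_le S w w0 wS _ (2 / 9) (1 / 3) (2 / 9)) => //; try lra.
- move=> u v c d uS vS cS dS tc td; rewrite (one u v c d) //.
  by rewrite eqxx.
(* Nine times the difference of the two sides is (s - x)^2 (2s + x): the bound is tight when one
   block carries all the weight. *)
- move=> x s x0 xs; have := mulr_ge0 (mulr_ge0 x0 x0) x0.
  have := mulr_ge0 (sqr_ge0 (s - x)) (addr_ge0 (addr_ge0 x0 (le_trans x0 xs)) (le_trans x0 xs)).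
  lra.
- by move=> B /hB /(triple_sum_le3 w0)[].
- by move=> B /hB /(triple_sum_le3 w0)[].
Qed.

Lemma cubic_linear4 (S : {set I}) (w : I -> K) : (forall i, 0 <= w i) ->
  (forall i, i \notin S -> w i = 0) ->
  (forall u v c d, u \in S -> v \in S -> c \in S -> d \in S ->
    t u v c -> t u v d -> c != d -> t u c d) ->
  (forall u v c d e, u \in S -> v \in S -> c \in S -> d \in S -> e \in S ->
    t u v c -> t u v d -> t u v e -> [|| c == d, d == e | e == c]) ->
  trilin w w w <= 3 / 8 * (\sum_i w i) ^+ 3.
Proof.
move=> w0 wS clo two.
have hB (B : {set I}) : B \in blocks S -> (#|B| <= 4)%N.
  case/imsetP=> -[u v] /and3P[/= uS vS uv] ->.
  have sub : block S (u, v) \subset [set u; v] :|: [set c in S | t u v c].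
    by apply/subsetP => c; rewrite !inE => /andP[->]; rewrite /= orbA.
  apply: leq_trans (subset_leq_card sub) _; apply: leq_trans (leq_card_setU _ _) _.
  rewrite cards2 uv add2n !ltnS leqNgt; apply/card_gt2P => -[c [d [e]]].
  rewrite !inE => -[[/andP[cS tc] /andP[dS td] /andP[eS te]]].
  case=> /negbTE cd /negbTE de /negbTE ec.
  by have := two u v c d e uS vS cS dS eS tc td te; rewrite cd de ec.
apply: (@linear_space_le S w w0 wS _ (3 / 8) (1 / 2) (3 / 8)) => //; try lra.
(* Eight times the difference of the two sides is (s - x)(3s^2 - xs - x^2), nonnegative for x <=
   s. *)
- move=> x s x0 xs; have d0 : 0 <= s - x by lra.
  have s0 := le_trans x0 xs.
  have := mulr_ge0 x0 (sqr_ge0 (s - x)).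
  have := mulr_ge0 s0 (sqr_ge0 (s - x)).
  have := mulr_ge0 (mulr_ge0 d0 x0) x0.
  have := mulr_ge0 (mulr_ge0 d0 x0) s0.
  have := mulr_ge0 (mulr_ge0 d0 d0) d0.
  lra.
- by move=> B /hB /(triple_sum_le4 w0)[].
- by move=> B /hB /(triple_sum_le4 w0)[].
Qed.

(** * Pushing weights forward to a template *)

Lemma sum_fibers (S : {set I}) (g : nat -> K) (v : I -> K) (f : I -> nat) m :
  (forall i, i \notin S -> v i = 0) -> (forall i, i \in S -> (f i < m)%N) ->
  \sum_i v i * g (f i) =
  \sum_(x <- iota 0 m) (\sum_(i in S | f i == x) v i) * g x.
Proof.
move=> vS fm.
under [RHS]eq_bigr => x _.
  rewrite mulr_suml (eq_bigr (fun i => v i * g (f i))); last first.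
    by move=> i /andP[_ /eqP->].
  over.
rewrite (bigID (mem S)) /= [X in _ + X]big1 ?addr0; last first.
  by move=> i /vS->; rewrite mul0r.
under [RHS]eq_bigr => x _ do rewrite big_mkcondr.
rewrite exchange_big; apply: eq_bigr => i iS /=.
rewrite (bigD1_seq (f i)) ?iota_uniq ?mem_iota ?add0n ?fm //= eqxx big1 ?addr0 //.
by move=> x; rewrite eq_sym => /negbTE->.
Qed.

(** Merging the weights of all points with the same label keeps the total, and since edges go to
    edges of [t0] the form can only grow. The edges of [t0] are filtered from an explicit list so
    that they can be computed. *)
Lemma trilin_template (S : {set I}) (w : I -> K) (f : I -> nat) m
    (t0 : nat -> nat -> nat -> bool) (C : K) : (forall i, 0 <= w i) ->
  (forall i, i \notin S -> w i = 0) -> (forall i, i \in S -> (f i < m)%N) ->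
  (forall i j k, i \in S -> j \in S -> k \in S ->
     t i j k -> t0 (f i) (f j) (f k)) ->
  (forall W : nat -> K, (forall x, 0 <= W x) ->
     \sum_(p <- [seq p <- allpairs pair (allpairs pair (iota 0 m) (iota 0 m))
       (iota 0 m) | t0 p.1.1 p.1.2 p.2]) W p.1.1 * W p.1.2 * W p.2
      <= C * (\sum_(x <- iota 0 m) W x) ^+ 3) ->
  trilin w w w <= C * (\sum_i w i) ^+ 3.
Proof.
move=> w0 wS fm tt0 hC.
pose W x := \sum_(i in S | f i == x) w i.
have W0 x : 0 <= W x by apply: sumr_ge0.
have -> : \sum_i w i = \sum_(x <- iota 0 m) W x.
  have := sum_fibers (fun _ => 1) wS fm.
  under eq_bigr do rewrite mulr1; move=> ->.
  by apply: eq_bigr => x _; rewrite mulr1.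
apply: le_trans (hC W W0).
rewrite big_filter big_mkcond big_allpairs big_allpairs.
pose G x y z := w x * w y * w z * (t0 (f x) (f y) (f z))%:R.
apply: (@le_trans _ _ (\sum_i \sum_j \sum_k G i j k)).
  apply: ler_sum => i _; apply: ler_sum => j _; apply: ler_sum => k _.
  rewrite /G; have [iS|/wS->] := boolP (i \in S); last by rewrite !mul0r lexx.
  have [jS|/wS->] := boolP (j \in S); last by rewrite mulr0 ?mul0r lexx.
  have [kS|/wS->] := boolP (k \in S); last by rewrite mulr0 ?mul0r lexx.
  apply: ler_wpM2l; first by rewrite !mulr_ge0.
  rewrite ler_nat; have := tt0 i j k iS jS kS.
  by case: (t i j k) => // ->.
have e3 i j : \sum_k G i j k =
    w i * (w j * \sum_(z <- iota 0 m) W z * (t0 (f i) (f j) z)%:R).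
  have := sum_fibers (fun z => (t0 (f i) (f j) z)%:R) wS fm.
  move=> <-; rewrite !mulr_sumr; apply: eq_bigr => k _.
  by rewrite /G !mulrA.
have e2 i : \sum_j \sum_k G i j k = w i * \sum_(y <- iota 0 m) W y *
   \sum_(z <- iota 0 m) W z * (t0 (f i) y z)%:R.
  under eq_bigr do rewrite e3; rewrite -mulr_sumr.
  have := sum_fibers
    (fun y => \sum_(z <- iota 0 m) W z * (t0 (f i) y z)%:R) wS fm.
  by move=> <-.
rewrite [leLHS](eq_bigr _ (fun i _ => e2 i)).
rewrite (sum_fibers (fun x => \sum_(y <- iota 0 m) W y *
   \sum_(z <- iota 0 m) W z * (t0 x y z)%:R) wS fm).
apply: ler_sum => x _; rewrite mulr_sumr; apply: ler_sum => y _.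
rewrite !mulr_sumr; apply: ler_sum => z _ /=.
by case: (t0 x y z); rewrite ?mulr1 ?mulr0 //= !mulrA lexx.
Qed.

End Lagrangian.

(** * The extremal configurations *)

(** Vertex 0 is the centre of the equilateral triangle 1, 2, 3; the centre and two vertices form a
    triangle with angles 120, 30, 30. *)
Definition star_edge (i j k : nat) : bool :=
  uniq [:: i; j; k] && (0%N \in [:: i; j; k]).
Definition cyc_dist (m i j : nat) : nat :=
  let d := (i + m - j) %% m in minn d (m - d).
Definition rainbow (a b c : nat) : bool := perm_eq [:: a; b; c] [:: 1; 2; 3].
(** This serves both types in (d): numbering the vertices along the pentagram instead of the
    pentagon makes the diagonals the pairs at cyclic distance 1. *)
Definition penta_edge (i j k : nat) : bool :=
  perm_eq [:: cyc_dist 5 i j; cyc_dist 5 j k; cyc_dist 5 k i] [:: 1; 1; 2].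
Definition hexa_edge (i j k : nat) : bool :=
  rainbow (cyc_dist 6 i j) (cyc_dist 6 j k) (cyc_dist 6 k i).
Definition hepta_edge (i j k : nat) : bool :=
  rainbow (cyc_dist 7 i j) (cyc_dist 7 j k) (cyc_dist 7 k i).


Section Templates.
Import Order.TTheory GRing.Theory Num.Theory.
Import mathcomp.algebra_tactics.ring mathcomp.algebra_tactics.lra.
Local Open Scope ring_scope.
Variable K : realFieldType.

Definition edge_sum (m : nat) (t0 : nat -> nat -> nat -> bool) (W : nat -> K) :=
  \sum_(p <- [seq p <- allpairs pair (allpairs pair (iota 0 m) (iota 0 m))
       (iota 0 m) | t0 p.1.1 p.1.2 p.2]) W p.1.1 * W p.1.2 * W p.2.

Ltac compute_edges :=
  rewrite /edge_sum;
  match goal with |- context [filter ?P ?l] =>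
    let r := eval vm_compute in (filter P l) in
    rewrite (_ : filter P l = r); last by vm_compute
  end;
  rewrite /= !big_cons !big_nil /= !addr0.


Lemma star_sum_le (W : nat -> K) : (forall x, 0 <= W x) ->
  edge_sum 4 star_edge W <= 8 / 27 * (\sum_(x <- iota 0 4) W x) ^+ 3.
Proof.
move=> W0; compute_edges.
move: (W0 0%N) (W0 1%N) (W0 2%N) (W0 3%N).
move: (W 0%N) (W 1%N) (W 2%N) (W 3%N) => x y z t x0 y0 z0 t0.
(* With v = y + z + t the form is at most 2xv^2, and 4(x + v)^3 - 27xv^2 = (v - 2x)^2 (4v + x).
   Equality needs v = 2x, whence the weights 3, 2, 2, 2. *)
have u0 : 0 <= 4 * (y + z + t) + x by lra.
have := mulr_ge0 (sqr_ge0 (y + z + t - 2 * x)) u0.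
have := mulr_ge0 x0 (sqr_ge0 (y - z)).
have := mulr_ge0 x0 (sqr_ge0 (z - t)); have := mulr_ge0 x0 (sqr_ge0 (t - y)).
by lra.
Qed.

Lemma amgm3 (x y z : K) : 0 <= x -> 0 <= y -> 0 <= z ->
  27 * (x * y * z) <= (x + y + z) ^+ 3.
Proof.
move=> x0 y0 z0.
have h (a b c : K) : 0 <= a -> 0 <= a * (b - c) ^+ 2.
  by move=> a0; rewrite mulr_ge0 // sqr_ge0.
have := h x y z x0; have := h y x z y0; have := h z x y z0.
have := h x x y x0; have := h y x y y0; have := h x x z x0.
have := h z x z z0; have := h y y z y0; have := h z y z z0.
by lra.
Qed.

(* With a the smallest weight, the sum is a(b+d)(c+e) + cd(b+e-a), and each product
   is estimated by AM-GM. *)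
Lemma penta_min (a b c d e : K) : 0 <= a -> a <= b -> a <= c -> a <= d -> a <= e ->
  25 * (a * b * c + b * c * d + c * d * e + d * e * a + e * a * b)
    <= (a + b + c + d + e) ^+ 3.
Proof.
move=> a0 ab ac ad ae.
have h1 := mulr_ge0 a0 (sqr_ge0 (b + d - c - e)).
have cd0 : 0 <= b + e - a by lra.
have := amgm3 (le_trans a0 ac) (le_trans a0 ad) cd0.
set s := a + b + c + d + e.
have -> : c + d + (b + e - a) = s - 2 * a by rewrite /s; ring.
have s0 : 0 <= 8 * s + 5 * a by rewrite /s; lra.
(* What remains is 25(a(s - a)^2/4 + (s - 2a)^3/27) <= s^3, and 108 times the difference of its
   sides is (s - 5a)^2 (8s + 5a). *)
have h3 := mulr_ge0 (sqr_ge0 (s - 5 * a)) s0.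
have e4 : 4 * (a * ((b + d) * (c + e))) =
    a * (s - a) ^+ 2 - a * (b + d - c - e) ^+ 2 by rewrite /s; ring.
have e5 : a * b * c + b * c * d + c * d * e + d * e * a + e * a * b =
    a * ((b + d) * (c + e)) + c * d * (b + e - a) by ring.
rewrite e5; move: e4 h1 h3; clearbody s.
move: (a * ((b + d) * (c + e))) (c * d * (b + e - a)) (a * (b + d - c - e) ^+ 2).
by move=> x y z; lra.
Qed.

Lemma penta_sum_le (W : nat -> K) : (forall x, 0 <= W x) ->
  edge_sum 5 penta_edge W <= 6 / 25 * (\sum_(x <- iota 0 5) W x) ^+ 3.
Proof.
move=> W0; compute_edges.
move: (W0 0%N) (W0 1%N) (W0 2%N) (W0 3%N) (W0 4%N).
move: (W 0%N) (W 1%N) (W 2%N) (W 3%N) (W 4%N) => a b c d e a0 b0 c0 d0 e0.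
suff : 25 * (a * b * c + b * c * d + c * d * e + d * e * a + e * a * b)
    <= (a + b + c + d + e) ^+ 3 by lra.
have tot (x y : K) : x <= y \/ y <= x by case: (leP x y) => [|/ltW]; [left|right].
(* The form is invariant under rotation, so the smallest weight may be put first, as [penta_min]
   requires. *)
have best : ((a <= b /\ a <= c) /\ (a <= d /\ a <= e)) \/
  ((b <= c /\ b <= d) /\ (b <= e /\ b <= a)) \/
  ((c <= d /\ c <= e) /\ (c <= a /\ c <= b)) \/
  ((d <= e /\ d <= a) /\ (d <= b /\ d <= c)) \/
  ((e <= a /\ e <= b) /\ (e <= c /\ e <= d)).
  case: (tot a b) => ?; case: (tot c d) => ?.
  - case: (tot a c) => ?; [case: (tot a e) => ? | case: (tot c e) => ?];
    first [ by left; do 2!split; lra | by right; right; left; do 2!split; lra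
      | by do 4!right; do 2!split; lra ].
  - case: (tot a d) => ?; [case: (tot a e) => ? | case: (tot d e) => ?];
    first [ by left; do 2!split; lra | by do 3!right; left; do 2!split; lra
      | by do 4!right; do 2!split; lra ].
  - case: (tot b c) => ?; [case: (tot b e) => ? | case: (tot c e) => ?];
    first [ by right; left; do 2!split; lra | by right; right; left; do 2!split; lra
      | by do 4!right; do 2!split; lra ].
  - case: (tot b d) => ?; [case: (tot b e) => ? | case: (tot d e) => ?];
    first [ by right; left; do 2!split; lra | by do 3!right; left; do 2!split; lra
      | by do 4!right; do 2!split; lra ].
case: best => [|[|[|[]]]] [[h1 h2] [h3 h4]].
- exact: penta_min.
- by have := penta_min b0 h1 h2 h3 h4; lra.
- by have := penta_min c0 h1 h2 h3 h4; lra.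
- by have := penta_min d0 h1 h2 h3 h4; lra.
- by have := penta_min e0 h1 h2 h3 h4; lra.
Qed.

Lemma hexa_sum_le (W : nat -> K) : (forall x, 0 <= W x) ->
  edge_sum 6 hexa_edge W <= 3 / 8 * (\sum_(x <- iota 0 6) W x) ^+ 3.
Proof.
move=> W0; compute_edges.
move: (W0 0%N) (W0 1%N) (W0 2%N) (W0 3%N) (W0 4%N) (W0 5%N).
move: (W 0%N) (W 1%N) (W 2%N) (W 3%N) (W 4%N) (W 5%N).
move=> a b c d e f a0 b0 c0 d0 e0 f0.
have h (x y z : K) : 0 <= x -> 0 <= y -> 0 <= z -> 0 <= x * (y - z) ^+ 2.
  by move=> x0 y0 z0; rewrite mulr_ge0 // sqr_ge0.
have k (x y z : K) : 0 <= x -> 0 <= y * (x - z) ^+ 2 -> True by [].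
set s := a + b + c + d + e + f.
(* An edge is a diameter of the hexagon with one of the other four vertices, so the form is a sum
   over the three diameters. Here pq <= (p + q)^2/4 and (p + q)(s - p - q) <= s^2/4; the sums p + q
   of the three diameters add up to s. *)
have pq (p q : K) : 0 <= p -> 0 <= q -> p + q <= s ->
    p * q * (s - p - q) <= (p + q) * s ^+ 2 / 16.
  move=> p0 q0 ps; have d1 : 0 <= s - p - q by lra.
  have := mulr_ge0 d1 (sqr_ge0 (p - q)).
  have := mulr_ge0 (addr_ge0 p0 q0) (sqr_ge0 (s - 2 * (p + q))).
  by lra.
have h1 := pq a d a0 d0; have h2 := pq b e b0 e0; have h3 := pq c f c0 f0.
have : a * d * (s - a - d) + b * e * (s - b - e) + c * f * (s - c - f)
   <= s ^+ 3 / 16.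
  have {}h1 := h1 _; have {}h2 := h2 _; have {}h3 := h3 _.
  have i1 : a + d <= s by rewrite /s; lra.
  have i2 : b + e <= s by rewrite /s; lra.
  have i3 : c + f <= s by rewrite /s; lra.
  have -> : s ^+ 3 / 16 = (a + d) * s ^+ 2 / 16 + (b + e) * s ^+ 2 / 16 +
     (c + f) * s ^+ 2 / 16 by rewrite /s; field.
  by rewrite !lerD // ?h1 ?h2 ?h3.
by rewrite /s; lra.
Qed.

(* The coefficients make the form nonnegative on each eigenspace of the cyclic
   symmetry of order six of the link of a vertex. *)
Lemma hepta_form_ge0 (x a b c d e f : K) :
  0 <= 6 * x ^+ 2 - 2 * x * (a + b + c + d + e + f)
   + 20 * (a ^+ 2 + b ^+ 2 + c ^+ 2 + d ^+ 2 + e ^+ 2 + f ^+ 2)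
   - 37 * (a * c + c * b + b * f + f * d + d * e + e * a)
   - 36 * (a * f + b * e + c * d)
   + 36 * (a * b + b * d + d * a + c * e + e * f + f * c).
Proof.
have := sqr_ge0 (6 * x - (a + b + c + d + e + f)).
have := sqr_ge0 (a - c + b - f + d - e).
have := sqr_ge0 (2 * a + c - b - 2 * f - d + e).
have := sqr_ge0 (c + b - d - e).
have := sqr_ge0 (2 * a - c - b + 2 * f - d - e).
have := sqr_ge0 (c - b + d - e).
by lra.
Qed.

Lemma hepta_sum_le (W : nat -> K) : (forall x, 0 <= W x) ->
  edge_sum 7 hepta_edge W <= 12 / 49 * (\sum_(x <- iota 0 7) W x) ^+ 3.
Proof.
move=> W0; compute_edges.
move: (W0 0%N) (W0 1%N) (W0 2%N) (W0 3%N) (W0 4%N) (W0 5%N) (W0 6%N).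
move: (W 0%N) (W 1%N) (W 2%N) (W 3%N) (W 4%N) (W 5%N) (W 6%N).
move=> a b c d e f g a0 b0 c0 d0 e0 f0 g0.
(* Weighting the form of each vertex by that vertex and adding the seven rotations gives 49/2 times
   the difference of the two sides. *)
have := mulr_ge0 a0 (hepta_form_ge0 a b c d e f g).
have := mulr_ge0 b0 (hepta_form_ge0 b c d e f g a).
have := mulr_ge0 c0 (hepta_form_ge0 c d e f g a b).
have := mulr_ge0 d0 (hepta_form_ge0 d e f g a b c).
have := mulr_ge0 e0 (hepta_form_ge0 e f g a b c d).
have := mulr_ge0 f0 (hepta_form_ge0 f g a b c d e).
have := mulr_ge0 g0 (hepta_form_ge0 g a b c d e f).
by lra.
Qed.

End Templates.

(** * Reduction to exact configurations *)

Section Compactness.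
Local Open Scope R_scope.

Lemma pbP (P : Prop) : reflect P (pb P).
Proof. by rewrite /pb; case: excluded_middle_informative => h; constructor. Qed.

Lemma distC p q : dist p q = dist q p.
Proof. by rewrite /dist; congr sqrt; ring. Qed.

Lemma dist_triangle p q r : dist p r <= dist p q + dist q r.
Proof. exact: triangle. Qed.

Lemma dist_translate p q r :
  dist (fst p - fst r, snd p - snd r) (fst q - fst r, snd q - snd r) = dist p q.
Proof. by rewrite /dist /=; congr sqrt; ring. Qed.

Lemma coord_le_dist p q : Rabs (fst p - fst q) <= dist p q /\
  Rabs (snd p - snd q) <= dist p q.
Proof.
have h1 := Rle_0_sqr (fst p - fst q); have h2 := Rle_0_sqr (snd p - snd q).
by split; rewrite -sqrt_Rsqr_abs /dist; apply: sqrt_le_1_alt; move: h1 h2;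
  rewrite /Rsqr => h1 h2; lra.
Qed.

Lemma dist_le_coord p q d : Rabs (fst p - fst q) <= d ->
  Rabs (snd p - snd q) <= d -> dist p q <= 2 * d.
Proof.
move=> h1 h2; have d0 : 0 <= d by have := Rabs_pos (fst p - fst q); lra.
rewrite -(sqrt_Rsqr (2 * d)); last lra.
apply: sqrt_le_1_alt; rewrite /Rsqr.
move: h1 h2; rewrite /Rabs; do 2!case: Rcase_abs; nra.
Qed.

(** Only [k <= phi k] is asked of the subsequence: with the explicit rate this suffices for limits,
    and it is preserved by the compositions in [common_subsequence]. *)
Lemma bounded_subsequence (u : nat -> R) M : (forall k, Rabs (u k) <= M) ->
  exists (phi : nat -> nat) (l : R), forall k : nat, (k <= phi k)%N /\
    Rabs (u (phi k) - l) <= / (INR k + 1).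
Proof.
move=> uM.
have [|l hl] := Bolzano_Weierstrass u (fun x => - M <= x <= M) (compact_P3 (- M) M).
  by move=> k; have := uM k; rewrite /Rabs; case: Rcase_abs; lra.
have step (k : nat) : exists m : nat, (k <= m)%N /\ Rabs (u m - l) <= / (INR k + 1).
  have pos : 0 < / (INR k + 1).
    by apply: Rinv_0_lt_compat; have := pos_INR k; lra.
  have nb : neighbourhood (fun x => Rabs (x - l) < / (INR k + 1)) l.
    by exists (mkposreal _ pos).
  have [m [km hm]] := hl _ k nb.
  by exists m; split; [apply/leP|apply: Rlt_le].
by exists (fun k => epsilon (inhabits 0%N)
    (fun m : nat => (k <= m)%N /\ Rabs (u m - l) <= / (INR k + 1))), l => k;
  exact: (epsilon_spec _ _ (step k)).
Qed.

Lemma common_subsequence (T : eqType) (s : seq T) (u : T -> nat -> R) :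
  (forall x, exists M, forall k, Rabs (u x k) <= M) ->
  exists (phi : nat -> nat) (l : T -> R),
    forall k : nat, (k <= phi k)%N /\
    forall x, x \in s -> Rabs (u x (phi k) - l x) <= / (INR k + 1).
Proof.
move=> uM; elim: s => [|x s [phi [l hphi]]].
  by exists id, (fun _ => 0) => k; split.
have [M hM] := uM x.
have [psi [m hpsi]] := @bounded_subsequence (u x \o phi) M (fun k => hM (phi k)).
exists (phi \o psi), (fun y => if y == x then m else l y) => k /=.
have [kpsi hk] := hpsi k; have [h1 h2] := hphi (psi k).
split; first exact: leq_trans kpsi h1.
move=> y; rewrite inE; case: eqP => [-> _ //|_ /= ys].
apply: Rle_trans (h2 _ ys) _; apply: Rinv_le_contravar.
  by have := pos_INR k; lra.
by apply: Rplus_le_compat_r; apply: le_INR; apply/leP.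
Qed.

Lemma Rle_of_inv (x y c : R) : (forall k : nat, x <= y + c * / (INR k + 1)) -> x <= y.
Proof.
move=> h; apply: Rnot_lt_le => yx.
have c0 : 0 < c.
  have := h 0%N; rewrite /= Rplus_0_l Rinv_1; lra.
have pos : 0 < (x - y) / c by apply: Rdiv_lt_0_compat; lra.
have [k [hk /lt_INR/= k0]] := archimed_cor1 _ pos.
have le : / (INR k + 1) < (x - y) / c.
  by apply: Rle_lt_trans hk; apply: Rinv_le_contravar; lra.
have := h k; have : c * / (INR k + 1) < c * ((x - y) / c).
  by apply: Rmult_lt_compat_l.
rewrite /Rdiv (Rmult_comm (x - y)) -Rmult_assoc Rinv_r; lra.
Qed.
Lemma dist_perturb p q p' q' d : dist p p' <= d -> dist q q' <= d ->
  Rabs (dist p q - dist p' q') <= 2 * d.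
Proof.
move=> h1 h2; have t1 := dist_triangle p p' q; have t2 := dist_triangle p' q' q.
have t3 := dist_triangle p' p q'; have t4 := dist_triangle p q q'.
rewrite (distC q' q) in t2; rewrite (distC p' p) in t3.
by apply: Rabs_le; lra.
Qed.

Lemma eps_congruent_sides a b c eps A B C : eps_congruent a b c eps A B C ->
  let d := 2 * (eps * Rmin a (Rmin b c)) in
  [/\ Rabs (dist B C - a) <= d, Rabs (dist C A - b) <= d &
      Rabs (dist A B - c) <= d].
Proof.
case=> A' [B' [C' [[<- [<- <-]] [hA [hB hC]]]]] /=.
by split; apply: dist_perturb.
Qed.

Lemma eps_congruent_le a b c e1 e2 A B C : 0 < a -> 0 < b -> 0 < c -> e1 <= e2 ->
  eps_congruent a b c e1 A B C -> eps_congruent a b c e2 A B C.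
Proof.
move=> a0 b0 c0 le [A' [B' [C' [h [hA [hB hC]]]]]]; exists A', B', C'; split=> //.
have m0 : 0 < Rmin a (Rmin b c) by do 2!apply: Rmin_pos => //.
have : e1 * Rmin a (Rmin b c) <= e2 * Rmin a (Rmin b c).
  by apply: Rmult_le_compat_r; lra.
by move=> ?; split; [|split]; lra.
Qed.

(* The approximate configurations need not be bounded; translating each connected
   component of the hypergraph [E] to the origin makes them so. *)
Lemma limit_realization n a b c (E : {set 'I_n * 'I_n * 'I_n}) :
  0 < a -> 0 < b -> 0 < c ->
  (forall eps, 0 < eps -> exists p : 'I_n -> point, forall x, x \in E ->
     eps_congruent a b c eps (p x.1.1) (p x.1.2) (p x.2)) ->
  exists q : 'I_n -> point, forall x, x \in E ->
     congruent_to a b c (q x.1.1) (q x.1.2) (q x.2).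
Proof.
move=> a0 b0 c0 hE; set m := Rmin a (Rmin b c).
have m0 : 0 < m by do 2!apply: Rmin_pos => //.
have inv_pos (k : nat) : 0 < / (INR k + 1) <= 1.
  have k0 := pos_INR k; split; first by apply: Rinv_0_lt_compat; lra.
  by rewrite -Rinv_1; apply: Rinv_le_contravar; lra.
have inh : inhabited ('I_n -> point) by constructor => _; exact: (0, 0).
pose good (k : nat) (p : 'I_n -> point) := forall x, x \in E ->
  eps_congruent a b c (/ (INR k + 1)) (p x.1.1) (p x.1.2) (p x.2).
pose P k := epsilon inh (good k).
have hP k : good k (P k).
  by apply: epsilon_spec; apply: hE; case: (inv_pos k).
pose pts (x : 'I_n * 'I_n * 'I_n) := [:: x.1.1; x.1.2; x.2].
pose adj i j := [exists x in E, (i \in pts x) && (j \in pts x)].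
have adjC : symmetric adj.
  by move=> i j; apply: eq_existsb => x; rewrite [(i \in _) && _]andbC.
have conC := sym_connect_sym adjC.
have adj_bound i j : adj i j -> forall k, dist (P k i) (P k j) <= a + b + c + 2 * m.
  case/exists_inP=> -[[x y] z] xE /andP[]; rewrite !inE /= => hi hj k.
  have [] := eps_congruent_sides (hP k _ xE); rewrite /= -/m.
  have [k0 k1] := inv_pos k.
  have km : / (INR k + 1) * m <= m by nra.
  have dd p : dist p p = 0.
    rewrite /dist !Rminus_diag; rewrite Rmult_0_l Rplus_0_l; exact: sqrt_0.
  rewrite /Rabs; do 3!case: Rcase_abs => ?; move=> ? ? ?;
  case/or3P: hi => /eqP->; case/or3P: hj => /eqP->;
  rewrite ?dd ?(distC (P k y) (P k x)) ?(distC (P k z) (P k y)) ?(distC (P k x) (P k z)); lra.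
have con_bound i j : connect adj i j ->
    exists M, forall k, dist (P k i) (P k j) <= M.
  case/connectP=> s; elim: s i => [|y s IHs] i /=.
    move=> _ ->; exists 0 => k.
    by rewrite /dist !Rminus_diag Rmult_0_l Rplus_0_l sqrt_0; lra.
  case/andP=> iy ys jl; have [M hM] := IHs y ys jl.
  exists (a + b + c + 2 * m + M) => k.
  have := dist_triangle (P k i) (P k y) (P k j).
  by have := adj_bound _ _ iy k; have := hM k; lra.
pose Q k i := (fst (P k i) - fst (P k (fingraph.root adj i)),
               snd (P k i) - snd (P k (fingraph.root adj i))).
pose u (x : 'I_n * bool) k := if x.2 then fst (Q k x.1) else snd (Q k x.1).
have uM x : exists M, forall k, Rabs (u x k) <= M.
  case: x => i e; have [M hM] := con_bound _ _ (connect_root adj i).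
  exists M => k; have [h1 h2] := coord_le_dist (P k i) (P k (fingraph.root adj i)).
  by have := hM k; rewrite /u /=; case: e => ?; lra.
have [phi [l hl]] := common_subsequence (enum {: 'I_n * bool}) uM.
pose q i : point := (l (i, true), l (i, false)).
exists q => -[[x y] z] xE; rewrite [_.1.1]/= [_.1.2]/= [_.2]/=.
have close k i : dist (q i) (Q (phi k) i) <= 2 * / (INR k + 1).
  have [_ h] := hl k; apply: dist_le_coord.
    by have := h (i, true); rewrite mem_enum Rabs_minus_sym; apply.
  by have := h (i, false); rewrite mem_enum Rabs_minus_sym; apply.
have same i j k : adj i j -> dist (Q k i) (Q k j) = dist (P k i) (P k j).
  move=> ij; have rij : fingraph.root adj i = fingraph.root adj j.
    by apply/eqP; rewrite root_connect // connect1.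
  by rewrite /Q -rij dist_translate.
have in3 i : i \in pts (x, y, z) -> forall j, j \in pts (x, y, z) -> adj i j.
  by move=> hi j hj; apply/exists_inP; exists (x, y, z); rewrite ?hi.
have lim i j s : i \in pts (x, y, z) -> j \in pts (x, y, z) ->
    (forall k, Rabs (dist (P k i) (P k j) - s) <= 2 * (/ (INR k + 1) * m)) ->
    dist (q i) (q j) = s.
  move=> hi hj hs.
  (* The 4 accounts for the two endpoints, each within [2 * / (INR k + 1)] of its limit, and [2 * m]
     for the tolerance of the approximate copies. *)
  have key k : Rabs (dist (q i) (q j) - s) <= 0 + (4 + 2 * m) * / (INR k + 1).
    have h1 := dist_perturb (close k i) (close k j).
    rewrite (same i j (phi k) (in3 i hi j hj)) in h1.
    have [le _] := hl k; have h2 := hs (phi k).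
    have h3 : / (INR (phi k) + 1) <= / (INR k + 1).
      apply: Rinv_le_contravar; first by have := pos_INR k; lra.
      by apply: Rplus_le_compat_r; apply: le_INR; apply/leP.
    have h4 := Rabs_triang (dist (q i) (q j) - dist (P (phi k) i) (P (phi k) j))
      (dist (P (phi k) i) (P (phi k) j) - s).
    move: h4; rewrite (_ : _ - _ + _ = dist (q i) (q j) - s); last ring.
    by have : / (INR (phi k) + 1) * m <= / (INR k + 1) * m; nra.
  have := Rle_of_inv key; have := Rabs_pos (dist (q i) (q j) - s).
  move=> h1 h2; apply: Rminus_diag_uniq.
  by case: (Req_dec (dist (q i) (q j) - s) 0) => // /Rabs_no_R0; lra.
have sides k := eps_congruent_sides (hP k _ xE).
by split; [|split]; apply: lim; rewrite ?inE ?eqxx ?orbT // => k;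
  case: (sides k).
Qed.

Lemma common_eps (T : eqType) (s : seq T) (P : T -> R -> Prop) :
  (forall x e e', e' <= e -> P x e -> P x e') ->
  (forall x, exists2 e, 0 < e & P x e) ->
  exists2 e, 0 < e & forall x, x \in s -> P x e.
Proof.
move=> mono hP; elim: s => [|x s [e e0 he]]; first by exists 1; first lra.
have [d d0 hd] := hP x; exists (Rmin d e); first exact: Rmin_pos.
move=> y; rewrite inE => /orP[/eqP->|ys].
  exact: (mono _ _ _ (Rmin_l d e)).
by apply: (mono _ _ _ (Rmin_r d e)); apply: he.
Qed.

(** There are finitely many systems E of triples. By [limit_realization], an E without exact
    realization already has no approximate one for some positive tolerance; the least of these
    tolerances serves all configurations at once. *)
Lemma exact_realization n a b c : 0 < a -> 0 < b -> 0 < c ->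
  exists2 eps, 0 < eps & forall p : 'I_n -> point,
  exists q : 'I_n -> point, forall i j k,
    eps_congruent a b c eps (p i) (p j) (p k) ->
    congruent_to a b c (q i) (q j) (q k).
Proof.
move=> a0 b0 c0.
pose real (E : {set 'I_n * 'I_n * 'I_n}) := exists q : 'I_n -> point,
  forall x, x \in E -> congruent_to a b c (q x.1.1) (q x.1.2) (q x.2).
pose P (E : {set 'I_n * 'I_n * 'I_n}) e := forall p : 'I_n -> point,
  (forall x, x \in E -> eps_congruent a b c e (p x.1.1) (p x.1.2) (p x.2)) -> real E.
have [||e e0 he] := @common_eps _ (enum {set 'I_n * 'I_n * 'I_n}) P.
- move=> E e e' le hE p hp; apply: (hE p) => x xE.
  by apply: (eps_congruent_le a0 b0 c0 le); apply: hp.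
- move=> E; case: (excluded_middle_informative (real E)) => [rE|nE].
    by exists 1; [lra|move=> p _].
  apply: Coq.Logic.Classical_Prop.NNPP => none; apply: nE.
  apply: limit_realization => // eps eps0.
  apply: Coq.Logic.Classical_Prop.NNPP => nop; apply: none; exists eps => // p hp.
  by case: nop; exists p.
exists e => // p.
pose E := [set x | pb (eps_congruent a b c e (p x.1.1) (p x.1.2) (p x.2))].
have [||q hq] := he E _ p; first by rewrite mem_enum.
  by move=> x; rewrite inE => /pbP.
exists q => i j k h; apply: (hq (i, j, k)).
by rewrite inE; apply/pbP.
Qed.

End Compactness.

(** * Ordered triples and 3-element sets *)

Section OrderedTriples.
Variables (n : nat) (t : 'I_n -> 'I_n -> 'I_n -> bool).
Hypothesis tC12 : forall i j k, t i j k = t j i k.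
Hypothesis tC23 : forall i j k, t i j k = t i k j.
Hypothesis tirr : forall i k, t i i k = false.

Definition edge_sets := [set S : {set 'I_n} |
  [exists i, exists j, exists k, (S == [set i; j; k]) && t i j k]].
Definition edge_triples := [set x : 'I_n * 'I_n * 'I_n | t x.1.1 x.1.2 x.2].

Lemma edge_neq i j k : t i j k -> [/\ i != j, j != k & i != k].
Proof.
move=> tijk; split; apply: contraTneq tijk => ->; first by rewrite tirr.
  by rewrite tC12 tC23 tirr.
by rewrite tC23 tirr.
Qed.

Lemma card_edge_sets : #|edge_triples| = 6 * #|edge_sets|.
Proof.
pose f (x : 'I_n * 'I_n * 'I_n) := [set x.1.1; x.1.2; x.2].
rewrite -sum1_card (partition_big f [in edge_sets]) => [|x]; last first.
  rewrite !inE /= => tx; apply/existsP; exists x.1.1.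
  by apply/existsP; exists x.1.2; apply/existsP; exists x.2; rewrite eqxx.
rewrite mulnC -sum_nat_const; apply: eq_bigr => S.
rewrite inE => /existsP[i /existsP[j /existsP[k /andP[/eqP-> tijk]]]].
have [ij jk ik] := edge_neq tijk; rewrite sum1dep_card.
pose s := [:: (i, j, k); (i, k, j); (j, i, k); (j, k, i); (k, i, j); (k, j, i)].
have us : uniq s.
  rewrite /= !inE !xpair_eqE !eqxx.
  by rewrite ![k == _]eq_sym ![j == i]eq_sym (negbTE ij) (negbTE jk) (negbTE ik) /= ?andbF.
rewrite -(card_uniqP us : #|s| = 6)%N; apply: eq_card => -[[x y] z].
rewrite inE /= inE /= /f /=; apply/andP/idP => [[txyz /eqP e]|].
  have [xy yz xz] := edge_neq txyz.
  have hx : x \in [set i; j; k] by rewrite -e !inE eqxx.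
  have hy : y \in [set i; j; k] by rewrite -e !inE eqxx orbT.
  have hz : z \in [set i; j; k] by rewrite -e !inE eqxx orbT.
  move: hx hy hz xy yz xz; rewrite !inE !xpair_eqE.
  by case/orP => [/orP[]|] /eqP->; case/orP => [/orP[]|] /eqP->;
     case/orP => [/orP[]|] /eqP->; rewrite ?eqxx ?orbT.
have tj : t j i k by rewrite tC12. have tk : t i k j by rewrite tC23.
have tjk : t j k i by rewrite tC23 tC12. have tki : t k i j by rewrite tC12.
have tkj : t k j i by rewrite tC12.
rewrite !inE !xpair_eqE.
by case/or4P => [||| /or3P[]] /andP[/andP[/eqP-> /eqP->] /eqP->]; split=> //;
  apply/eqP/setP => w; rewrite !inE; case: (w == i); case: (w == j); case: (w == k).
Qed.
End OrderedTriples.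

(** * From h to the number of exact copies *)

Section Reduction.
Local Open Scope R_scope.

Definition sqd (p q : point) : R :=
  (fst p - fst q) * (fst p - fst q) + (snd p - snd q) * (snd p - snd q).

Definition perm3 (x y z A B C : R) : Prop :=
  (x = A /\ y = B /\ z = C) \/ (x = A /\ y = C /\ z = B) \/
  (x = B /\ y = A /\ z = C) \/ (x = B /\ y = C /\ z = A) \/
  (x = C /\ y = A /\ z = B) \/ (x = C /\ y = B /\ z = A).

(** A, B, C are the squared sides. They may occur in any order, which makes the relation symmetric
    in the three points, unlike [congruent_to]. *)
Definition tri (A B C : R) (u v w : point) : Prop :=
  perm3 (sqd u v) (sqd v w) (sqd w u) A B C.

Lemma sqdC u v : sqd u v = sqd v u.
Proof. by rewrite /sqd; ring. Qed.

Lemma sqd_refl u : sqd u u = 0.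
Proof. by rewrite /sqd; ring. Qed.

Lemma sqd_ge0 u v : 0 <= sqd u v.
Proof.
have := Rle_0_sqr (fst u - fst v); have := Rle_0_sqr (snd u - snd v).
by rewrite /Rsqr /sqd; lra.
Qed.

Lemma sqd_dist u v : sqd u v = dist u v * dist u v.
Proof. by rewrite /dist sqrt_sqrt //; apply: sqd_ge0. Qed.

Lemma dist_sqd u v d : 0 < d -> sqd u v = d * d -> dist u v = d.
Proof. by move=> d0; rewrite /dist -/(sqd u v) => ->; rewrite sqrt_square; lra. Qed.

Lemma triC12 A B C u v w : tri A B C u v w -> tri A B C v u w.
Proof. by rewrite /tri /perm3 (sqdC v u) (sqdC u w) (sqdC w v); intuition. Qed.

Lemma triC23 A B C u v w : tri A B C u v w -> tri A B C u w v.
Proof. by rewrite /tri /perm3 (sqdC w v) (sqdC v u) (sqdC u w); intuition. Qed.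

Lemma tri_neq A B C u v w : 0 < A -> 0 < B -> 0 < C -> tri A B C u v w -> u <> v.
Proof.
by move=> A0 B0 C0 h uv; move: h; rewrite uv /tri /perm3 sqd_refl; intuition lra.
Qed.

Variables (n : nat) (a b c : R).
Hypotheses (a0 : 0 < a) (b0 : 0 < b) (c0 : 0 < c).

Definition ctri (u v w : point) : bool := pb (tri (a * a) (b * b) (c * c) u v w).

Lemma ctriC12 u v w : ctri u v w = ctri v u w.
Proof. by apply/pbP/pbP; apply: triC12. Qed.

Lemma ctriC23 u v w : ctri u v w = ctri u w v.
Proof. by apply/pbP/pbP; apply: triC23. Qed.

Lemma ctri_irr u w : ctri u u w = false.
Proof. by apply/pbP => h; apply: (tri_neq _ _ _ h) => //; nra. Qed.

Lemma congruent_tri A B C : congruent_to a b c A B C -> ctri A B C.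
Proof.
by case=> h1 [h2 h3]; apply/pbP; rewrite /tri !sqd_dist h1 h2 h3 /perm3; tauto.
Qed.

Lemma tri_congruent A B C : ctri A B C ->
  [\/ congruent_to a b c A B C \/ congruent_to a b c A C B,
      congruent_to a b c B A C \/ congruent_to a b c B C A |
      congruent_to a b c C A B \/ congruent_to a b c C B A].
Proof.
have d u v s : 0 < s -> sqd u v = s * s -> dist u v = s /\ dist v u = s.
  by move=> s0 e; rewrite [dist v u]distC (dist_sqd s0 e).
move/pbP; rewrite /congruent_to.
case=> [|[|[|[|[|]]]]] [h1 [h2 h3]];
  have := d _ _ _ _ h1; have := d _ _ _ _ h2; have := d _ _ _ _ h3;
  move=> /(_ ltac:(assumption)) [? ?] /(_ ltac:(assumption)) [? ?]
         /(_ ltac:(assumption)) [? ?];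
  by [ apply: Or31; left | apply: Or31; right | apply: Or32; left
     | apply: Or32; right | apply: Or33; left | apply: Or33; right ].
Qed.

Definition config_triples (q : 'I_n -> point) : {set 'I_n * 'I_n * 'I_n} :=
  edge_triples (fun i j k => ctri (q i) (q j) (q k)).

Lemma bigminn_le (T : eqType) (r : seq T) (P : pred T) (F : T -> nat) d x :
  x \in r -> P x -> (\big[minn/d]_(i <- r | P i) F i <= F x)%N.
Proof.
elim: r => // y r IHr; rewrite inE big_cons => /orP[/eqP<- Px|xr Px].
  by rewrite Px geq_minl.
case: ifP => _; last exact: IHr.
by apply: leq_trans (geq_minr _ _) _; apply: IHr.
Qed.

Lemma h_eps_le_bin e : (h_eps n a b c e <= 'C(n, 3))%N.
Proof. by apply/bigmax_leqP => m _; rewrite -ltnS. Qed.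

Lemma h_le e : 0 < e -> (h n a b c <= h_eps n a b c e)%N.
Proof.
move=> e0; have lt : (h_eps n a b c e < ('C(n, 3)).+1)%N by rewrite ltnS h_eps_le_bin.
apply: (@bigminn_le _ _ _ (fun m : 'I_('C(n, 3)).+1 => nat_of_ord m) _ (Ordinal lt)).
  by rewrite mem_index_enum.
by apply/pbP; exists e.
Qed.

(** With the tolerance of [exact_realization], approximate copies in [p] are exact copies in [q].
    The points of [q] may coincide even though [p] is injective, so the hypothesis ranges over all
    [q]. *)
Lemma h_upper X : (forall q, #|config_triples q| <= X)%N -> (6 * h n a b c <= X)%N.
Proof.
move=> hX; have [e e0 he] := exact_realization n a0 b0 c0.
apply: (@leq_trans (6 * h_eps n a b c e)).
  by rewrite leq_mul2l h_le.
rewrite -(@leq_pmul2l 1) // mul1n mul1n.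
apply: (@leq_trans (6 * (X %/ 6))); last by rewrite mulnC leq_trunc_div.
rewrite leq_mul2l /=; apply/bigmax_leqP => m /pbP[p [_ <-]].
have [q hq] := he p; have := hX q.
rewrite /config_triples card_edge_sets; last 3 first.
- by move=> i j k; rewrite ctriC12.
- by move=> i j k; rewrite ctriC23.
- by move=> i k; rewrite ctri_irr.
rewrite mulnC -leq_divRL // => le; apply: leq_trans le.
apply: subset_leq_card; apply/subsetP => S; rewrite !inE => /andP[_ /pbP[i [j [k [-> h]]]]].
apply/existsP; exists i; apply/existsP; exists j; apply/existsP; exists k.
by rewrite eqxx /=; apply: congruent_tri; apply: hq.
Qed.

Lemma h_lower X : (X <= 'C(n, 3))%N ->
  (forall e, 0 < e -> exists2 p : 'I_n -> point, injective p &
     (X <= count_cong p a b c e)%N) ->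
  (X <= h n a b c)%N.
Proof.
(* [Xn] settles the default value ['C(n, 3)] of the minimum. *)
move=> Xn hX; rewrite /h; apply: (big_ind (fun x => (X <= x)%N)) => //.
  by move=> x y hx hy; rewrite leq_min hx.
move=> m /pbP[e [e0 <-]]; have [p inj le] := hX e e0.
apply: leq_trans le _.
have lt : (count_cong p a b c e < ('C(n, 3)).+1)%N.
  rewrite ltnS -[n in 'C(n, 3)]card_ord -card_draws.
  by apply: subset_leq_card; apply/subsetP => S; rewrite !inE => /andP[].
have := @leq_bigmax_cond _ (fun m : 'I_('C(n, 3)).+1 =>
  pb (exists p : 'I_n -> point, injective p /\ count_cong p a b c e = m))
  (fun m => nat_of_ord m) (Ordinal lt).
by apply; apply/pbP; exists p.
Qed.

End Reduction.

Section UpperBound.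
Import Order.TTheory GRing.Theory Num.Theory.
Local Open Scope ring_scope.
Variables (n : nat) (a b c : R).
Hypotheses (a0 : Rlt 0 a) (b0 : Rlt 0 b) (c0 : Rlt 0 c).

Definition config_edge (q : 'I_n -> point) (i j k : 'I_n) : bool :=
  ctri a b c (q i) (q j) (q k).

(** At constant weight 1 the form counts the ordered copies in [q] and the total weight is n. Moving
    weight stays within the rationals, where the final constants are compared by computation. *)
Lemma h_le_cubic (num den : nat) : (0 < den)%N ->
  (forall (q : 'I_n -> point) (S : {set 'I_n}) (w : 'I_n -> rat),
     covered (config_edge q) S -> (forall i, 0 <= w i) ->
     (forall i, i \notin S -> w i = 0) ->
     trilin (config_edge q) w w w <= (6 * num)%:R / den%:R * (\sum_i w i) ^+ 3) ->
  (den * h n a b c <= num * n ^ 3)%N.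
Proof.
move=> den0 hyp.
suff le : (6 * h n a b c <= (6 * num * n ^ 3) %/ den)%N.
  move: le; rewrite leq_divRL // => le.
  by rewrite -(@leq_pmul2l 6) // [leqRHS]mulnA (mulnC den) mulnA.
apply: h_upper => // q; rewrite leq_divRL //.
have := @cubic_le_covered rat _ (config_edge q) _ _ _ _ (hyp q) (fun _ => 1) _.
have -> : \sum_(i : 'I_n) (1 : rat) = n%:R by rewrite sumr_const card_ord.
have -> : trilin (config_edge q) (fun=> 1) (fun=> 1) (fun=> 1) =
    (#|config_triples a b c q|)%:R :> rat.
  rewrite -sum1_card natr_sum big_mkcond /= /trilin.
  rewrite (pair_bigA _ (fun i j => \sum_k _)) /= (pair_bigA _ (fun p k => _)) /=.
  apply: eq_bigr => -[[i j] k] _ /=; rewrite inE /= /config_edge !mul1r.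
  by case: ctri.
rewrite mulrAC ler_pdivlMr ?ltr0n // -natrX -!natrM ler_nat; apply=> //.
- by move=> i j k; apply: ctriC12.
- by move=> i j k; apply: ctriC23.
- by move=> i k; apply: ctri_irr.
Qed.

End UpperBound.

(** * Lower bounds by blowing up a template *)

Section Perturbation.
Local Open Scope R_scope.

(** The n points run cyclically through the template, the i-th being shifted right by [eta * i]. The
    shifts separate points over equal abscissas; different abscissas stay apart because [eta * n] is
    below every nonzero gap. *)
Lemma perturbation (n m : nat) (a b c : R) (q : 'I_m -> point) :
  0 < a -> 0 < b -> 0 < c -> (0 < n)%N -> forall m0 : (0 < m)%N,
  let r (i : 'I_n) : 'I_m := Ordinal (ltn_pmod i m0) in
  forall e, 0 < e -> exists2 p : 'I_n -> point, injective p &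
  forall i j k, congruent_to a b c (q (r i)) (q (r j)) (q (r k)) ->
    eps_congruent a b c e (p i) (p j) (p k).
Proof.
move=> a0 b0 c0 n0 m0 r e e0.
have [||eta eta0 heta] := @common_eps _ (enum {: 'I_m * 'I_m}) (fun x d =>
   (d * INR n <= e * Rmin a (Rmin b c)) /\
   (fst (q x.1) <> fst (q x.2) -> (d * INR n < Rabs (fst (q x.1) - fst (q x.2))))).
- move=> x d d' le [h1 h2]; have ? := pos_INR n.
  by split=> [|/h2 ?]; have : (d' * INR n <= d * INR n); nra.
- move=> x; have n1 : (0 < INR n) by apply: lt_0_INR; apply/ltP.
  have small s : (0 < s) -> exists2 d, (0 < d) & (d * INR n < s).
    move=> s0; exists (s / INR n / 2).
      by do 2!(apply: Rdiv_lt_0_compat; try lra).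
    by rewrite (_ : _ * _ = s / 2); [lra | field; lra].
  have [|d1 d10 h1] := small (e * Rmin a (Rmin b c)).
    by apply: Rmult_lt_0_compat => //; do 2!apply: Rmin_pos => //.
  case: (excluded_middle_informative (fst (q x.1) = fst (q x.2))) => [eq|ne].
    by exists d1 => //; split; [lra|].
  have [|d2 d20 h2] := small (Rabs (fst (q x.1) - fst (q x.2))).
    by apply: Rabs_pos_lt; lra.
  exists (Rmin d1 d2); first exact: Rmin_pos.
  have := Rmin_l d1 d2; have := Rmin_r d1 d2 => ? ?.
  by split=> [|_]; nra.
pose p (i : 'I_n) : point := (fst (q (r i)) + eta * INR i, snd (q (r i))).
have INRn (i : 'I_n) : (0 <= INR i <= INR n).
  by split; [apply: pos_INR | apply: le_INR; apply/leP/ltnW].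
exists p.
  move=> i j; rewrite /p => -[e1 _].
  have [_ h2] := heta (r i, r j) ltac:(by rewrite mem_enum).
  have [li ui] := INRn i; have [lj uj] := INRn j.
  case: (excluded_middle_informative (fst (q (r i)) = fst (q (r j)))) => [eq|ne].
    apply/val_inj/INR_eq; rewrite eq in e1.
    rewrite -[\val i]/(nat_of_ord i) -[\val j]/(nat_of_ord j).
    by apply: (Rmult_eq_reg_l eta); [lra | apply: Rgt_not_eq].
  have := h2 ne; rewrite /= (_ : _ - _ = eta * (INR j - INR i)); last lra.
  rewrite Rabs_mult (Rabs_pos_eq eta); last lra.
  have : (Rabs (INR j - INR i) <= INR n) by apply: Rabs_le; lra.
  by nra.
have near (l : 'I_n) : (dist (p l) (q (r l)) <= e * Rmin a (Rmin b c)).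
  have [h1 _] := heta (r l, r l) ltac:(by rewrite mem_enum).
  have [? ?] := INRn l.
  rewrite /dist /p /= (_ : _ + _ = (eta * INR l) * (eta * INR l)); last ring.
  by rewrite sqrt_square; nra.
by move=> i j k h; exists (q (r i)), (q (r j)), (q (r k)).
Qed.

End Perturbation.

Section LowerBound.
Variables (n m : nat) (a b c : R) (q : 'I_m -> point).
Hypotheses (a0 : Rlt 0 a) (b0 : Rlt 0 b) (c0 : Rlt 0 c).
Hypotheses (n0 : 0 < n) (m0 : 0 < m) (mn : m %| n).

Lemma sum_mod (F : nat -> nat) :
  \sum_(i < n) F (i %% m) = (n %/ m) * \sum_(x <- iota 0 m) F x.
Proof.
rewrite -(big_mkord xpredT (fun i => F (i %% m))) -[X in \sum_(0 <= i < X) _](divnK mn).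
elim: (n %/ m) => [|k IHk]; first by rewrite mul0n big_nil.
rewrite mulSnr (@big_cat_nat _ _ _ (k * m)) ?leq_addr //= IHk mulSnr; congr (_ + _).
rewrite -{1}[k * m]add0n big_addn addKn /index_iota subn0.
rewrite [LHS]big_seq [RHS]big_seq; apply: eq_bigr => x.
by rewrite mem_iota add0n => /andP[_ xm]; rewrite addnC modnMDl modn_small.
Qed.

(** Each template vertex is replaced by n / m nearby points, so each ordered edge of the template
    lifts to (n / m)^3 ordered approximate copies. *)
Lemma h_ge_template (t0 : nat -> nat -> nat -> bool) :
  (forall x y z : 'I_m, t0 x y z -> tri (Rmult a a) (Rmult b b) (Rmult c c) (q x) (q y) (q z)) ->
  (n %/ m) ^ 3 * size [seq p <- allpairs pair (allpairs pair (iota 0 m) (iota 0 m))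
       (iota 0 m) | t0 p.1.1 p.1.2 p.2] <= 6 * h n a b c.
Proof.
move=> ht0.
pose r (i : 'I_n) : 'I_m := Ordinal (ltn_pmod i m0).
pose t i j k := ctri a b c (q (r i)) (q (r j)) (q (r k)).
have tC12 i j k : t i j k = t j i k by apply: ctriC12.
have tC23 i j k : t i j k = t i k j by apply: ctriC23.
have tirr i k : t i i k = false by apply: ctri_irr.
apply: (@leq_trans #|edge_triples t|).
  have -> : #|edge_triples t| =
      \sum_(i < n) \sum_(j < n) \sum_(k < n) (t i j k : nat).
    rewrite -sum1_card big_mkcond /=.
    rewrite (pair_bigA _ (fun i j => \sum_k _)) /= (pair_bigA _ (fun p k => _)) /=.
    by apply: eq_bigr => -[[i j] k] _ /=; rewrite inE /=; case: (t i j k).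
  apply: (@leq_trans (\sum_(i < n) \sum_(j < n) \sum_(k < n) t0 (i %% m) (j %% m) (k %% m))).
    under [leqRHS]eq_bigr => i _ do
      (under eq_bigr => j _ do rewrite (sum_mod (fun z => t0 (i %% m) (j %% m) z))).
    under [leqRHS]eq_bigr => i _ do
      rewrite (sum_mod (fun y => n %/ m * \sum_(z <- iota 0 m) t0 (i %% m) y z)).
    rewrite (sum_mod (fun x => n %/ m * \sum_(y <- iota 0 m)
        (n %/ m * \sum_(z <- iota 0 m) t0 x y z))).
    rewrite -big_distrr /=; under eq_bigr do rewrite -big_distrr /=.
    rewrite -big_distrr /= !expnS expn0 muln1 -!mulnA !leq_mul2l; apply/orP; right.
    apply/orP; right; apply/orP; right.
    rewrite -sum1_size big_filter big_mkcond big_allpairs big_allpairs /=.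
    apply: leq_sum => x _; apply: leq_sum => y _; apply: leq_sum => z _.
    by case: (t0 x y z).
  apply: leq_sum => i _; apply: leq_sum => j _; apply: leq_sum => k _.
  case e: (t0 _ _ _) => //; suff -> : t i j k by [].
  by apply/pbP; apply: ht0.
rewrite card_edge_sets // leq_mul2l /=; apply: h_lower.
  rewrite -[n in 'C(n, 3)]card_ord -card_draws.
  apply: subset_leq_card; apply/subsetP => S; rewrite !inE.
  case/existsP=> i /existsP[j /existsP[k /andP[/eqP-> tijk]]].
  have [ij jk ik] := edge_neq tC12 tC23 tirr tijk.
  by rewrite setUC cardsU1 cards2 ij !inE negb_or ![k == _]eq_sym ik jk.
move=> e /(perturbation q a0 b0 c0 n0 m0)[p inj hp]; exists p => //.
apply: subset_leq_card; apply/subsetP => S; rewrite !inE.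
case/existsP=> i /existsP[j /existsP[k /andP[/eqP-> tijk]]].
have [ij jk ik] := edge_neq tC12 tC23 tirr tijk.
apply/andP; split; first by rewrite setUC cardsU1 cards2 ij !inE negb_or ![k == _]eq_sym ik jk.
apply/pbP.
have use x y z : congruent_to a b c (q (r x)) (q (r y)) (q (r z)) ->
    eps_congruent a b c e (p x) (p y) (p z).
  exact: hp.
(* [eps_congruent] depends on the order of the points but the counted set does not, so the order
   delivered by [tri_congruent] may be chosen. *)
have perm x y z : (forall l, (l \in [set x; y; z]) = (l \in [set i; j; k])) ->
    eps_congruent a b c e (p x) (p y) (p z) -> exists i0 j0 k0 : 'I_n,
    [set i; j; k] = [set i0; j0; k0] /\ eps_congruent a b c e (p i0) (p j0) (p k0).
  by move=> h1 h2; exists x, y, z; split=> //; apply/setP => l; rewrite h1.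
by case: (tri_congruent a0 b0 c0 tijk) => -[] /use /perm; apply=> l; rewrite !inE;
  case: (l == i); case: (l == j); case: (l == k).
Qed.

End LowerBound.

(** * Configurations in which every pair lies in a copy of the triangle *)

From Stdlib Require Import Nsatz.
(* Imported again because [Nsatz] shadows [nth] and rebinds [%N]. *)
From mathcomp Require Import all_boot all_order all_algebra.
Require Import Defs.

Section Covering.
Local Open Scope R_scope.

Definition tri_covered (X : point -> Prop) (A B C : R) : Prop :=
  forall u v, X u -> X v -> u <> v -> exists w, X w /\ tri A B C u v w.

(** The geometric form of the hypothesis of [trilin_template]: copies go to edges of the template,
    nothing is asked of the other triples. *)
Definition labelled (X : point -> Prop) (A B C : R) (m : nat)
    (t0 : nat -> nat -> nat -> bool) : Prop :=
  exists f : point -> nat, (forall p, X p -> (f p < m)%N) /\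
    forall p q r, X p -> X q -> X r -> tri A B C p q r -> t0 (f p) (f q) (f r).

Definition alg_right (A B C : R) : Prop := A + B = C \/ B + C = A \/ C + A = B.
Definition alg_120 (A B C : R) : Prop := exists P, perm3 P P (3 * P) A B C.
(** The sides have ratio 1 : 1 : |t|. The golden ratio t gives the angles 108, 36, 36 and its
    conjugate gives 72, 72, 36. *)
Definition alg_penta (A B C : R) : Prop :=
  exists P t, t * t = t + 1 /\ perm3 P P (t * t * P) A B C.
(** The roots are t = 2 cos(2k pi/7). With t = 2 cos(s), the chords sin(s), sin(2s), sin(3s) of the
    heptagon have ratio 1 : t : t^2 - 1, and (t^2 - 1)^2 = t^2 - t for these t. *)
Definition alg_hepta (A B C : R) : Prop :=
  exists P t, t * t * t + t * t - 2 * t - 1 = 0 /\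
    perm3 P (t * t * P) ((t * t - t) * P) A B C.

Definition exceptional (X : point -> Prop) (A B C : R) : Prop :=
  alg_120 A B C /\ labelled X A B C 4 star_edge \/
  alg_penta A B C /\ labelled X A B C 5 penta_edge \/
  alg_hepta A B C /\ labelled X A B C 7 hepta_edge.

Lemma perm3_trans x y z P Q R A B C :
  perm3 x y z P Q R -> perm3 P Q R A B C -> perm3 x y z A B C.
Proof.
by case=> [|[|[|[|[|]]]]] [-> [-> ->]]; case=> [|[|[|[|[|]]]]] [-> [-> ->]];
  rewrite /perm3; tauto.
Qed.

Lemma perm3_sym A B C P Q R : perm3 A B C P Q R -> perm3 P Q R A B C.
Proof. by case=> [|[|[|[|[|]]]]] [-> [-> ->]]; rewrite /perm3; tauto. Qed.

Lemma perm3_scale k A B C P Q R : perm3 A B C P Q R ->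
  perm3 (k * A) (k * B) (k * C) (k * P) (k * Q) (k * R).
Proof. by case=> [|[|[|[|[|]]]]] [-> [-> ->]]; rewrite /perm3; tauto. Qed.

Lemma perm3_cancel A y z B C : perm3 A y z A B C -> y = B /\ z = C \/ y = C /\ z = B.
Proof.
by case=> [|[|[|[|[|]]]]] [? [? ?]]; first [left; split; lra | right; split; lra].
Qed.

Lemma tri_perm A B C P Q R u v w : perm3 P Q R A B C -> tri A B C u v w <-> tri P Q R u v w.
Proof.
move=> h; split=> ht; last exact: perm3_trans ht h.
by apply: perm3_trans ht _; apply: perm3_sym.
Qed.

Lemma cover_perm X A B C P Q R : perm3 P Q R A B C -> tri_covered X A B C -> tri_covered X P Q R.
Proof.
move=> h cov u v Xu Xv uv; have [w [Xw t]] := cov u v Xu Xv uv.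
by exists w; split=> //; apply/(tri_perm u v w h).
Qed.

Lemma labelled_perm X A B C P Q R m t0 : perm3 P Q R A B C ->
  labelled X P Q R m t0 -> labelled X A B C m t0.
Proof.
move=> h [f [h1 h2]]; exists f; split=> // p q r Xp Xq Xr t.
by apply: h2 => //; apply/(tri_perm p q r h).
Qed.

Lemma alg_right_perm A B C P Q R : perm3 P Q R A B C -> alg_right P Q R -> alg_right A B C.
Proof.
by case=> [|[|[|[|[|]]]]] [-> [-> ->]]; rewrite /alg_right => -[|[]] ?;
  first [left; lra | right; left; lra | right; right; lra].
Qed.

Lemma exceptional_perm X A B C P Q R : perm3 P Q R A B C ->
  exceptional X P Q R -> exceptional X A B C.
Proof.
move=> h [[a l]|[[a l]|[a l]]]; [left|right; left|right; right];
  (split; last exact: (labelled_perm h l)).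
- by case: a => x hx; exists x; apply: perm3_trans hx h.
- by case: a => x [t [ht hx]]; exists x, t; split=> //; apply: perm3_trans hx h.
- by case: a => x [t [ht hx]]; exists x, t; split=> //; apply: perm3_trans hx h.
Qed.

Definition image_of (phi : point -> point) (X : point -> Prop) (p' : point) : Prop :=
  exists p, X p /\ p' = phi p.

Section Similarity.
Variables (phi : point -> point) (k : R).
Hypothesis k0 : 0 < k.
Hypothesis phiE : forall p q, sqd (phi p) (phi q) = k * sqd p q.

Lemma sim_tri A B C u v w :
  tri (k * A) (k * B) (k * C) (phi u) (phi v) (phi w) <-> tri A B C u v w.
Proof.
rewrite /tri !phiE; split=> [|h]; last exact: perm3_scale.
move/(@perm3_scale (/ k)); rewrite -!Rmult_assoc Rinv_l ?Rmult_1_l //.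
exact: Rgt_not_eq.
Qed.

Lemma sim_cover X A B C : tri_covered X A B C -> tri_covered (image_of phi X) (k * A) (k * B) (k * C).
Proof.
move=> cov _ _ [u [Xu ->]] [v [Xv ->]] uv.
have [|w [Xw t]] := cov u v Xu Xv; first by move=> e; case: uv; rewrite e.
by exists (phi w); split; [exists w|apply/sim_tri].
Qed.

Lemma sim_labelled X A B C m t0 :
  labelled (image_of phi X) (k * A) (k * B) (k * C) m t0 -> labelled X A B C m t0.
Proof.
case=> f [h1 h2]; exists (fun p => f (phi p)); split=> [p Xp|p q r Xp Xq Xr t].
  by apply: h1; exists p.
by apply: h2; [exists p|exists q|exists r|apply/sim_tri].
Qed.

Lemma sim_unscale A B C P Q R : perm3 P Q R (k * A) (k * B) (k * C) ->
  perm3 (/ k * P) (/ k * Q) (/ k * R) A B C.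
Proof.
move/(@perm3_scale (/ k)); rewrite -!(Rmult_assoc (/ k) k) Rinv_l ?Rmult_1_l //.
exact: Rgt_not_eq.
Qed.

Lemma sim_exceptional X A B C :
  exceptional (image_of phi X) (k * A) (k * B) (k * C) -> exceptional X A B C.
Proof.
move=> [[a l]|[[a l]|[a l]]]; [left|right; left|right; right];
  (split; last exact: (sim_labelled l)).
- case: a => P /sim_unscale h; exists (/ k * P).
  by rewrite (_ : 3 * (/ k * P) = / k * (3 * P)); last ring.
- case: a => P [t [ht /sim_unscale h]]; exists (/ k * P), t; split=> //.
  by rewrite (_ : t * t * (/ k * P) = / k * (t * t * P)); last ring.
- case: a => P [t [ht /sim_unscale h]]; exists (/ k * P), t; split=> //.
  rewrite (_ : t * t * (/ k * P) = / k * (t * t * P)); last ring.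
  by rewrite (_ : (t * t - t) * (/ k * P) = / k * ((t * t - t) * P)); last ring.
Qed.

End Similarity.

(* The similarity taking u, v to (-1, 0), (1, 0); the squared side 4, rather than 1,
   keeps the polynomial identities below free of fractions. *)
Definition normalize (u v p : point) : point :=
  (2 * ((p.1 - u.1) * (v.1 - u.1) + (p.2 - u.2) * (v.2 - u.2)) / sqd u v - 1,
   2 * ((v.1 - u.1) * (p.2 - u.2) - (v.2 - u.2) * (p.1 - u.1)) / sqd u v).

Lemma normalizeE u v : sqd u v <> 0 ->
  [/\ forall p q, sqd (normalize u v p) (normalize u v q) = 4 / sqd u v * sqd p q,
      normalize u v u = (- 1, 0) & normalize u v v = (1, 0)].
Proof.
move=> ne; split.
- move=> [p1 p2] [q1 q2]; move: u v ne => [u1 u2] [v1 v2].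
  by rewrite /normalize /sqd /= => ne; field.
- move: u v ne => [u1 u2] [v1 v2]; rewrite /normalize /sqd /= => ne.
  by congr pair; field.
- move: u v ne => [u1 u2] [v1 v2]; rewrite /normalize /sqd /= => ne.
  by congr pair; field.
Qed.

Lemma cover_side X A B C p q : tri_covered X A B C -> X p -> X q -> p <> q ->
  sqd p q = A \/ sqd p q = B \/ sqd p q = C.
Proof.
move=> cov Xp Xq pq; have [w [_ t]] := cov p q Xp Xq pq.
by case: t => [|[|[|[|[|]]]]] [? _]; tauto.
Qed.

Lemma cover_third X A B C p q : tri_covered X A B C -> X p -> X q -> p <> q ->
  sqd p q = A -> exists w, X w /\
  (sqd w p = B /\ sqd w q = C \/ sqd w p = C /\ sqd w q = B).
Proof.
move=> cov Xp Xq pq e; have [w [Xw t]] := cov p q Xp Xq pq; exists w; split=> //.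
move: t; rewrite /tri e (sqdC q w) => /perm3_cancel[] [-> ->]; tauto.
Qed.

Lemma sqd_eq0 p q : sqd p q = 0 -> p = q.
Proof.
move: p q => [p1 p2] [q1 q2]; rewrite /sqd /= => e.
have h1 := Rle_0_sqr (p1 - q1); have h2 := Rle_0_sqr (p2 - q2).
rewrite /Rsqr in h1 h2.
have e1 : (p1 - q1) * (p1 - q1) = 0 by lra.
have e2 : (p2 - q2) * (p2 - q2) = 0 by lra.
by congr pair; apply: Rminus_diag_uniq; [case/Rmult_integral: e1|case/Rmult_integral: e2].
Qed.

End Covering.

(* [nsatz] may fail when unrelated hypotheses are present. *)
Ltac algebra := repeat match goal with H : @eq R _ _ |- _ => revert H end;
  clear; intros; solve [nsatz].
(** For systems of equations that are unsolvable even over the complex numbers: 1 then lies in the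
    ideal they generate, and no order argument is involved. *)
Ltac absurd_algebra := exfalso; apply: R1_neq_R0; algebra.

(** * Kites and parallelograms over a normalized pair *)

Section Normalized.
Local Open Scope R_scope.
Variables (X : point -> Prop) (Q S x y : R).
Hypothesis y0 : y <> 0.
Hypothesis EQ : Q = (x + 1) * (x + 1) + y * y.
Hypothesis ES : S = (x - 1) * (x - 1) + y * y.
Hypothesis cov : tri_covered X 4 Q S.
Hypothesis Xu : X (- 1, 0).
Hypothesis Xv : X (1, 0).
Hypothesis Xc : X (x, y).

Lemma yy_gt0 : 0 < y * y.
Proof. have := Rsqr_pos_lt y y0; rewrite /Rsqr; lra. Qed.

Lemma Q_gt0 : 0 < Q.
Proof. have := yy_gt0; have := Rle_0_sqr (x + 1); rewrite /Rsqr; lra. Qed.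

Lemma S_gt0 : 0 < S.
Proof. have := yy_gt0; have := Rle_0_sqr (x - 1); rewrite /Rsqr; lra. Qed.

Lemma side p q : X p -> X q ->
  p = q \/ sqd p q = 4 \/ sqd p q = Q \/ sqd p q = S.
Proof.
move=> Xp Xq; case: (excluded_middle_informative (p = q)) => [->|pq]; first by left.
by right; apply: (cover_side cov).
Qed.

Lemma side_neq p q : X p -> X q -> p <> q ->
  sqd p q = 4 \/ sqd p q = Q \/ sqd p q = S.
Proof. exact: (cover_side cov). Qed.

(** With c = (x, y) and d = (x, -y), the segment cd is as long as uv and perpendicular to it. A copy
    of the triangle over cd has its apex at abscissa x + 1 or x - 1, where the distances to u and v
    cannot both be sides. *)
Lemma kite_one e : X e -> e <> (- 1, 0) -> e <> (1, 0) -> y * y = 1 ->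
  sqd e (x, y) = Q /\ sqd e (x, - y) = S \/ sqd e (x, y) = S /\ sqd e (x, - y) = Q ->
  False.
Proof.
move: e => [ex ey] Xe eu ev yy h.
have := side_neq Xe Xu eu; have := side_neq Xe Xv ev; move: h.
rewrite /sqd /= => h hv hu.
have e1 : ey * ey = x * x by case: h => -[h1 h2]; algebra.
have e2 : (ex - x - 1) * (ex - x + 1) = 0 by case: h => -[h1 h2]; algebra.
have s1 := Rle_0_sqr (x + 1); have s2 := Rle_0_sqr (x - 1).
rewrite /Rsqr in s1 s2.
case/Rmult_integral: e2 => e2.
  have E : ex = x + 1 by lra.
  rewrite E in hu hv.
  by case: hu => [hu|[hu|hu]]; [|exfalso; lra|];
    case: hv => [hv|[hv|hv]]; absurd_algebra.
have E : ex = x - 1 by lra.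
rewrite E in hu hv.
by case: hv => [hv|[hv|hv]]; [| |exfalso; lra];
  case: hu => [hu|[hu|hu]]; absurd_algebra.
Qed.

Hypothesis nonright : ~ alg_right 4 Q S.

Lemma kite_Q e : X e -> X (x, - y) -> e <> (- 1, 0) -> e <> (1, 0) ->
  4 * (y * y) = Q ->
  sqd e (x, y) = 4 /\ sqd e (x, - y) = S \/ sqd e (x, y) = S /\ sqd e (x, - y) = 4 ->
  False.
Proof.
(* The inequation [y <> 0] is passed to the ideal computations as the equation y z = 1. *)
move=> Xe Xd eu ev yy h; have yz := Rinv_r _ y0; move: (/ y) yz => z yz.
have hu := side_neq Xe Xu eu; have hv := side_neq Xe Xv ev.
have Q0 := Q_gt0; have S0 := S_gt0; have yy0 := yy_gt0.
move: nonright; rewrite /alg_right => nr.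
have e2 : (e.1 - x - 1) * (e.1 - x + 1) = 0.
  by move: h; rewrite /sqd /= => -[] [h1 h2]; algebra.
have E : e.1 = x - 1.
  case/Rmult_integral: e2 => e2; last lra.
  have huu : sqd e (- 1, 0) = 4 + Q.
    by move: h; rewrite /sqd /= => -[] [h1 h2]; algebra.
  by exfalso; case: hu => [hu|[hu|hu]]; [lra|lra|apply: nr; left; lra].
have hvv : sqd e (1, 0) = Q + 4 - 8 * x.
  by move: h; rewrite /sqd /= => -[] [h1 h2]; algebra.
case: hv => [hv|[hv|hv]]; last 2 first.
- by apply: nr; right; left; algebra.
- by apply: nr; right; right; algebra.
(* The copy over [e] and v supplies a further point, whose distances to u, c and d are contradictory
   in all cases. *)
have [f [Xf hf]] := cover_third cov Xe Xv ev hv.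
have fu := side Xf Xu; have fc := side Xf Xc; have fd := side Xf Xd.
move: e f h hf fu fc fd E hvv hv {Xe eu ev e2 hu Xf} => [ex ey] [fx fy].
rewrite /sqd /= => h hf fu fc fd E hvv hv.
by case: h => -[h1 h2]; case: hf => -[h3 h4]; case: fu => [[E1 E2]|[fu|[fu|fu]]];
  first [ absurd_algebra
  | case: fc => [[E1 E2]|[fc|[fc|fc]]]; first [ absurd_algebra
  | case: fd => [[E1 E2]|[fd|[fd|fd]]]; absurd_algebra ]].
Qed.

Lemma cover_thirdQ p q : X p -> X q -> p <> q -> sqd p q = Q -> exists w, X w /\
  (sqd w p = 4 /\ sqd w q = S \/ sqd w p = S /\ sqd w q = 4).
Proof.
apply: (cover_third (A := Q)); apply: cover_perm cov; rewrite /perm3; tauto.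
Qed.

Lemma parallelogram_Q e : X e -> X (- x, - y) -> e <> (- 1, 0) -> e <> (1, 0) ->
  4 * (x * x + y * y) = Q ->
  sqd e (x, y) = 4 /\ sqd e (- x, - y) = S \/
  sqd e (x, y) = S /\ sqd e (- x, - y) = 4 -> False.
Proof.
move=> Xe Xd eu ev cd h.
have hu := side_neq Xe Xu eu; have hv := side_neq Xe Xv ev.
have Q0 := Q_gt0; have S0 := S_gt0; have yy0 := yy_gt0.
(* The parallelogram law, as uv and cd bisect each other. Together with 2S = 4 - Q it leaves only
   (Q, S) = (2, 1) and (8/3, 2/3), each refuted by a further point [f]. *)
have sum : sqd e (- 1, 0) + sqd e (1, 0) = 8 - Q.
  by move: h; rewrite /sqd /= => -[] [h1 h2]; algebra.
have SE : 2 * S = 4 - Q by lra.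
case: hu => [hu|[hu|hu]]; case: hv => [hv|[hv|hv]]; try (exfalso; lra).
- have [QE {}SE] : Q = 2 /\ S = 1 by lra.
  have [f [Xf hf]] := cover_third cov Xe Xu eu hu.
  have fv := side Xf Xv; have fc := side Xf Xc; have fd := side Xf Xd.
  move: e f h hf fv fc fd hu hv {Xe eu ev sum Xf} => [ex ey] [fx fy].
  rewrite /sqd /= => h hf fv fc fd hu hv.
  case: h => -[h1 h2]; try (solve [absurd_algebra]); case: hf => -[h3 h4];
    case: fv => [[E1 E2]|[fv|[fv|fv]]]; try (solve [absurd_algebra]);
    case: fc => [[E3 E4]|[fc|[fc|fc]]]; try (solve [absurd_algebra]);
    by case: fd => [[E5 E6]|[fd|[fd|fd]]]; absurd_algebra.
- have [QE {}SE] : Q = 2 /\ S = 1 by lra.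
  have [f [Xf hf]] := cover_third cov Xe Xv ev hv.
  have fv := side Xf Xu; have fc := side Xf Xd; have fd := side Xf Xc.
  move: e f h hf fv fc fd hu hv {Xe eu ev sum Xf} => [ex ey] [fx fy].
  rewrite /sqd /= => h hf fv fc fd hu hv.
  case: h => -[h1 h2]; try (solve [absurd_algebra]); case: hf => -[h3 h4];
    case: fv => [[E1 E2]|[fv|[fv|fv]]]; try (solve [absurd_algebra]);
    case: fc => [[E3 E4]|[fc|[fc|fc]]]; try (solve [absurd_algebra]);
    by case: fd => [[E5 E6]|[fd|[fd|fd]]]; absurd_algebra.
have [QE {}SE] : 3 * Q = 8 /\ 3 * S = 2 by lra.
case: h => h.
  have [f [Xf hf]] := cover_thirdQ Xe Xu eu hu.
  have fv := side Xf Xv; have fc := side Xf Xc; have fd := side Xf Xd.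
  move: e f h hf fv fc fd hu hv {Xe eu ev sum Xf} => [ex ey] [fx fy].
  rewrite /sqd /= => -[h1 h2] hf fv fc fd hu hv.
  case: hf => -[h3 h4];
    case: fv => [[E1 E2]|[fv|[fv|fv]]]; try (solve [absurd_algebra]);
    case: fc => [[E3 E4]|[fc|[fc|fc]]]; try (solve [absurd_algebra]);
    by case: fd => [[E5 E6]|[fd|[fd|fd]]]; absurd_algebra.
have [f [Xf hf]] := cover_thirdQ Xe Xv ev hv.
have fv := side Xf Xu; have fc := side Xf Xd; have fd := side Xf Xc.
move: e f h hf fv fc fd hu hv {Xe eu ev sum Xf} => [ex ey] [fx fy].
rewrite /sqd /= => -[h1 h2] hf fv fc fd hu hv.
case: hf => -[h3 h4];
  case: fv => [[E1 E2]|[fv|[fv|fv]]]; try (solve [absurd_algebra]);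
  case: fc => [[E3 E4]|[fc|[fc|fc]]]; try (solve [absurd_algebra]);
  by case: fd => [[E5 E6]|[fd|[fd|fd]]]; absurd_algebra.
Qed.

End Normalized.

(** * Labelling points by a finite table of distances *)

Section Labels.
Local Open Scope R_scope.

Lemma labelled_of_points (X : point -> Prop) A B C m (V : nat -> point)
    (t0 : nat -> nat -> nat -> bool) :
  (forall p, X p -> exists2 i, (i < m)%N & p = V i) ->
  (forall i j k, (i < m)%N -> (j < m)%N -> (k < m)%N ->
     tri A B C (V i) (V j) (V k) -> t0 i j k) ->
  labelled X A B C m t0.
Proof.
move=> hV ht.
pose f p := epsilon (inhabits 0%N) (fun i => (i < m)%N /\ p = V i).
have fP p : X p -> (f p < m)%N /\ p = V (f p).
  move=> /hV[i im pi]; apply: (epsilon_spec (inhabits 0%N) (fun i => (i < m)%N /\ p = V i)).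
  by exists i.
exists f; split=> [p /fP[]//|p q r /fP[pm pE] /fP[qm qE] /fP[rm rE] t].
by apply: ht => //; rewrite -pE -qE -rE.
Qed.

(** Colouring the pairs of template points by their distance separates the geometry from the
    combinatorics: the edge condition becomes a statement on three colours. *)
Lemma labelled_of_colors (X : point -> Prop) A B C m (V : nat -> point)
    (col : nat -> nat -> nat) (val : nat -> R) (t1 : nat -> nat -> nat -> bool) :
  (forall p, X p -> exists2 i, (i < m)%N & p = V i) ->
  (forall i j, (i < m)%N -> (j < m)%N -> sqd (V i) (V j) = val (col i j)) ->
  (forall a b c, perm3 (val a) (val b) (val c) A B C -> t1 a b c) ->
  labelled X A B C m (fun i j k => t1 (col i j) (col j k) (col k i)).
Proof.
move=> hV hcol ht; apply: labelled_of_points hV _ => i j k im jm km.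
by rewrite /tri !hcol // => /ht.
Qed.

(** Colour 0 belongs to a point paired with itself; the sides proper start at colour 1, in
    accordance with [cyc_dist]. *)
Definition side_value (a b c d : R) (k : nat) : R :=
  match k with 0%N => 0 | 1%N => a | 2%N => b | 3%N => c | _ => d end.

Lemma rainbow_of_perm3 A B C i j k : 0 < A -> 0 < B -> 0 < C ->
  A <> B -> B <> C -> A <> C ->
  perm3 (side_value A B C 0 i) (side_value A B C 0 j) (side_value A B C 0 k) A B C ->
  rainbow i j k.
Proof.
move=> A0 B0 C0 AB BC AC.
case: i => [|[|[|[|i]]]]; case: j => [|[|[|[|j]]]]; case: k => [|[|[|[|k]]]];
  rewrite /side_value; try (by move=> _; vm_compute);
  by case=> [|[|[|[|[|]]]]] [? [? ?]]; exfalso; lra.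
Qed.

Lemma penta_of_perm3 A B i j k : 0 < A -> 0 < B -> A <> B ->
  perm3 (side_value A B 0 0 i) (side_value A B 0 0 j) (side_value A B 0 0 k) A A B ->
  perm_eq [:: i; j; k] [:: 1; 1; 2]%N.
Proof.
move=> A0 B0 AB.
case: i => [|[|[|[|i]]]]; case: j => [|[|[|[|j]]]]; case: k => [|[|[|[|k]]]];
  rewrite /side_value; try (by move=> _; vm_compute);
  by case=> [|[|[|[|[|]]]]] [? [? ?]]; exfalso; lra.
Qed.

End Labels.

(** * Trapezoids, the pentagon and the heptagon *)

Section Trapezoid.
Local Open Scope R_scope.
Variables (X : point -> Prop) (Q S x y : R).
Hypothesis y0 : y <> 0.
Hypothesis EQ : Q = (x + 1) * (x + 1) + y * y.
Hypothesis ES : S = (x - 1) * (x - 1) + y * y.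
Hypothesis cov : tri_covered X 4 Q S.
Hypothesis Xu : X (- 1, 0).
Hypothesis Xv : X (1, 0).
Hypothesis Xc : X (x, y).
Hypothesis Xd : X (- x, y).
Hypothesis cd : 4 * (x * x) = Q.

(** Since eu^2 - ev^2 is four times the abscissa of e, each of the nine choices of eu and ev fixes
    that abscissa; the copy over cd then gives a polynomial equation in x alone. Only the golden
    equation and the cubic of the heptagon survive. *)
Lemma trapezoid_fifth e : ~ alg_right 4 Q S -> X e -> e <> (- 1, 0) -> e <> (1, 0) ->
  sqd e (x, y) = 4 /\ sqd e (- x, y) = S \/ sqd e (x, y) = S /\ sqd e (- x, y) = 4 ->
  (x * x = x + 1 /\ e.1 = 0 /\ e.2 * y = 3 * x + 1) \/
  (x * x * x + x * x - 2 * x - 1 = 0 /\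
    (e.1 = x * x - 1 \/ e.1 = 1 - x * x) /\ e.2 * y = 2 * (x * x) - 1).
Proof.
rewrite /alg_right => nr Xe eu ev h.
have hu := side_neq cov Xe Xu eu; have hv := side_neq cov Xe Xv ev.
have yy0 := yy_gt0 y0.
have SE : S = 4 * (x * x) - 4 * x by lra.
have yyE : y * y = 3 * (x * x) - 2 * x - 1 by lra.
(* These three factors occur in the eliminations below: x = 1 is degenerate, while x = -1 and x =
   -1/2 give right angles. *)
have x1 : x - 1 <> 0 by move=> /Rminus_diag_uniq e1; rewrite e1 in yyE; lra.
have x2 : x + 1 <> 0.
  by move=> e1; apply: nr; left; algebra.
have x3 : 2 * x + 1 <> 0.
  by move=> e1; apply: nr; right; left; algebra.
move: e h hu hv {Xe eu ev} => [ex ey]; rewrite /sqd /= => h hu hv.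
have cancel a b : a <> 0 -> a * b = 0 -> b = 0.
  by move=> a0 /Rmult_integral[/a0[]|].
case: hu => [hu|[hu|hu]]; case: hv => [hv|[hv|hv]].
- have ex0 : ex = 0 by lra.
  have g : x * x = x + 1 by case: h => -[h1 h2]; algebra.
  by case: h => -[h1 h2]; absurd_algebra.
- have exE : ex = 1 - x * x by lra.
  (* Elimination also produces the first cubic factor, which contradicts the remaining equations. *)
  have : (x * x * x - x * x + 1) * (x * x * x + x * x - 2 * x - 1) = 0.
    by case: h => -[h1 h2]; algebra.
  have eyE : ey * y = 2 * (x * x) - 1 by case: h => -[h1 h2]; algebra.
  case/Rmult_integral => g; first by case: h => -[h1 h2]; absurd_algebra.
  by right; split=> //; split=> //; right.
- have exE : 4 * ex = 4 - S by lra.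
  have g : (x - 1) * ((x + 1) * (x * x - x - 1)) = 0.
    by case: h => -[h1 h2]; algebra.
  have {}g := cancel _ _ x2 (cancel _ _ x1 g).
  by case: h => -[h1 h2]; absurd_algebra.
- have exE : ex = x * x - 1 by lra.
  have : (x * x * x - x * x + 1) * (x * x * x + x * x - 2 * x - 1) = 0.
    by case: h => -[h1 h2]; algebra.
  have eyE : ey * y = 2 * (x * x) - 1 by case: h => -[h1 h2]; algebra.
  case/Rmult_integral => g; first by case: h => -[h1 h2]; absurd_algebra.
  by right; split=> //; split=> //; left.
- have ex0 : ex = 0 by lra.
  have g : x * x = x + 1 by case: h => -[h1 h2]; algebra.
  by left; split=> //; split=> //; case: h => -[h1 h2]; algebra.
- have exE : ex = x by lra.
  have g : (x + 1) * ((x - 1) * (2 * x + 1)) = 0 by case: h => -[h1 h2]; algebra.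
  by case: x3; exact: (cancel _ _ x1 (cancel _ _ x2 g)).
- have exE : 4 * ex = S - 4 by lra.
  have g : (x - 1) * ((x + 1) * (x * x - x - 1)) = 0.
    by case: h => -[h1 h2]; algebra.
  have {}g := cancel _ _ x2 (cancel _ _ x1 g).
  by case: h => -[h1 h2]; absurd_algebra.
- have exE : ex = - x by lra.
  have g : (x + 1) * ((x - 1) * (2 * x + 1)) = 0 by case: h => -[h1 h2]; algebra.
  by case: x3; exact: (cancel _ _ x1 (cancel _ _ x2 g)).
- have ex0 : ex = 0 by lra.
  have g : x * x = x + 1 by case: h => -[h1 h2]; algebra.
  by case: h => -[h1 h2]; absurd_algebra.
Qed.

Lemma coord_eq (p : point) a b : p.1 = a -> p.2 * y = b -> p = (a, b * / y).
Proof. by case: p => [p1 p2] /= -> <-; rewrite Rmult_assoc Rinv_r // Rmult_1_r. Qed.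

Lemma penta_points (p : point) : x * x = x + 1 -> X p ->
  [\/ p = (- 1, 0), p = (1, 0) | p = (x, y)] \/
  p = (- x, y) \/ p = (0, (3 * x + 1) * / y).
Proof.
move=> g Xp.
have SE : S = 4 by algebra.
have pu := side cov Xp Xu; have pv := side cov Xp Xv.
have pc := side cov Xp Xc; have pd := side cov Xp Xd.
case: pu => [->|pu]; first by left; apply: Or31.
case: pv => [->|pv]; first by left; apply: Or32.
case: pc => [->|pc]; first by left; apply: Or33.
case: pd => [->|pd]; first by right; left.
have two s : s = 4 \/ s = Q \/ s = S -> s = 4 \/ s = Q by rewrite SE; tauto.
right; right; case: (two _ pu) (two _ pv) (two _ pc) (two _ pd) => {}pu [] {}pv [] {}pc [] {}pd;
  apply: coord_eq; move: pu pv pc pd; case: (p) => px py; rewrite /sqd /= => pu pv pc pd;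
  by first [algebra | absurd_algebra].
Qed.

Lemma penta_labelled : x * x = x + 1 -> alg_penta 4 Q S /\ labelled X 4 Q S 5 penta_edge.
Proof.
move=> g; have SE : S = 4 by algebra.
have yy0 := yy_gt0 y0.
have yyE : y * y = x + 2 by algebra.
have Q0 := Q_gt0 y0 EQ.
have Q4 : 4 <> Q by move=> e; absurd_algebra.
split.
  exists 4, x; split=> //; rewrite /perm3 SE (_ : x * x * 4 = Q); last lra.
  by right; left.
have yz := Rinv_r _ y0.
(* Consecutive points have squared distance 4; for the negative root x this is the order along the
   pentagram. *)
pose V i := nth (0, 0) [:: (- 1, 0); (1, 0); (x, y); (0, (3 * x + 1) * / y); (- x, y)] i.
apply: (@labelled_of_colors X 4 Q S 5 V (cyc_dist 5) (side_value 4 Q 0 0)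
  (fun a b c => perm_eq [:: a; b; c] [:: 1; 1; 2]%N)).
- move=> p /(penta_points g)[[||]|[]] ->;
    [by exists 0%N|by exists 1%N|by exists 2%N|by exists 4%N|by exists 3%N].
- move: (/ y) yz @V => z yz V.
  by case=> [|[|[|[|[|i]]]]] // [|[|[|[|[|j]]]]] // _ _; rewrite /V /sqd /=; algebra.
- move=> a b c; rewrite SE => h; apply: (@penta_of_perm3 4 Q) => //; try lra.
  by apply: perm3_trans h _; rewrite /perm3; tauto.
Qed.

Lemma hepta_points (p : point) : x * x * x + x * x - 2 * x - 1 = 0 -> X p ->
  [\/ p = (- 1, 0), p = (1, 0) | p = (x, y)] \/
  [\/ p = (- x, y), p = (x * x - 1, (2 * (x * x) - 1) * / y),
      p = (1 - x * x, (2 * (x * x) - 1) * / y) |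
      p = (0, (4 * (x * x) - 3 * x - 3) * / y)].
Proof.
move=> g Xp.
have SE : S = 4 * (x * x) - 4 * x by lra.
have pu := side cov Xp Xu; have pv := side cov Xp Xv.
have pc := side cov Xp Xc; have pd := side cov Xp Xd.
case: pu => [->|pu]; first by left; apply: Or31.
case: pv => [->|pv]; first by left; apply: Or32.
case: pc => [->|pc]; first by left; apply: Or33.
case: pd => [->|pd]; first by right; apply: Or41.
(* Both sides are 4x times the abscissa of p. This relation between the four distances disposes of
   many of the 81 cases without the coordinates of p. *)
have lin : x * (sqd p (- 1, 0) - sqd p (1, 0)) = sqd p (- x, y) - sqd p (x, y).
  by case: (p) => px py; rewrite /sqd /=; ring.
right; case: pu => [pu|[pu|pu]]; case: pv => [pv|[pv|pv]];
  case: pc => [pc|[pc|pc]]; case: pd => [pd|[pd|pd]];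
  rewrite pu pv pc pd in lin; try (solve [absurd_algebra]);
  move: pu pv pc pd; rewrite /sqd /= => pu pv pc pd;
  first [ solve [absurd_algebra]
  | by apply: Or42; apply: coord_eq; algebra
  | by apply: Or43; apply: coord_eq; algebra
  | by apply: Or44; apply: coord_eq; algebra ].
Qed.

Lemma hepta_labelled : x * x * x + x * x - 2 * x - 1 = 0 ->
  alg_hepta 4 Q S /\ labelled X 4 Q S 7 hepta_edge.
Proof.
move=> g.
have SE : S = 4 * (x * x) - 4 * x by lra.
have yy0 := yy_gt0 y0.
have yyE : y * y = 3 * (x * x) - 2 * x - 1 by lra.
have Q0 := Q_gt0 y0 EQ; have S0 := S_gt0 y0 ES.
have Q4 : 4 <> Q by move=> e; absurd_algebra.
have QS : Q <> S by move=> e; absurd_algebra.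
have S4 : 4 <> S by move=> e; absurd_algebra.
split.
  exists 4, x; split=> //; rewrite /perm3 (_ : x * x * 4 = Q); last lra.
  by rewrite (_ : (x * x - x) * 4 = S); [left | lra].
have yz := Rinv_r _ y0.
(* The order makes cyclic distances 1, 2, 3 correspond to the squared sides 4, Q, S, whichever of
   the three roots x is. *)
pose V i := nth (0, 0) [:: (- 1, 0); (1, 0); (x * x - 1, (2 * (x * x) - 1) * / y);
  (- x, y); (0, (4 * (x * x) - 3 * x - 3) * / y); (x, y);
  (1 - x * x, (2 * (x * x) - 1) * / y)] i.
apply: (@labelled_of_colors X 4 Q S 7 V (cyc_dist 7) (side_value 4 Q S 0) rainbow).
- by move=> p /(hepta_points g)[[||]|[|||]] ->;
    [exists 0%N|exists 1%N|exists 5%N|exists 3%N|exists 2%N|exists 6%N|exists 4%N].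
- move: (/ y) yz @V => z yz V.
  by case=> [|[|[|[|[|[|[|i]]]]]]] // [|[|[|[|[|[|[|j]]]]]]] // _ _;
    rewrite /V /sqd /=; algebra.
- by move=> a b c; apply: rainbow_of_perm3 => //; lra.
Qed.

End Trapezoid.

(** * Triangles without a right angle *)

Section NonRight.
Local Open Scope R_scope.

(** Heron's formula in terms of squared sides: sixteen times the squared area. *)
Definition heron (A B C : R) : R :=
  2 * A * B + 2 * B * C + 2 * C * A - A * A - B * B - C * C.

Lemma heron_perm A B C P Q S : perm3 P Q S A B C -> heron P Q S = heron A B C.
Proof. by case=> [|[|[|[|[|]]]]] [-> [-> ->]]; rewrite /heron; ring. Qed.

Lemma alg_right_scale k A B C : k <> 0 -> alg_right (k * A) (k * B) (k * C) ->
  alg_right A B C.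
Proof.
move=> k0; rewrite /alg_right -!Rmult_plus_distr_l.
by case=> [|[|]] /(Rmult_eq_reg_l _ _ _) /(_ k0); tauto.
Qed.

Section Half.
Variables (X : point -> Prop) (Q S x y : R).
Hypothesis y0 : y <> 0.
Hypothesis EQ : Q = (x + 1) * (x + 1) + y * y.
Hypothesis ES : S = (x - 1) * (x - 1) + y * y.
Hypothesis cov : tri_covered X 4 Q S.
Hypothesis Xu : X (- 1, 0).
Hypothesis Xv : X (1, 0).
Hypothesis Xc : X (x, y).
Hypothesis nonright : ~ alg_right 4 Q S.

(** Here u = (-1, 0) turns out to be the centre of the equilateral triangle v, c, d. *)
Lemma kite_star : X (x, - y) -> 4 * (y * y) = S -> Q = 4 ->
  alg_120 4 Q S /\ labelled X 4 Q S 4 star_edge.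
Proof.
move=> Xd hS hQ; have yy0 := yy_gt0 y0.
have xE : x = - 2.
  have : (x - 1) * (x + 2) = 0 by lra.
  case/Rmult_integral=> e; last lra.
  have e1 : x = 1 by lra.
  by move: ES; rewrite e1; lra.
have yyE : y * y = 3 by move: EQ; rewrite xE; lra.
have SE : S = 12 by lra.
split; first by exists 4; rewrite /perm3; lra.
pose V i := nth (0, 0) [:: (- 1, 0); (1, 0); (x, y); (x, - y)] i.
apply: (@labelled_of_points X 4 Q S 4 V).
- move=> p Xp.
  have pu := side cov Xp Xu; have pv := side cov Xp Xv.
  have pc := side cov Xp Xc; have pd := side cov Xp Xd.
  case: pu => [->|pu]; first by exists 0%N.
  case: pv => [->|pv]; first by exists 1%N.
  case: pc => [->|pc]; first by exists 2%N.
  case: pd => [->|pd]; first by exists 3%N.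
  (* Leibniz's relation for the centroid u. With all distances equal to 4 or 12, the left side is
     12, 20, 28 or 36 and the right side 24 or 48, so there is no further point. *)
  have e : sqd p (1, 0) + sqd p (x, y) + sqd p (x, - y) = 3 * sqd p (- 1, 0) + 12.
    by case: (p) => px py; rewrite xE /sqd /=; lra.
  exfalso; rewrite hQ SE in pu pv pc pd.
  by case: pu => [pu|[pu|pu]]; case: pv => [pv|[pv|pv]];
    case: pc => [pc|[pc|pc]]; case: pd => [pd|[pd|pd]]; lra.
- by case=> [|[|[|[|i]]]] // [|[|[|[|j]]]] // [|[|[|[|k]]]] // _ _ _;
    rewrite /V /tri /perm3 /sqd ?xE hQ SE /=; try (by move=> _; vm_compute);
    case=> [|[|[|[|[|]]]]] [? [? ?]]; exfalso; lra.
Qed.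

Lemma half_nonright d e : X d -> d <> (x, y) ->
  [\/ d = (x, - y), d = (- x, - y) | d = (- x, y)] ->
  X e -> tri 4 Q S (x, y) d e ->
  e = (- 1, 0) \/ e <> (- 1, 0) /\ e <> (1, 0) /\ (sqd (x, y) d = 4 \/ sqd (x, y) d = Q) ->
  exceptional X 4 Q S.
Proof.
move=> Xd dc hd Xe t he.
have Q0 := Q_gt0 y0 EQ; have S0 := S_gt0 y0 ES.
move: (nonright); rewrite /alg_right => nr.
case: hd => dE; rewrite {}dE in Xd dc t he.
- have sE : sqd (x, y) (x, - y) = 4 * (y * y) by rewrite /sqd /=; ring.
  rewrite sE in he; case: he => [eE|[eu [ev [s|s]]]].
  + move: t; rewrite {}eE /tri sE (_ : sqd (x, - y) (- 1, 0) = Q); last by rewrite /sqd /=; lra.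
    rewrite (_ : sqd (- 1, 0) (x, y) = Q); last by rewrite /sqd /=; lra.
    move=> t; have [[h1 h2]|[h1 h2]] : (4 * (y * y) = 4 /\ Q = S) \/ (4 * (y * y) = S /\ Q = 4).
      by case: t => [|[|[|[|[|]]]]] [? [? ?]]; first [left; split; lra | right; split; lra].
    * exfalso; apply: nr; right; left; have xE : x = 0 by lra.
      by move: EQ ES; rewrite xE; lra.
    * by left; apply: kite_star.
  + exfalso; apply: (kite_one EQ ES cov Xu Xv Xe eu ev); first lra.
    move: t; rewrite /tri sE s => /perm3_cancel; rewrite (sqdC _ e); tauto.
  + exfalso; apply: (kite_Q y0 EQ ES cov Xu Xv Xc nonright Xe Xd eu ev s).
    have : perm3 Q (sqd (x, - y) e) (sqd e (x, y)) Q 4 S.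
      by move: t; rewrite /tri sE s => t; apply: (perm3_trans t); rewrite /perm3; tauto.
    by move=> /perm3_cancel; rewrite (sqdC _ e); tauto.
- have sE : sqd (x, y) (- x, - y) = 4 * (x * x + y * y) by rewrite /sqd /=; ring.
  rewrite sE in he; case: he => [eE|[eu [ev [s|s]]]].
  + move: t; rewrite {}eE /tri sE (_ : sqd (- x, - y) (- 1, 0) = S); last by rewrite /sqd /=; lra.
    rewrite (_ : sqd (- 1, 0) (x, y) = Q); last by rewrite /sqd /=; lra.
    move=> t; exfalso; apply: nr; right; left.
    by case: t => [|[|[|[|[|]]]]] [? [? ?]]; lra.
  + by exfalso; apply: nr; right; left; lra.
  + exfalso; apply: (parallelogram_Q y0 EQ ES cov Xu Xv Xc Xe Xd eu ev s).
    have : perm3 Q (sqd (- x, - y) e) (sqd e (x, y)) Q 4 S.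
      by move: t; rewrite /tri sE s => t; apply: (perm3_trans t); rewrite /perm3; tauto.
    by move=> /perm3_cancel; rewrite (sqdC _ e); tauto.
- have sE : sqd (x, y) (- x, y) = 4 * (x * x) by rewrite /sqd /=; ring.
  have no4 : 4 * (x * x) <> 4.
    move=> e4; have : (x - 1) * (x + 1) = 0 by lra.
    case/Rmult_integral=> e1; apply: nr; [right; right|left].
      have xE : x = 1 by lra.
      by move: EQ ES; rewrite xE; lra.
    have xE : x = -1 by lra.
    by move: EQ ES; rewrite xE; lra.
  rewrite sE in he; case: he => [eE|[eu [ev [s|s]]]].
  + move: t; rewrite {}eE /tri sE (_ : sqd (- x, y) (- 1, 0) = S); last by rewrite /sqd /=; lra.
    rewrite (_ : sqd (- 1, 0) (x, y) = Q); last by rewrite /sqd /=; lra.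
    move=> t; exfalso; apply: no4.
    by case: t => [|[|[|[|[|]]]]] [? [? ?]]; lra.
  + by case: no4.
  + have h : sqd e (x, y) = 4 /\ sqd e (- x, y) = S \/ sqd e (x, y) = S /\ sqd e (- x, y) = 4.
      have : perm3 Q (sqd (- x, y) e) (sqd e (x, y)) Q 4 S.
        by move: t; rewrite /tri sE s => t; apply: (perm3_trans t); rewrite /perm3; tauto.
      by move=> /perm3_cancel; rewrite (sqdC _ e); tauto.
    have [[g _]|[g _]] := trapezoid_fifth y0 EQ ES cov Xu Xv s nonright Xe eu ev h.
      by right; left; apply: (penta_labelled y0 EQ ES cov Xu Xv Xc Xd s).
    by right; right; apply: (hepta_labelled y0 EQ ES cov Xu Xv Xc Xd s).
Qed.

End Half.
Definition mirror (p : point) : point := (- p.1, p.2).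

Lemma mirrorE p q : sqd (mirror p) (mirror q) = 1 * sqd p q.
Proof. by rewrite /sqd /=; ring. Qed.

Lemma normalized_nonright (X : point -> Prop) (Q S x y : R) d :
  y <> 0 -> Q = (x + 1) * (x + 1) + y * y -> S = (x - 1) * (x - 1) + y * y ->
  tri_covered X 4 Q S -> X (- 1, 0) -> X (1, 0) -> X (x, y) -> ~ alg_right 4 Q S ->
  X d -> d <> (x, y) -> [\/ d = (x, - y), d = (- x, - y) | d = (- x, y)] ->
  exceptional X 4 Q S.
Proof.
move=> y0 EQ ES cov Xu Xv Xc nr Xd dc hd.
have [e [Xe t]] := cov (x, y) d Xc Xd (not_eq_sym dc).
have half := half_nonright y0 EQ ES cov Xu Xv Xc nr Xd dc hd Xe t.
have swap : perm3 4 S Q 4 Q S by rewrite /perm3; tauto.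
have other : e = (1, 0) \/ e <> (- 1, 0) /\ e <> (1, 0) /\ sqd (x, y) d = S ->
    exceptional X 4 Q S.
  move=> he; apply: (exceptional_perm swap).
  apply: (@sim_exceptional mirror 1 Rlt_0_1 mirrorE).
  have cov' := @sim_cover mirror 1 Rlt_0_1 mirrorE _ _ _ _ (cover_perm swap cov).
  have t' : tri 4 S Q (mirror (x, y)) (mirror d) (mirror e).
    have := @sim_tri mirror 1 Rlt_0_1 mirrorE 4 S Q (x, y) d e.
    by rewrite !Rmult_1_l => -[_]; apply; apply/(tri_perm _ _ _ swap).
  rewrite !Rmult_1_l in cov' *.
  have refl_inj p q : mirror p = mirror q -> p = q.
    by case: p q => [p1 p2] [q1 q2] [h1 ->]; congr pair; lra.
  apply: (@half_nonright (image_of mirror X) S Q (- x) y y0 _ _ cov' _ _ _ _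
    (mirror d) (mirror e)) => //.
  - by rewrite ES; ring.
  - by rewrite EQ; ring.
  - by exists (1, 0).
  - by exists (- 1, 0); split=> //; rewrite /mirror /= Ropp_involutive.
  - by exists (x, y).
  - by move=> h; apply: nr; apply: alg_right_perm h; rewrite /perm3; tauto.
  - by exists d.
  - by move=> /(refl_inj d (x, y)).
  - by case: hd => ->; rewrite /mirror /= ?Ropp_involutive; [apply: Or31|apply: Or32|apply: Or33];
      rewrite ?Ropp_involutive.
  - by exists e.
  - case: he => [->|[eu [ev s]]]; first by left.
    right; split; [|split].
    + by move=> h; apply: ev; apply: refl_inj; rewrite h.
    + by move=> h; apply: eu; apply: refl_inj; rewrite h /mirror /= Ropp_involutive.
    + by right; rewrite -s -[RHS]Rmult_1_l -mirrorE.
case: (excluded_middle_informative (e = (- 1, 0))) => [eu|eu]; first by apply: half; left.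
case: (excluded_middle_informative (e = (1, 0))) => [ev|ev]; first by apply: other; left.
have [s|[s|s]] := cover_side cov Xc Xd (not_eq_sym dc).
- by apply: half; right; split=> //; split=> //; left.
- by apply: half; right; split=> //; split=> //; right.
- by apply: other; right.
Qed.

Lemma normalized_thirds (Q S x y : R) d : y <> 0 ->
  Q = (x + 1) * (x + 1) + y * y -> S = (x - 1) * (x - 1) + y * y ->
  tri 4 Q S (- 1, 0) (1, 0) d -> d <> (x, y) ->
  [\/ d = (x, - y), d = (- x, - y) | d = (- x, y)].
Proof.
move=> y0 EQ ES; rewrite /tri (_ : sqd (- 1, 0) (1, 0) = 4); last by rewrite /sqd /=; ring.
case: d => dx dy /perm3_cancel; rewrite /sqd /= => h dc.
have dyE : dy = y \/ dy = - y.
  have : (dy - y) * (dy + y) = 0.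
    case: h => -[h1 h2].
      have e : dx = - x by lra.
      by rewrite e in h1; lra.
    have e : dx = x by lra.
    by rewrite e in h1; lra.
  by case/Rmult_integral => ?; [left; lra | right; lra].
case: h => -[h1 h2].
  have -> : dx = - x by lra.
  by case: dyE => ->; [apply: Or33 | apply: Or32].
have dxE : dx = x by lra.
by case: dyE => e; [case: dc; rewrite dxE e | rewrite dxE e; apply: Or31].
Qed.

Lemma side_tri A B C u v w : tri A B C u v w ->
  perm3 (sqd u v) (sqd u w) (sqd v w) A B C.
Proof. by rewrite /tri /perm3 (sqdC w u); intuition. Qed.

Lemma normalize_config (X : point -> Prop) A B C u v c d :
  0 < A -> 0 < B -> 0 < C -> 0 < heron A B C -> tri_covered X A B C ->
  X u -> X v -> X c -> X d -> tri A B C u v c -> tri A B C u v d -> c <> d ->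
  let phi := normalize u v in let k := 4 / sqd u v in
  let X' := image_of phi X in
  exists Q S x y, [/\ 0 < k, forall p q, sqd (phi p) (phi q) = k * sqd p q,
    perm3 4 Q S (k * A) (k * B) (k * C), phi u = (- 1, 0) & phi v = (1, 0)] /\
  [/\ y <> 0, Q = (x + 1) * (x + 1) + y * y, S = (x - 1) * (x - 1) + y * y &
    phi c = (x, y)] /\
  [/\ tri_covered X' 4 Q S, phi d <> (x, y) &
   [\/ phi d = (x, - y), phi d = (- x, - y) | phi d = (- x, y)]].
Proof.
move=> A0 B0 C0 H0 cov Xu Xv Xc Xd tc td cd phi k X'.
have pos : 0 < sqd u v.
  by case: (tc) => [|[|[|[|[|]]]]] [-> _].
have [phiE phiu phiv] := normalizeE (Rgt_not_eq _ _ pos).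
rewrite -/phi -/k in phiE phiu phiv.
have k0 : 0 < k by apply: Rdiv_lt_0_compat; lra.
have k1 : k * sqd u v = 4 by rewrite /k; field; lra.
case cE : (phi c) => [x y].
exists (k * sqd u c), (k * sqd v c), x, y.
have per : perm3 4 (k * sqd u c) (k * sqd v c) (k * A) (k * B) (k * C).
  by rewrite -k1; apply: perm3_scale; apply: side_tri.
have EQ : k * sqd u c = (x + 1) * (x + 1) + y * y.
  by rewrite -phiE phiu cE /sqd /=; ring.
have ES : k * sqd v c = (x - 1) * (x - 1) + y * y.
  by rewrite -phiE phiv cE /sqd /=; ring.
have y0 : y <> 0.
  (* With y = 0 the three points are collinear and the area vanishes. *)
  move=> y0; have := heron_perm per; rewrite EQ ES y0.
  have -> : heron (k * A) (k * B) (k * C) = k * k * heron A B C by rewrite /heron; ring.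
  have : 0 < k * k * heron A B C by apply: Rmult_lt_0_compat => //; apply: Rmult_lt_0_compat.
  rewrite (_ : heron 4 _ _ = 0); last by rewrite /heron; ring.
  by lra.
have dc' : phi d <> (x, y).
  rewrite -cE => e; apply: cd; apply/esym/sqd_eq0.
  apply: (Rmult_eq_reg_l k); last lra.
  by rewrite -phiE e sqd_refl; ring.
split; first by [].
split; first by [].
split=> //.
  by apply: cover_perm per _; apply: (sim_cover k0 phiE).
apply: (normalized_thirds y0 EQ ES) => //.
by rewrite -phiu -phiv; apply/(tri_perm _ _ _ per)/(sim_tri k0 phiE).
Qed.

Theorem nonright_cover (X : point -> Prop) A B C :
  0 < A -> 0 < B -> 0 < C -> 0 < heron A B C -> ~ alg_right A B C ->
  tri_covered X A B C ->
  (forall u v c d, X u -> X v -> X c -> X d ->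
     tri A B C u v c -> tri A B C u v d -> c = d) \/ exceptional X A B C.
Proof.
move=> A0 B0 C0 H0 nr cov.
case: (excluded_middle_informative (exceptional X A B C)) => [|none]; first by right.
left=> u v c d Xu Xv Xc Xd tc td.
case: (excluded_middle_informative (c = d)) => // cd; case: none.
have := normalize_config A0 B0 C0 H0 cov Xu Xv Xc Xd tc td cd.
move=> [Q [S [x [y [[k0 phiE per eu ev] [[y0 EQ ES ec] [cov' dc hd]]]]]]].
apply: (sim_exceptional k0 phiE); apply: (exceptional_perm per).
apply: (normalized_nonright y0 EQ ES cov' _ _ _ _ _ dc hd).
- by rewrite -eu; exists u.
- by rewrite -ev; exists v.
- by rewrite -ec; exists c.
- move=> h; apply: nr; apply: (@alg_right_scale (4 / sqd u v)); first lra.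
  exact: alg_right_perm per h.
- by exists d.
Qed.

End NonRight.

(** * Right angled triangles *)

Section Right.
Local Open Scope R_scope.

(** * The regular hexagon *)

Section Hexagon.
Variables (X : point -> Prop) (a b : R).
Hypothesis aa : 4 * (a * a) = 1.
Hypothesis bb : 4 * (b * b) = 3.
Hypothesis cov : tri_covered X 4 1 3.
Hypothesis Xu : X (- 1, 0).
Hypothesis Xv : X (1, 0).
Hypothesis X1 : X (a, b).
Hypothesis X2 : X (- a, - b).
Hypothesis X3 : X (a, - b).

Lemma hexagon_side p q : X p -> X q ->
  p = q \/ sqd p q = 4 \/ sqd p q = 1 \/ sqd p q = 3.
Proof.
move=> Xp Xq; case: (excluded_middle_informative (p = q)) => [->|pq]; first by left.
by right; apply: (cover_side cov).
Qed.

(** The distance 1 from the centre to the vertices is a side, so distances to the vertices do not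
    exclude it. The copy over the centre and u does: its third vertex would fit nowhere. *)
Lemma hexagon_no_center : ~ X (0, 0).
Proof.
move=> X0; have ne : (0, 0) <> (- 1, 0) :> point by case; lra.
have cov' : tri_covered X 1 3 4 by apply: cover_perm cov; rewrite /perm3; tauto.
have s : sqd (0, 0) (- 1, 0) = 1 by rewrite /sqd /=; ring.
have [f [Xf hf]] := cover_third cov' X0 Xu ne s.
have fv := hexagon_side Xf Xv; have f1 := hexagon_side Xf X1.
have f2 := hexagon_side Xf X2; have f3 := hexagon_side Xf X3.
move: f hf fv f1 f2 f3 {Xf} => [fx fy]; rewrite /sqd /= => hf fv f1 f2 f3.
case: hf => -[h1 h2]; case: fv => [[E1 E2]|[fv|[fv|fv]]]; try (solve [absurd_algebra]);
  case: f1 => [[E3 E4]|[f1|[f1|f1]]]; try (solve [absurd_algebra]);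
  case: f2 => [[E5 E6]|[f2|[f2|f2]]]; try (solve [absurd_algebra]);
  by case: f3 => [[E7 E8]|[f3|[f3|f3]]]; absurd_algebra.
Qed.

Lemma hexagon_points p : X p ->
  [\/ p = (- 1, 0), p = (1, 0) | p = (a, b)] \/
  [\/ p = (- a, - b), p = (a, - b) | p = (- a, b)].
Proof.
move=> Xp.
have pu := hexagon_side Xp Xu; have pv := hexagon_side Xp Xv.
have p1 := hexagon_side Xp X1; have p2 := hexagon_side Xp X2.
have p3 := hexagon_side Xp X3.
case: pu => [->|pu]; first by left; apply: Or31.
case: pv => [->|pv]; first by left; apply: Or32.
case: p1 => [->|p1]; first by left; apply: Or33.
case: p2 => [->|p2]; first by right; apply: Or31.
case: p3 => [->|p3]; first by right; apply: Or32.
right; apply: Or33.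
(* Two diameters of the hexagon: both sums are twice the squared distance to the centre plus 2. *)
have lin : sqd p (- 1, 0) + sqd p (1, 0) = sqd p (a, b) + sqd p (- a, - b).
  by case: (p) => px py; rewrite /sqd /=; lra.
have center : p = (0, 0) -> p = (- a, b).
  by move=> pE; rewrite pE in Xp; case: hexagon_no_center.
case: pu => [pu|[pu|pu]]; case: pv => [pv|[pv|pv]]; case: p1 => [p1|[p1|p1]];
  case: p2 => [p2|[p2|p2]]; rewrite pu pv p1 p2 in lin; try (exfalso; lra);
  case: p3 => [p3|[p3|p3]];
  move: pu pv p1 p2 p3 center; case: (p) => px py; rewrite /sqd /= => pu pv p1 p2 p3 center;
  first [ solve [absurd_algebra] | by congr pair; algebra | by apply: center; congr pair; algebra ].
Qed.

Lemma hexagon_labelled : labelled X 4 1 3 6 hexa_edge.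
Proof.
pose V i := nth (0, 0)
  [:: (2 * a, 0); (a, b); (- a, b); (- 2 * a, 0); (- a, - b); (a, - b)] i.
apply: (@labelled_of_colors X 4 1 3 6 V (cyc_dist 6) (side_value 1 3 4 0) rainbow).
(* The signs of a and b are left open to admit every placement of the known vertices, so which of u
   and v has label 0 depends on the sign of a. *)
- have a2 : 2 * a = 1 \/ 2 * a = - 1.
    have : (2 * a - 1) * (2 * a + 1) = 0 by lra.
    by case/Rmult_integral => ?; [left|right]; lra.
  have na : 2 * a = -1 -> - 2 * a = 1 by lra.
  have na' : 2 * a = 1 -> - 2 * a = -1 by lra.
  move=> p /hexagon_points[[||]|[||]] ->.
  + by case: a2 => h; [exists 3%N|exists 0%N] => //; rewrite /V /= ?h ?(na' h).
  + by case: a2 => h; [exists 0%N|exists 3%N] => //; rewrite /V /= ?h ?(na h).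
  + by exists 1%N.
  + by exists 4%N.
  + by exists 5%N.
  + by exists 2%N.
- by case=> [|[|[|[|[|[|i]]]]]] // [|[|[|[|[|[|j]]]]]] // _ _; rewrite /V /sqd /=; lra.
- move=> i j k h; apply: (@rainbow_of_perm3 1 3 4) => //; try lra.
  by apply: perm3_trans h _; rewrite /perm3; tauto.
Qed.

End Hexagon.

Section Half.
Variables (X : point -> Prop) (Q S x y : R).
Hypothesis y0 : y <> 0.
Hypothesis EQ : Q = (x + 1) * (x + 1) + y * y.
Hypothesis ES : S = (x - 1) * (x - 1) + y * y.
Hypothesis cov : tri_covered X 4 Q S.
Hypothesis Xu : X (- 1, 0).
Hypothesis Xv : X (1, 0).
Hypothesis Xc : X (x, y).

(** The right angle is at u, so u is the midpoint of cd and cd^2 = 4Q must be a side. This leaves Q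
    = 1 and Q = 4/3; the copy over cd refutes the first, and a further point the second. *)
Lemma kite_leg : 4 + Q = S -> X (x, - y) -> False.
Proof.
move=> leg Xd; have yy0 := yy_gt0 y0.
have xE : x = - 1 by lra.
have yyE : y * y = Q by move: EQ; rewrite xE; lra.
have ne : (x, y) <> (x, - y) by case; lra.
have sE : sqd (x, y) (x, - y) = 4 * Q by rewrite /sqd /=; lra.
have [e [Xe t]] := cov Xc Xd ne.
have s := cover_side cov Xc Xd ne; rewrite sE in s t.
have eu := side cov Xe Xu; have ev := side cov Xe Xv.
case: s => [s|[s|s]]; last 1 first.
- have Q43 : 3 * Q = 4 by lra.
  have h : sqd e (x, y) = 4 /\ sqd e (x, - y) = Q \/ sqd e (x, y) = Q /\ sqd e (x, - y) = 4.
    have : perm3 S (sqd (x, - y) e) (sqd e (x, y)) S 4 Q.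
      by move: t; rewrite /tri sE s => t; apply: (perm3_trans t); rewrite /perm3; tauto.
    by move=> /perm3_cancel; rewrite (sqdC _ e); tauto.
  have euE : sqd e (- 1, 0) = Q.
    by move: h; case: (e) => ex ey; rewrite /sqd /= => -[] [h1 h2]; algebra.
  have ne' : e <> (- 1, 0) by move=> eE; rewrite eE sqd_refl in euE; lra.
  have [f [Xf hf]] := cover_thirdQ cov Xe Xu ne' euE.
  have fv := side cov Xf Xv; have fc := side cov Xf Xc; have fd := side cov Xf Xd.
  move: e f h hf fv fc fd ev euE {eu Xe t ne' Xf} => [ex ey] [fx fy].
  rewrite /sqd /= => h hf fv fc fd ev euE.
  case: h => -[h1 h2]; case: ev => [[E1 E2]|[ev|[ev|ev]]]; try (solve [absurd_algebra]);
    case: hf => -[h3 h4];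
    case: fv => [[E3 E4]|[fv|[fv|fv]]]; try (solve [absurd_algebra]);
    case: fc => [[E5 E6]|[fc|[fc|fc]]]; try (solve [absurd_algebra]);
    by case: fd => [[E7 E8]|[fd|[fd|fd]]]; absurd_algebra.
- have Q1 : Q = 1 by lra.
  have h : sqd e (x, y) = Q /\ sqd e (x, - y) = S \/ sqd e (x, y) = S /\ sqd e (x, - y) = Q.
    move: t; rewrite /tri sE s => /perm3_cancel; rewrite (sqdC _ e); tauto.
  have euE : sqd e (- 1, 0) = 2.
    by move: h; case: (e) => ex ey; rewrite /sqd /= => -[] [h1 h2]; algebra.
  by case: eu => [eE|[eu|[eu|eu]]]; [rewrite eE sqd_refl in euE|..]; lra.
- lra.
Qed.

Lemma perm3_hex : Q + S = 4 -> 4 * (x * x) = 1 -> perm3 4 1 3 4 Q S.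
Proof.
move=> hyp xx; have : (2 * x - 1) * (2 * x + 1) = 0 by lra.
by case/Rmult_integral => ?; [right|]; left; split; [|split|..]; lra.
Qed.

(** The points u, v, c, d are four vertices of the hexagon; the copy over cd contributes a fifth,
    and then [hexagon_labelled] applies with suitable signs. *)
Lemma hexagon_of_pair d : Q + S = 4 -> 4 * (x * x) = 1 -> X d ->
  d = (x, - y) \/ d = (- x, y) -> labelled X 4 Q S 6 hexa_edge.
Proof.
move=> hyp xx Xd hd; have yy0 := yy_gt0 y0.
have yy : 4 * (y * y) = 3 by lra.
have per := perm3_hex hyp xx.
have cov' := cover_perm per cov.
have x0 : x <> 0 by move=> x0; rewrite x0 in xx; lra.
have dc : (x, y) <> d by case: hd => -> [] ?; lra.
have [e [Xe t]] := cov' _ _ Xc Xd dc.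
have eu := hexagon_side cov' Xe Xu; have ev := hexagon_side cov' Xe Xv.
have corner : e = (- x, - y) \/ (d = (x, - y) /\ e = (- x, y)) \/ (d = (- x, y) /\ e = (x, - y)).
  case: hd => dE; rewrite dE in t *; move: e t eu ev {Xe} => [ex ey].
    rewrite /tri (_ : sqd (x, y) (x, - y) = 3); last by rewrite /sqd /=; lra.
    move=> t; have {}t : perm3 3 (sqd (x, - y) (ex, ey)) (sqd (ex, ey) (x, y)) 3 4 1.
      by apply: (perm3_trans t); rewrite /perm3; tauto.
    move/perm3_cancel: t; rewrite /sqd /= => t eu ev.
    case: t => -[h1 h2]; case: eu => [[E1 E2]|[eu|[eu|eu]]]; try (solve [absurd_algebra]);
    case: ev => [[E3 E4]|[ev|[ev|ev]]];
    first [ solve [absurd_algebra] | by left; congr pair; algebra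
      | by right; left; split=> //; congr pair; algebra ].
  rewrite /tri (_ : sqd (x, y) (- x, y) = 1); last by rewrite /sqd /=; lra.
  move=> t; have {}t : perm3 1 (sqd (- x, y) (ex, ey)) (sqd (ex, ey) (x, y)) 1 4 3.
    by apply: (perm3_trans t); rewrite /perm3; tauto.
  move/perm3_cancel: t; rewrite /sqd /= => t eu ev.
  case: t => -[h1 h2]; case: eu => [[E1 E2]|[eu|[eu|eu]]]; try (solve [absurd_algebra]);
    case: ev => [[E3 E4]|[ev|[ev|ev]]];
    first [ solve [absurd_algebra] | by left; congr pair; algebra
      | by right; right; split=> //; congr pair; algebra ].
apply: (labelled_perm per).
have nx : 4 * (- x * - x) = 1 by lra.
have ny : 4 * (- y * - y) = 3 by lra.
case: corner => [eE|[[dE eE]|[dE eE]]]; rewrite ?dE eE in Xd Xe.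
- case: hd => dE; rewrite dE in Xd.
    exact: (hexagon_labelled xx yy cov' Xu Xv Xc Xe Xd).
  by apply: (hexagon_labelled nx ny cov' Xu Xv); rewrite ?Ropp_involutive.
- by apply: (hexagon_labelled xx ny cov' Xu Xv); rewrite ?Ropp_involutive.
- by apply: (hexagon_labelled xx ny cov' Xu Xv); rewrite ?Ropp_involutive.
Qed.

End Half.
(** If u, v, c, d are the corners of a rectangle, its other triples are copies as well. A kite or
    trapezoid that is no rectangle forces the angles 30 and 60, hence the hexagon, or is
    impossible. *)
Lemma normalized_right (X : point -> Prop) (Q S x y : R) d :
  y <> 0 -> Q = (x + 1) * (x + 1) + y * y -> S = (x - 1) * (x - 1) + y * y ->
  tri_covered X 4 Q S -> X (- 1, 0) -> X (1, 0) -> X (x, y) -> alg_right 4 Q S ->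
  X d -> d <> (x, y) -> [\/ d = (x, - y), d = (- x, - y) | d = (- x, y)] ->
  tri 4 Q S (- 1, 0) (x, y) d \/ labelled X 4 Q S 6 hexa_edge.
Proof.
move=> y0 EQ ES cov Xu Xv Xc rt Xd dc hd; have yy0 := yy_gt0 y0.
have Q0 := Q_gt0 y0 EQ; have S0 := S_gt0 y0 ES.
have sides := cover_side cov Xc Xd (not_eq_sym dc).
have swap : perm3 4 S Q 4 Q S by rewrite /perm3; tauto.
have uc : sqd (- 1, 0) (x, y) = Q by rewrite /sqd /=; lra.
case: hd => dE; rewrite dE in Xd dc sides *.
- have sE : sqd (x, y) (x, - y) = 4 * (y * y) by rewrite /sqd /=; ring.
  rewrite sE in sides.
  case: rt => [rt|[rt|rt]].
  + by exfalso; apply: (kite_leg y0 EQ ES cov Xu Xv Xc).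
  + have m : x * x + y * y = 1 by lra.
    case: sides => [s|[s|s]].
    * have x0 : x = 0.
        have xx0 : x * x = 0 by lra.
        by case/Rmult_integral: xx0.
      left; rewrite /tri uc sE (_ : sqd (x, - y) (- 1, 0) = Q); last by rewrite /sqd /=; lra.
      by right; right; left; split; [lra|split; [lra|]]; rewrite EQ ES x0; lra.
    * right; apply: (hexagon_of_pair y0 EQ ES cov Xu Xv Xc rt _ Xd); last by left.
      have : (x + 1) * (2 * x - 1) = 0 by lra.
      case/Rmult_integral=> e; last by rewrite (_ : x = 1 / 2); lra.
      have xE : x = -1 by lra.
      by rewrite xE in m; lra.
    * right; apply: (hexagon_of_pair y0 EQ ES cov Xu Xv Xc rt _ Xd); last by left.
      have : (x - 1) * (2 * x + 1) = 0 by lra.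
      case/Rmult_integral=> e; last by rewrite (_ : x = -1 / 2); lra.
      have xE : x = 1 by lra.
      by rewrite xE in m; lra.
  + exfalso.
    have cov' := @sim_cover mirror 1 Rlt_0_1 mirrorE _ _ _ _ (cover_perm swap cov).
    rewrite !Rmult_1_l in cov'.
    apply: (@kite_leg (image_of mirror X) S Q (- x) y y0 _ _ cov') => //.
    * by rewrite ES; ring.
    * by rewrite EQ; ring.
    * by exists (1, 0).
    * by exists (- 1, 0); split=> //; rewrite /mirror /= Ropp_involutive.
    * by exists (x, y).
    * lra.
    * by exists (x, - y).
- have sE : sqd (x, y) (- x, - y) = 4 * (x * x + y * y) by rewrite /sqd /=; ring.
  rewrite sE in sides.
  case: rt => [rt|[rt|rt]].
  + have xE : x = -1 by lra.
    by exfalso; rewrite xE in EQ ES sides; lra.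
  + left; rewrite /tri uc sE (_ : sqd (- x, - y) (- 1, 0) = S); last by rewrite /sqd /=; lra.
    by right; right; left; lra.
  + have xE : x = 1 by lra.
    by exfalso; rewrite xE in EQ ES sides; lra.
have sE : sqd (x, y) (- x, y) = 4 * (x * x) by rewrite /sqd /=; ring.
rewrite sE in sides.
have close : 4 * (x * x) = 4 -> tri 4 Q S (- 1, 0) (x, y) (- x, y).
  move=> s; rewrite /tri uc sE (_ : sqd (- x, y) (- 1, 0) = S); last by rewrite /sqd /=; lra.
  by right; right; left; lra.
case: rt => [rt|[rt|rt]].
- have xE : x = -1 by lra.
  by left; apply: close; rewrite xE; lra.
- have m : x * x + y * y = 1 by lra.
  case: sides => [s|[s|s]]; first by left; apply: close.
  + right; apply: (hexagon_of_pair y0 EQ ES cov Xu Xv Xc rt _ Xd); last by right.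
    have : (x - 1) * (2 * x + 1) = 0 by lra.
    case/Rmult_integral=> e; last by rewrite (_ : x = -1 / 2); lra.
    have xE : x = 1 by lra.
    by rewrite xE in m; lra.
  + right; apply: (hexagon_of_pair y0 EQ ES cov Xu Xv Xc rt _ Xd); last by right.
    have : (x + 1) * (2 * x - 1) = 0 by lra.
    case/Rmult_integral=> e; last by rewrite (_ : x = 1 / 2); lra.
    have xE : x = -1 by lra.
    by rewrite xE in m; lra.
- have xE : x = 1 by lra.
  by left; apply: close; rewrite xE; lra.
Qed.

(** For bounding the number of third vertices: two of them that are mirror images in the line uv and
    close up with u force x = 0, and then the four corners (x, y), (x, -y), (-x, y), (-x, -y) are
    only two points. *)
Lemma kite_closed (Q S x y z : R) : y <> 0 ->
  Q = (x + 1) * (x + 1) + y * y -> S = (x - 1) * (x - 1) + y * y ->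
  alg_right 4 Q S -> z = x \/ z = - x ->
  tri 4 Q S (- 1, 0) (z, y) (z, - y) \/ tri 4 Q S (- 1, 0) (z, - y) (z, y) -> x = 0.
Proof.
move=> y0 EQ ES rt zx ht; have yy0 := yy_gt0 y0.
have {ht} : tri 4 Q S (- 1, 0) (z, y) (z, - y) by case: ht => // /triC23.
set U := (z + 1) * (z + 1) + y * y.
have -> : tri 4 Q S (- 1, 0) (z, y) (z, - y) = perm3 U (4 * (y * y)) U 4 Q S.
  rewrite /tri (_ : sqd (- 1, 0) (z, y) = U); last by rewrite /sqd /U /=; ring.
  rewrite (_ : sqd (z, - y) (- 1, 0) = U); last by rewrite /sqd /U /=; ring.
  by rewrite (_ : sqd (z, y) (z, - y) = 4 * (y * y)); last by rewrite /sqd /=; ring.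
have UE : U = Q \/ U = S by rewrite /U; case: zx => ->; [left|right]; lra.
clearbody U => t.
have QS : Q = S -> x = 0 by lra.
case: rt => rt; [|case: rt => rt].
- have xE : x = -1 by lra.
  have [e1 e2] : Q = y * y /\ S = y * y + 4 by rewrite EQ ES xE; lra.
  by case: UE => UE; case: t => [|[|[|[|[|]]]]] [? [? ?]]; lra.
- apply: QS; have [|] : U = Q /\ (Q = S \/ Q = 4 /\ 4 * (y * y) = S) \/
      U = S /\ (Q = S \/ S = 4 /\ 4 * (y * y) = Q).
    case: UE => UE; [left|right]; split=> //;
    by case: t => [|[|[|[|[|]]]]] [? [? ?]]; first [left; lra | right; lra].
  + by case=> _ [//|[? ?]]; lra.
  + by case=> _ [//|[? ?]]; lra.
- have xE : x = 1 by lra.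
  have [e1 e2] : S = y * y /\ Q = y * y + 4 by rewrite EQ ES xE; lra.
  by case: UE => UE; case: t => [|[|[|[|[|]]]]] [? [? ?]]; lra.
Qed.

Theorem right_cover (X : point -> Prop) A B C :
  0 < A -> 0 < B -> 0 < C -> 0 < heron A B C -> alg_right A B C -> tri_covered X A B C ->
  ((forall u v c d, X u -> X v -> X c -> X d ->
     tri A B C u v c -> tri A B C u v d -> c <> d -> tri A B C u c d) /\
   (forall u v c d e, X u -> X v -> X c -> X d -> X e ->
     tri A B C u v c -> tri A B C u v d -> tri A B C u v e ->
     [\/ c = d, d = e | e = c])) \/
  labelled X A B C 6 hexa_edge.
Proof.
move=> A0 B0 C0 H0 rt cov.
case: (excluded_middle_informative (labelled X A B C 6 hexa_edge)) => [|none]; first by right.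
have rtk k Q S : perm3 4 Q S (k * A) (k * B) (k * C) -> alg_right 4 Q S.
  move=> /perm3_sym per; apply: (alg_right_perm per); rewrite /alg_right -!Rmult_plus_distr_l.
  by case: rt => [->|[->|->]]; tauto.
have clo u v c d : X u -> X v -> X c -> X d ->
     tri A B C u v c -> tri A B C u v d -> c <> d -> tri A B C u c d.
  move=> Xu Xv Xc Xd tc td cd.
  have := normalize_config A0 B0 C0 H0 cov Xu Xv Xc Xd tc td cd.
  move=> [Q [S [x [y [[k0 phiE per eu ev] [[y0 EQ ES ec] [cov' dc hd]]]]]]].
  case: (normalized_right y0 EQ ES cov' _ _ _ (rtk _ _ _ per) _ dc hd).
  - by rewrite -eu; exists u.
  - by rewrite -ev; exists v.
  - by rewrite -ec; exists c.
  - by exists d.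
  - by rewrite -eu -ec => /(tri_perm _ _ _ per)/(sim_tri k0 phiE).
  - by move=> l; case: none; apply: (sim_labelled k0 phiE); apply: (labelled_perm per).
left; split=> // u v c d e Xu Xv Xc Xd Xe tc td te.
case: (excluded_middle_informative (c = d)) => [|cd]; first by move=> ?; apply: Or31.
case: (excluded_middle_informative (d = e)) => [|de]; first by move=> ?; apply: Or32.
case: (excluded_middle_informative (e = c)) => [|ec]; first by move=> ?; apply: Or33.
exfalso.
have := normalize_config A0 B0 C0 H0 cov Xu Xv Xc Xd tc td cd.
move=> [Q [S [x [y [[k0 phiE per eu ev] [[y0 EQ ES cE] [cov' dc hd]]]]]]].
have inj p q : normalize u v p = normalize u v q -> p = q.
  move=> h; apply: sqd_eq0; apply: (Rmult_eq_reg_l (4 / sqd u v)); last lra.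
  by rewrite -phiE h sqd_refl; ring.
have he : [\/ normalize u v e = (x, - y), normalize u v e = (- x, - y) |
    normalize u v e = (- x, y)].
  apply: (normalized_thirds y0 EQ ES).
    by rewrite -eu -ev; apply/(tri_perm _ _ _ per)/(sim_tri k0 phiE).
  by rewrite -cE => /inj.
have tt p q : tri A B C u p q -> tri 4 Q S (- 1, 0) (normalize u v p) (normalize u v q).
  by move=> h; rewrite -eu; apply/(tri_perm _ _ _ per)/(sim_tri k0 phiE).
have t1 := tt _ _ (clo u v c d Xu Xv Xc Xd tc td cd).
have t2 := tt _ _ (clo u v d e Xu Xv Xd Xe td te de).
have t3 := tt _ _ (clo u v c e Xu Xv Xc Xe tc te (not_eq_sym ec)).
have ndc : normalize u v d <> normalize u v c by move=> /inj h; apply: cd.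
have nde : normalize u v d <> normalize u v e by move=> /inj.
have nec : normalize u v e <> normalize u v c by move=> /inj.
have kc := kite_closed y0 EQ ES (rtk _ _ _ per).
(* Of three distinct corners, two are mirror images in the line uv. *)
have x0 : x = 0.
  move: t1 t2 t3 nde; rewrite cE.
  case: hd => ->; case: he => -> // t1 t2 t3 nde.
  - by apply: (kc x); [left|left].
  - by apply: (kc x); [left|left].
  - by apply: (kc x); [left|left].
  - by apply: (kc (- x)); [right|right].
  - by apply: (kc x); [left|left].
  - by apply: (kc (- x)); [right|left].
move: ndc nde nec; rewrite cE x0 Ropp_0 in hd he *.
by case: hd => ->; case: he => ->.
Qed.

End Right.

(** * Angles *)

Section Angles.
Local Open Scope R_scope.

Lemma heron_gt0 a b c : is_triangle a b c -> 0 < heron (a * a) (b * b) (c * c).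
Proof.
move=> [a0 [b0 [c0 [h1 [h2 h3]]]]].
have -> : heron (a * a) (b * b) (c * c) = (a + b + c) * (b + c - a) * (c + a - b) * (a + b - c).
  by rewrite /heron; ring.
by repeat apply: Rmult_lt_0_compat; lra.
Qed.

Lemma cos_angleA a b c : is_triangle a b c ->
  cos (angleA a b c) = (b * b + c * c - a * a) / (2 * b * c).
Proof.
move=> T; have := heron_gt0 T; case: T => [a0 [b0 [c0 [h1 [h2 h3]]]]] H.
have bc : 0 < 2 * b * c by nra.
rewrite /angleA cos_acos //.
have : (b * b + c * c - a * a) / (2 * b * c) * (2 * b * c) = b * b + c * c - a * a.
  by field; lra.
move: (_ / (2 * b * c)) => r hr.
have f1 : 0 < (a + b + c) * (b + c - a) by apply: Rmult_lt_0_compat; lra.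
have f2 : 0 < (c + a - b) * (a + b - c) by apply: Rmult_lt_0_compat; lra.
by split; apply: Rnot_lt_le => h; nra.
Qed.

Lemma angleA_bound a b c : 0 <= angleA a b c <= PI.
Proof. exact: acos_bound. Qed.

Lemma rot_triangle a b c : is_triangle a b c -> is_triangle b c a.
Proof. by rewrite /is_triangle; lra. Qed.

Lemma cos_inj_0PI x y : 0 <= x <= PI -> 0 <= y <= PI -> cos x = cos y -> x = y.
Proof. by move=> hx hy e; rewrite -(acos_cos x) // e acos_cos. Qed.

Lemma sin_angleA a b c : is_triangle a b c ->
  sin (angleA a b c) * sin (angleA a b c) = heron (a * a) (b * b) (c * c) / (4 * (b * b) * (c * c)).
Proof.
move=> T; have := sin2_cos2 (angleA a b c); rewrite /Rsqr cos_angleA //.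
case: T => [a0 [b0 [c0 _]]] e; rewrite /heron.
rewrite (_ : sin _ * sin _ = 1 - (b * b + c * c - a * a) / (2 * b * c) *
   ((b * b + c * c - a * a) / (2 * b * c))); last lra.
by field; lra.
Qed.

Lemma sin_angleA_gt0 a b c : is_triangle a b c -> 0 < sin (angleA a b c).
Proof.
move=> T; have := sin_angleA T; have := heron_gt0 T.
have := sin_ge_0 _ (proj1 (angleA_bound a b c)) (proj2 (angleA_bound a b c)).
case: T => [a0 [b0 [c0 _]]] h1 h2 e.
have : 0 < heron (a * a) (b * b) (c * c) / (4 * (b * b) * (c * c)).
  by apply: Rdiv_lt_0_compat => //; repeat apply: Rmult_lt_0_compat; lra.
by rewrite -e; case: h1 => // <-; lra.
Qed.

(** The law of cosines and Heron's formula give cos(x + y) = - cos z. Positivity of sin(x + y) keeps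
    x + y below pi, where the cosine is injective. *)
Lemma angle_sum a b c : is_triangle a b c ->
  angleA a b c + angleB a b c + angleC a b c = PI.
Proof.
move=> T; have TB := rot_triangle T; have TC := rot_triangle TB.
rewrite /angleB /angleC.
have [sA sB] := (sin_angleA_gt0 T, sin_angleA_gt0 TB).
have [cA [cB cC]] := (cos_angleA T, (cos_angleA TB, cos_angleA TC)).
have [eA eB] := (sin_angleA T, sin_angleA TB).
have bA := angleA_bound a b c; have bB := angleA_bound b c a; have bC := angleA_bound c a b.
move: (angleA a b c) (angleA b c a) (angleA c a b) sA sB cA cB cC eA eB bA bB bC.
move=> x y z sA sB cA cB cC eA eB bA bB bC.
have H := heron_gt0 T; case: T => [a0 [b0 [c0 [h1 [h2 h3]]]]].
have abc : 0 < a * b /\ 0 < b * c by split; apply: Rmult_lt_0_compat.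
have prod : sin x * sin y = heron (a * a) (b * b) (c * c) / (4 * (a * b) * (c * c)).
  have e : (sin x * sin y - heron (a * a) (b * b) (c * c) / (4 * (a * b) * (c * c))) *
     (sin x * sin y + heron (a * a) (b * b) (c * c) / (4 * (a * b) * (c * c))) = 0.
    rewrite (_ : (_ - _) * _ = sin x * sin x * (sin y * sin y) -
      heron (a * a) (b * b) (c * c) / (4 * (a * b) * (c * c)) *
      (heron (a * a) (b * b) (c * c) / (4 * (a * b) * (c * c)))); last ring.
    by rewrite eA eB /heron; field; lra.
  have pos : 0 < heron (a * a) (b * b) (c * c) / (4 * (a * b) * (c * c)).
    by apply: Rdiv_lt_0_compat => //; repeat apply: Rmult_lt_0_compat; lra.
  have ss : 0 < sin x * sin y by apply: Rmult_lt_0_compat.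
  by case/Rmult_integral: e => e; lra.
have cxy : cos (x + y) = - cos z.
  by rewrite cos_plus prod cA cB cC /heron; field; lra.
have sxy : 0 < sin (x + y).
  have law : a * sin y = b * sin x.
    apply: (Rmult_eq_reg_l (sin x)); last lra.
    rewrite (_ : sin x * (a * sin y) = a * (sin x * sin y)); last ring.
    rewrite (_ : sin x * (b * sin x) = b * (sin x * sin x)); last ring.
    by rewrite prod eA /heron; field; lra.
  have : 0 < a * sin (x + y).
    rewrite sin_plus (_ : a * _ = sin x * (a * cos y) + cos x * (a * sin y)); last ring.
    rewrite law (_ : _ + _ = sin x * (a * cos y + b * cos x)); last ring.
    rewrite cA cB (_ : a * _ + b * _ = c); last by field; lra.
    exact: Rmult_lt_0_compat.
  by move=> ?; apply: Rnot_le_lt => ?; nra.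
have xy : x + y < PI.
  apply: Rnot_le_lt => le; have := sin_le_0 (x + y) le; lra.
have : x + y = PI - z by apply: cos_inj_0PI; [lra|lra|rewrite Rtrigo_facts.cos_pi_minus; lra].
lra.
Qed.

Lemma angleA_sym a b c : angleA a c b = angleA a b c.
Proof. by rewrite /angleA; congr acos; congr (_ / _); ring. Qed.

Lemma is_triangle_perm p q r a b c : perm3 p q r a b c ->
  is_triangle a b c -> is_triangle p q r.
Proof. by rewrite /is_triangle; case=> [|[|[|[|[|]]]]] [-> [-> ->]]; lra. Qed.

Lemma of_type_perm p q r a b c al be ga : perm3 p q r a b c ->
  of_type p q r al be ga -> of_type a b c al be ga.
Proof.
rewrite /of_type /angleB /angleC.
case=> [|[|[|[|[|]]]]] [-> [-> ->]] //=;
  rewrite ?(angleA_sym a b c) ?(angleA_sym b c a) ?(angleA_sym c a b); tauto.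
Qed.

Lemma of_type_angles a b c al be ga : al >= be -> be >= ga ->
  perm3 (angleA a b c) (angleB a b c) (angleC a b c) al be ga -> of_type a b c al be ga.
Proof. by move=> h1 h2 h3; split=> //; split. Qed.

Lemma perm3_sqrt P Q S a b c : 0 < a -> 0 < b -> 0 < c ->
  perm3 P Q S (a * a) (b * b) (c * c) -> perm3 (sqrt P) (sqrt Q) (sqrt S) a b c.
Proof.
move=> a0 b0 c0 h; have : perm3 (sqrt P) (sqrt Q) (sqrt S)
    (sqrt (a * a)) (sqrt (b * b)) (sqrt (c * c)).
  by case: h => [|[|[|[|[|]]]]] [-> [-> ->]]; rewrite /perm3; tauto.
by rewrite !sqrt_square //; lra.
Qed.

Lemma right_angled_alg a b c : is_triangle a b c ->
  right_angled a b c <-> alg_right (a * a) (b * b) (c * c).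
Proof.
have one p q r : is_triangle p q r -> angleA p q r = deg 90 <-> q * q + r * r = p * p.
  move=> T; have e := cos_angleA T; case: T => [p0 [q0 [r0 _]]].
  have d90 : deg 90 = PI / 2 by rewrite /deg; field.
  split=> [h|h].
    rewrite h d90 cos_PI2 in e.
    have : (q * q + r * r - p * p) / (2 * q * r) * (2 * q * r) = q * q + r * r - p * p.
      by field; lra.
    by rewrite -e; lra.
  rewrite d90; apply: cos_inj_0PI; [exact: angleA_bound|have := PI_RGT_0; lra|].
  rewrite e cos_PI2 h; field; lra.
move=> T; have TB := rot_triangle T; have TC := rot_triangle TB.
by rewrite /right_angled /angleB /angleC (one _ _ _ T) (one _ _ _ TB) (one _ _ _ TC) /alg_right; tauto.
Qed.

Lemma isosceles_angles p r : is_triangle p p r ->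
  angleB p p r = angleA p p r /\ angleC p p r = PI - 2 * angleA p p r /\
  cos (angleA p p r) = r / p / 2.
Proof.
move=> T; have sum := angle_sum T; have e := cos_angleA T.
have eB : angleB p p r = angleA p p r by rewrite /angleB angleA_sym.
split=> //; split; first by lra.
by rewrite e; case: T => [p0 [_ [r0 _]]]; field; lra.
Qed.

Lemma alg_120_type a b c : is_triangle a b c -> alg_120 (a * a) (b * b) (c * c) ->
  of_type a b c (deg 120) (deg 30) (deg 30).
Proof.
move=> T; case: (T) => [a0 [b0 [c0 _]]] [P /(perm3_sqrt a0 b0 c0) h].
apply: (of_type_perm h); have T' := is_triangle_perm h T.
have P0 : 0 < P by apply: sqrt_lt_0_alt; rewrite sqrt_0; case: T'.
have r3 : sqrt (3 * P) = sqrt 3 * sqrt P by rewrite sqrt_mult; lra.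
have := isosceles_angles T'; have pi := PI_RGT_0.
have s3 : cos (PI / 6) = sqrt (3 * P) / sqrt P / 2.
  by rewrite cos_PI6 r3; field; case: T' => ?; lra.
rewrite -s3 => -[eB [eC /cos_inj_0PI eA]].
have {}eA : angleA (sqrt P) (sqrt P) (sqrt (3 * P)) = PI / 6.
  by apply: eA; [exact: angleA_bound|lra].
rewrite eA in eB eC; apply: of_type_angles; rewrite ?eA ?eB ?eC /deg /perm3; lra.
Qed.

Lemma cos_double x : cos (2 * x) = 2 * (cos x * cos x) - 1.
Proof. by rewrite cos_2a_cos; ring. Qed.

Lemma cos_triple x : cos (3 * x) = 4 * (cos x * cos x * cos x) - 3 * cos x.
Proof.
rewrite (_ : 3 * x = 2 * x + x); last ring.
rewrite cos_plus cos_double sin_2a.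
have := sin2_cos2 x; rewrite /Rsqr => e.
rewrite (_ : 2 * sin x * cos x * sin x = 2 * cos x * (sin x * sin x)); last ring.
by rewrite (_ : sin x * sin x = 1 - cos x * cos x); [ring | lra].
Qed.

Lemma cos_gt0_bound x : 0 <= x <= PI -> 0 < cos x -> x < PI / 2.
Proof.
move=> h c0; apply: Rnot_le_lt => le.
by have := cos_le_0 x le; have := PI_RGT_0; lra.
Qed.

Lemma cos_2pi_minus x : cos (2 * PI - x) = cos x.
Proof. by rewrite cos_minus cos_2PI sin_2PI; ring. Qed.

(** The quadratic is a factor of cos 3x + cos 2x, whose other factor is cos x + 1; below pi/2 only x
    = pi/5 remains. *)
Lemma angle_36 x : 0 <= x <= PI -> 0 < cos x ->
  4 * (cos x * cos x) = 2 * cos x + 1 -> x = PI / 5.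
Proof.
move=> h c0 e; have lt := cos_gt0_bound h c0; have pi := PI_RGT_0.
have e3 : cos (3 * x) = - cos (2 * x) by rewrite cos_triple cos_double; nra.
rewrite -Rtrigo_facts.cos_pi_minus in e3.
case: (Rle_dec (3 * x) PI) => le; first by have := cos_inj_0PI _ _ e3; lra.
rewrite -(cos_2pi_minus (3 * x)) in e3.
by have := cos_inj_0PI _ _ e3; lra.
Qed.

(** The quadratic is a factor of cos 3x - cos 2x, whose other factor is cos x - 1; this accounts for
    the spurious solution x = 0. *)
Lemma angle_72 x : 0 <= x <= PI -> 0 < cos x ->
  4 * (cos x * cos x) = 1 - 2 * cos x -> x = 2 * PI / 5.
Proof.
move=> h c0 e; have lt := cos_gt0_bound h c0; have pi := PI_RGT_0.
have e3 : cos (3 * x) = cos (2 * x) by rewrite cos_triple cos_double; nra.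
case: (Rle_dec (3 * x) PI) => le.
  have := cos_inj_0PI _ _ e3 => e4; have x0 : x = 0 by lra.
  by rewrite x0 cos_0 in e; lra.
rewrite -(cos_2pi_minus (3 * x)) in e3.
by have := cos_inj_0PI _ _ e3; lra.
Qed.

Lemma alg_penta_type a b c : is_triangle a b c -> alg_penta (a * a) (b * b) (c * c) ->
  of_type a b c (deg 108) (deg 36) (deg 36) \/ of_type a b c (deg 72) (deg 72) (deg 36).
Proof.
move=> T; case: (T) => [a0 [b0 [c0 _]]] [P [t [ht /(perm3_sqrt a0 b0 c0) h]]].
have T' := is_triangle_perm h T; have pi := PI_RGT_0.
have p0 : 0 < sqrt P by case: T'.
have P0 : 0 < P by apply: sqrt_lt_0_alt; rewrite sqrt_0.
have r0 : 0 < sqrt (t * t * P) by case: T' => [_ [_ []]].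
have [eB [eC eA]] := isosceles_angles T'.
set x := angleA _ _ _ in eA eB eC.
have sE : 4 * (cos x * cos x) = t + 1.
  rewrite eA (_ : 4 * _ = sqrt (t * t * P) * sqrt (t * t * P) / (sqrt P * sqrt P)); last by field; lra.
  by rewrite !sqrt_sqrt; [rewrite -ht; field; lra|nra|nra].
have cx : 0 < cos x.
  by rewrite eA; repeat apply: Rdiv_lt_0_compat => //; lra.
(* Here 2 cos x = |t|, and the two factors correspond to the two signs of t. *)
have fac : (4 * (cos x * cos x) - 2 * cos x - 1) * (4 * (cos x * cos x) + 2 * cos x - 1) = 0.
  by move: (cos x) sE => s sE; clear - ht sE; algebra.
case/Rmult_integral: fac => e.
  have xE : x = PI / 5 by apply: angle_36 => //; [exact: angleA_bound|lra].
  left; apply: (of_type_perm h); apply: of_type_angles; rewrite ?eB ?eC -/x ?xE /deg /perm3; lra.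
have xE : x = 2 * PI / 5 by apply: angle_72 => //; [exact: angleA_bound|lra].
right; apply: (of_type_perm h); apply: of_type_angles; rewrite ?eB ?eC -/x ?xE /deg /perm3; lra.
Qed.

(* The law of cosines turns the two relations into [B = 2A] and [C = 2B]. *)
Lemma heptagonal_angles p q r : is_triangle p q r ->
  q * q = p * (p + r) -> r * r = q * (q + p) ->
  of_type p q r (deg (4 * 180 / 7)) (deg (2 * 180 / 7)) (deg (180 / 7)).
Proof.
move=> T h1 h2; have TB := rot_triangle T; have TC := rot_triangle TB.
have sum := angle_sum T; have pi := PI_RGT_0.
have [cA [cB cC]] := (cos_angleA T, (cos_angleA TB, cos_angleA TC)).
have bA := angleA_bound p q r; have bB := angleA_bound q r p.
have bC := angleA_bound r p q.
rewrite -/(angleB p q r) in cB bB; rewrite -/(angleC p q r) in cC bC.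
case: T => [p0 [q0 [r0 _]]] {TB TC}.
have cA' : cos (angleA p q r) = (p + r) / (2 * q).
  rewrite cA (_ : _ - _ = r * (p + r)); last lra.
  by field; lra.
have cB' : cos (angleB p q r) = (p + q) / (2 * r).
  rewrite cB (_ : _ - _ = p * (p + q)); last lra.
  by field; lra.
have eB : angleB p q r = 2 * angleA p q r.
  have c0 : 0 < cos (angleA p q r) by rewrite cA'; apply: Rdiv_lt_0_compat; lra.
  apply: cos_inj_0PI => //; first by have := cos_gt0_bound bA c0; lra.
  rewrite cos_double cA' cB.
  have -> : (p + r) / (2 * q) * ((p + r) / (2 * q)) = (p + r) / (4 * p).
    rewrite (_ : _ * _ = (p + r) * (p + r) / (4 * (q * q))); last by field; lra.
    by rewrite h1; field; lra.
  by rewrite h1; field; lra.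
have eC : angleC p q r = 2 * angleB p q r.
  have c0 : 0 < cos (angleB p q r) by rewrite cB'; apply: Rdiv_lt_0_compat; lra.
  apply: cos_inj_0PI => //; first by have := cos_gt0_bound bB c0; lra.
  rewrite cos_double cB' cC.
  have -> : (p + q) / (2 * r) * ((p + q) / (2 * r)) = (p + q) / (4 * q).
    rewrite (_ : _ * _ = (p + q) * (p + q) / (4 * (r * r))); last by field; lra.
    by rewrite h2; field; lra.
  by rewrite h2; field; lra.
have eA : angleA p q r = PI / 7 by lra.
rewrite eA in eB; rewrite eB in eC.
apply: of_type_angles; rewrite ?eA ?eC ?eB /deg; [lra|lra|].
by do 5!right; split; [field|split; field].
Qed.

Lemma alg_hepta_type a b c : is_triangle a b c -> alg_hepta (a * a) (b * b) (c * c) ->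
  of_type a b c (deg (4 * 180 / 7)) (deg (2 * 180 / 7)) (deg (180 / 7)).
Proof.
move=> T; case: (T) => [a0 [b0 [c0 _]]] [P [t [g h']]].
have h := perm3_sqrt a0 b0 c0 h'.
have T' := is_triangle_perm h T.
have s0 : 0 < sqrt P by case: T'.
have P0 : 0 < P by apply: sqrt_lt_0_alt; rewrite sqrt_0.
have z0 : 0 < (t * t - t) * P.
  by apply: sqrt_lt_0_alt; rewrite sqrt_0; case: T' => [_ [_ []]].
have tt0 : 0 < t * t - t by nra.
have sq x : sqrt (x * x * P) = Rabs x * sqrt P.
  by rewrite sqrt_mult; [rewrite sqrt_Rsqr_abs|nra|lra].
have zE : t * t - t = (t * t - 1) * (t * t - 1) by algebra.
rewrite zE !sq in h T'.
have T0 : t * (t * t + t - 2) = 1 by lra.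
(* The three roots lie in t > 1, -1 < t < 0 and t < -1. They describe the same triangle, with 1, |t|
   and |t^2 - 1| exchanging the roles of shortest, middle and longest side. *)
case: (Rlt_le_dec 0 t) => t0.
  have t1 : 1 < t by nra.
  rewrite (Rabs_pos_eq t) ?(Rabs_pos_eq (t * t - 1)) in h T'; try nra.
  have per : perm3 ((t * t - 1) * sqrt P) (sqrt P) (t * sqrt P) a b c.
    by apply: (@perm3_trans _ _ _ (sqrt P) (t * sqrt P) ((t * t - 1) * sqrt P)) => //; rewrite /perm3; tauto.
  apply: (of_type_perm per); apply: heptagonal_angles.
  - exact: is_triangle_perm per T.
  - by algebra.
  - by algebra.
have tn : t <> 0 by move=> e; rewrite e in g; lra.
have tm : t <> -1 by move=> e; rewrite e in g; lra.
rewrite (Rabs_left t) in h T'; last lra.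
case: (Rlt_le_dec (-1) t) => t1.
  rewrite (Rabs_left (t * t - 1)) in h T'; last nra.
  have per : perm3 (- t * sqrt P) (- (t * t - 1) * sqrt P) (sqrt P) a b c.
    by apply: (@perm3_trans _ _ _ (sqrt P) (- t * sqrt P) (- (t * t - 1) * sqrt P)) => //; rewrite /perm3; tauto.
  apply: (of_type_perm per); apply: heptagonal_angles.
  - exact: is_triangle_perm per T.
  - by algebra.
  - by algebra.
rewrite (Rabs_pos_eq (t * t - 1)) in h T'; last nra.
apply: (of_type_perm h); apply: heptagonal_angles => //.
- by algebra.
- by algebra.
Qed.

(** The law of sines; K is the squared diameter of the circumscribed circle. *)
Lemma of_type_sines a b c al be ga : is_triangle a b c -> of_type a b c al be ga ->
  exists K, 0 < K /\
  perm3 (K * (sin al * sin al)) (K * (sin be * sin be)) (K * (sin ga * sin ga))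
    (a * a) (b * b) (c * c).
Proof.
move=> T; have TB := rot_triangle T; have TC := rot_triangle TB.
have H := heron_gt0 T.
have [eA [eB eC]] := (sin_angleA T, (sin_angleA TB, sin_angleA TC)).
case: T => [a0 [b0 [c0 _]]] [_ [_]]; rewrite /angleB /angleC.
rewrite (_ : heron (b * b) _ _ = heron (a * a) (b * b) (c * c)) in eB; last by rewrite /heron; ring.
rewrite (_ : heron (c * c) _ _ = heron (a * a) (b * b) (c * c)) in eC; last by rewrite /heron; ring.
move: (heron _ _ _) H eA eB eC => D D0 eA eB eC hyp.
exists (4 * (a * a) * (b * b) * (c * c) / D); split.
  by apply: Rdiv_lt_0_compat => //; repeat apply: Rmult_lt_0_compat; lra.
have {}eA : 4 * (a * a) * (b * b) * (c * c) / D * (sin (angleA a b c) * sin (angleA a b c)) = a * a.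
  by rewrite eA; field; lra.
have {}eB : 4 * (a * a) * (b * b) * (c * c) / D * (sin (angleA b c a) * sin (angleA b c a)) = b * b.
  by rewrite eB; field; lra.
have {}eC : 4 * (a * a) * (b * b) * (c * c) / D * (sin (angleA c a b) * sin (angleA c a b)) = c * c.
  by rewrite eC; field; lra.
by case: hyp => [|[|[|[|[|]]]]] [<- [<- <-]]; rewrite eA eB eC /perm3; tauto.
Qed.

End Angles.

(** * The bounds *)

Section UpperBounds.
Import Order.TTheory GRing.Theory Num.Theory.
Local Open Scope ring_scope.
Variables (n : nat) (a b c : R).
Hypothesis T : is_triangle a b c.

Let a0 : Rlt 0 a. Proof. by case: T. Qed.
Let b0 : Rlt 0 b. Proof. by case: T => _ []. Qed.
Let c0 : Rlt 0 c. Proof. by case: T => _ [_ []]. Qed.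

Section Covered.
Variables (q : 'I_n -> point) (S : {set 'I_n}) (w : 'I_n -> rat).
Hypothesis covS : covered (config_edge a b c q) S.
Hypothesis w0 : forall i, 0 <= w i.
Hypothesis wS : forall i, i \notin S -> w i = 0.

Let t := config_edge a b c q.
Let X p := exists2 i, i \in S & p = q i.
Let A := Rmult a a.
Let B := Rmult b b.
Let C := Rmult c c.

Let A0 : Rlt 0 A. Proof. exact: Rmult_lt_0_compat. Qed.
Let B0 : Rlt 0 B. Proof. exact: Rmult_lt_0_compat. Qed.
Let C0 : Rlt 0 C. Proof. exact: Rmult_lt_0_compat. Qed.

Let tP i j k : reflect (tri A B C (q i) (q j) (q k)) (t i j k).
Proof. exact: pbP. Qed.

Lemma config_cover : tri_covered X A B C.
Proof.
move=> _ _ [i iS ->] [j jS ->] ij.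
have [|k kS /tP tk] := covS iS jS; first by apply: contra_notN ij => /eqP->.
by exists (q k); split=> //; exists k.
Qed.

(** Two indices carrying the same point lie in no copy, hence do not both belong to a covered
    set. *)
Lemma config_inj i j : i \in S -> j \in S -> q i = q j -> i = j.
Proof.
move=> iS jS e; apply/eqP/negPn/negP => ij.
have [k kS /tP tk] := covS iS jS ij.
exact: (tri_neq A0 B0 C0 tk).
Qed.

Lemma labelled_bound m t0 (K : rat) : labelled X A B C m t0 ->
  (forall W : nat -> rat, (forall x, 0 <= W x) ->
     edge_sum m t0 W <= K * (\sum_(x <- iota 0 m) W x) ^+ 3) ->
  trilin t w w w <= K * (\sum_i w i) ^+ 3.
Proof.
case=> f [f1 f2] hK.
apply: (@trilin_template rat _ t S w (f \o q) m t0 K w0 wS) => //.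
  by move=> i iS; apply: f1; exists i.
move=> i j k iS jS kS /tP h.
by apply: f2 => //; [exists i|exists j|exists k].
Qed.

Lemma right_bound : alg_right A B C -> trilin t w w w <= 3 / 8 * (\sum_i w i) ^+ 3.
Proof.
move=> rt; case: (right_cover A0 B0 C0 (heron_gt0 T) rt config_cover); last first.
  by move/labelled_bound; apply; apply: hexa_sum_le.
case=> clo two; apply: (@cubic_linear4 rat _ t _ _ _ S w w0 wS).
- by move=> i j k; apply: ctriC12.
- by move=> i j k; apply: ctriC23.
- by move=> i k; apply: ctri_irr.
- move=> u v x y uS vS xS yS /tP tx /tP ty xy; apply/tP.
  apply: (clo (q u) (q v)) => //; [by exists u|by exists v|by exists x|by exists y|].
  by move/(config_inj xS yS)/eqP; apply/negP.
- move=> u v x y z uS vS xS yS zS /tP tx /tP ty /tP tz.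
  case: (two (q u) (q v) (q x) (q y) (q z)) => //;
    [by exists u|by exists v|by exists x|by exists y|by exists z|..].
  + by move/(config_inj xS yS)->; rewrite eqxx.
  + by move/(config_inj yS zS)->; rewrite eqxx orbT.
  + by move/(config_inj zS xS)->; rewrite eqxx !orbT.
Qed.

Lemma nonright_bound : ~ alg_right A B C ->
  [\/ trilin t w w w <= 2 / 9 * (\sum_i w i) ^+ 3,
      alg_120 A B C /\ trilin t w w w <= 8 / 27 * (\sum_i w i) ^+ 3,
      alg_penta A B C /\ trilin t w w w <= 6 / 25 * (\sum_i w i) ^+ 3 |
      alg_hepta A B C /\ trilin t w w w <= 12 / 49 * (\sum_i w i) ^+ 3].
Proof.
move=> nr; case: (nonright_cover A0 B0 C0 (heron_gt0 T) nr config_cover) => [one|].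
  apply: Or41; apply: (@cubic_linear3 rat _ t _ _ _ S w w0 wS).
  - by move=> i j k; apply: ctriC12.
  - by move=> i j k; apply: ctriC23.
  - by move=> i k; apply: ctri_irr.
  - move=> u v x y uS vS xS yS /tP tx /tP ty; apply: config_inj => //.
    by apply: (one (q u) (q v)) => //; [exists u|exists v|exists x|exists y].
case=> [[h0 l]|[[h0 l]|[h0 l]]].
- apply: Or42; split; first exact: h0.
  exact: (labelled_bound l (star_sum_le (K := rat))).
- apply: Or43; split; first exact: h0.
  exact: (labelled_bound l (penta_sum_le (K := rat))).
- apply: Or44; split; first exact: h0.
  exact: (labelled_bound l (hepta_sum_le (K := rat))).
Qed.

Lemma bound_weaken (K K' : rat) : K <= K' ->
  trilin t w w w <= K * (\sum_i w i) ^+ 3 -> trilin t w w w <= K' * (\sum_i w i) ^+ 3.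
Proof.
move=> KK h; apply: le_trans h _; rewrite ler_wpM2r //.
by rewrite exprn_ge0 // sumr_ge0.
Qed.

End Covered.

Lemma h_right : right_angled a b c -> (16 * h n a b c <= n ^ 3)%N.
Proof.
move/(right_angled_alg T) => rt; rewrite -[leqRHS]mul1n.
apply: (h_le_cubic a0 b0 c0) => [//|q S w covS w0 wS].
apply: (@bound_weaken q w w0 (3 / 8)); last exact: (right_bound covS w0 wS rt).
by vm_compute.
Qed.

(** Since 2/9 < 6/25 < 12/49 < 8/27, a given type only has to rule out the exceptional
    configurations with a larger constant than its own; the others satisfy the numerical
    inequality. *)
Lemma h_nonright (num den : nat) : (0 < den)%N ->
  ~ right_angled a b c ->
  (2 / 9 <= (6 * num)%:R / den%:R :> rat) ->
  (alg_120 (Rmult a a) (Rmult b b) (Rmult c c) -> 8 / 27 <= (6 * num)%:R / den%:R :> rat) ->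
  (alg_penta (Rmult a a) (Rmult b b) (Rmult c c) -> 6 / 25 <= (6 * num)%:R / den%:R :> rat) ->
  (alg_hepta (Rmult a a) (Rmult b b) (Rmult c c) -> 12 / 49 <= (6 * num)%:R / den%:R :> rat) ->
  (den * h n a b c <= num * n ^ 3)%N.
Proof.
move=> d0 nr k0 k1 k2 k3; apply: (h_le_cubic a0 b0 c0) => [//|q S w covS w0 wS].
have nr' : ~ alg_right (Rmult a a) (Rmult b b) (Rmult c c).
  by move/(right_angled_alg T).
case: (nonright_bound covS w0 wS nr') => [|[e]|[e]|[e]]; apply: (@bound_weaken q w w0).
- exact: k0.
- exact: k1.
- exact: k2.
- exact: k3.
Qed.

End UpperBounds.

Definition edge_count (m : nat) (t0 : nat -> nat -> nat -> bool) : nat :=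
  size [seq p <- allpairs pair (allpairs pair (iota 0 m) (iota 0 m)) (iota 0 m)
       | t0 p.1.1 p.1.2 p.2].

Definition distinct3 (i j k : nat) : bool := uniq [:: i; j; k].

(* The centre and the vertices of the equilateral triangle receive the weights
   3, 2, 2, 2. *)
Definition star9_edge (i j k : nat) : bool :=
  let g := nth 0%N [:: 0; 0; 0; 1; 1; 2; 2; 3; 3]%N in star_edge (g i) (g j) (g k).

Section LowerBounds.
Local Open Scope R_scope.

(** The equation on [edge_count] says that the form of the template, at equal weights 1/m, has the
    value 6 num / den. *)
Lemma h_lower_eq (n m num den : nat) a b c (V : nat -> point)
    (t0 : nat -> nat -> nat -> bool) :
  is_triangle a b c -> (0 < n)%N -> (0 < m)%N -> (m %| n)%N ->
  (den * edge_count m t0 = 6 * num * m ^ 3)%N ->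
  (forall i j k, (i < m)%N -> (j < m)%N -> (k < m)%N -> t0 i j k ->
     tri (a * a) (b * b) (c * c) (V i) (V j) (V k)) ->
  (den * h n a b c <= num * n ^ 3)%N -> (den * h n a b c)%N = (num * n ^ 3)%N.
Proof.
case=> [a0 [b0 [c0 _]]] n0 m0 mn e ht up; apply/eqP; rewrite eqn_leq up /=.
have le := @h_ge_template n m a b c (fun i => V i) a0 b0 c0 n0 m0 mn t0
  (fun x y z => ht x y z (ltn_ord x) (ltn_ord y) (ltn_ord z)).
have {}le := leq_mul (leqnn den) le.
have eL : (6 * (num * n ^ 3) = den * ((n %/ m) ^ 3 * edge_count m t0))%N.
  by rewrite [RHS]mulnCA e [RHS]mulnCA -expnMn divnK // mulnA.
have eR : (6 * (den * h n a b c) = den * (6 * h n a b c))%N by rewrite mulnCA.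
by rewrite -(@leq_pmul2l 6) // eL eR.
Qed.

Lemma h_triangle (n : nat) a b c : is_triangle a b c -> (0 < n)%N -> (3 %| n)%N ->
  (27 * h n a b c <= n ^ 3)%N -> (27 * h n a b c)%N = (n ^ 3)%N.
Proof.
move=> T n0 mn; rewrite -{1 2}[(n ^ 3)%N]mul1n.
(* The abscissa of the apex over the base from (0, 0) to (c, 0), by the law of cosines. *)
pose X := (b * b + c * c - a * a) / (2 * c).
have h0 : 0 <= b * b - X * X.
  have H := heron_gt0 T; case: (T) => [a0 [b0 [c0 _]]].
  rewrite (_ : _ - _ = heron (a * a) (b * b) (c * c) / (4 * (c * c))).
    by apply: Rlt_le; apply: Rdiv_lt_0_compat => //; nra.
  by rewrite /X /heron; field; lra.
have e := sqrt_sqrt _ h0; move: (sqrt _) e => y e.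
pose V := nth (0, 0) [:: (0, 0); (c, 0); (X, y)].
apply: (@h_lower_eq n 3 1 27 a b c V distinct3) => //.
have e1 : (X - 0) * (X - 0) + (y - 0) * (y - 0) = b * b by lra.
have e2 : (X - c) * (X - c) + (y - 0) * (y - 0) = a * a.
  rewrite (_ : _ + _ = X * X + y * y - 2 * c * X + c * c); last ring.
  by rewrite e /X; field; case: T => [_ [_ []]]; lra.
have s12 : sqd (0, 0) (c, 0) = c * c by rewrite /sqd /=; ring.
have s13 : sqd (0, 0) (X, y) = b * b by rewrite sqdC.
have s23 : sqd (c, 0) (X, y) = a * a by rewrite sqdC.
by case=> [|[|[|i]]] // [|[|[|j]]] // [|[|[|k]]] // _ _ _ _; rewrite /V /tri /=
  ?(sqdC (X, y)) ?(sqdC (c, 0) (0, 0)) ?s12 ?s13 ?s23 /perm3; tauto.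
Qed.

Lemma h_rectangle (n : nat) a b c : is_triangle a b c -> (0 < n)%N -> (4 %| n)%N ->
  right_angled a b c ->
  (16 * h n a b c <= n ^ 3)%N -> (16 * h n a b c)%N = (n ^ 3)%N.
Proof.
move=> T n0 mn /(right_angled_alg T) rt; rewrite -{1 2}[(n ^ 3)%N]mul1n.
have [p [q per]] : exists p q, perm3 (p * p) (q * q) (p * p + q * q) (a * a) (b * b) (c * c).
  by case: rt => [<-|[<-|<-]]; [exists a, b|exists b, c|exists c, a]; rewrite /perm3; tauto.
pose V := nth (0, 0) [:: (0, 0); (p, 0); (p, q); (0, q)].
apply: (@h_lower_eq n 4 1 16 a b c V distinct3) => // i j k hi hj hk hd.
apply/(tri_perm _ _ _ per); move: i j k hi hj hk hd.
by case=> [|[|[|[|i]]]] // [|[|[|[|j]]]] // [|[|[|[|k]]]] // _ _ _ _;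
  rewrite /V /tri /perm3 /sqd /=; lra.
Qed.

Lemma h_star (n : nat) a b c : is_triangle a b c -> (0 < n)%N -> (9 %| n)%N ->
  of_type a b c (deg 120) (deg 30) (deg 30) ->
  (81 * h n a b c <= 4 * n ^ 3)%N -> (81 * h n a b c)%N = (4 * n ^ 3)%N.
Proof.
move=> T n0 mn /(of_type_sines T)[K [K0]].
rewrite (_ : deg 120 = 2 * (PI / 3)); last by rewrite /deg; field.
rewrite (_ : deg 30 = PI / 6); last by rewrite /deg; field.
rewrite sin_2PI3 sin_PI6 => per.
have e3 := sqrt_sqrt 3 ltac:(lra); have eK := sqrt_sqrt K ltac:(lra).
(* The circumradius of the triangle, which equals its two short sides because sin 30 is 1/2; the
   three outer points lie at this distance from the centre. *)
pose r := sqrt K / 2; have er : r * r = K / 4 by rewrite /r; lra.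
pose P := nth (0, 0) [:: (0, 0); (r, 0); (- r / 2, r * (sqrt 3 / 2)); (- r / 2, - r * (sqrt 3 / 2))].
pose g := nth 0%N [:: 0; 0; 0; 1; 1; 2; 2; 3; 3]%N.
apply: (@h_lower_eq n 9 4 81 a b c (fun i => P (g i)) star9_edge) => // i j k hi hj hk.
rewrite /star9_edge -/g.
have g4 l : (g l < 4)%N by do 9!(case: l => [//|l]); rewrite /g nth_default.
move: (g i) (g j) (g k) (g4 i) (g4 j) (g4 k) => {hi hj hk}i {}j {}k hi hj hk hd.
apply/(tri_perm _ _ _ per); move: i j k hi hj hk hd.
have rr : r * (sqrt 3 / 2) * (r * (sqrt 3 / 2)) = 3 / 16 * K.
  rewrite (_ : _ * _ = r * r * (sqrt 3 * sqrt 3) / 4); last field.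
  by rewrite er e3; field.
have e4 : K * (sqrt 3 / 2 * (sqrt 3 / 2)) = 3 / 4 * K.
  by rewrite (_ : _ / 2 * (_ / 2) = sqrt 3 * sqrt 3 / 4); [rewrite e3; field|field].
have dP i j : (i < 4)%N -> (j < 4)%N -> sqd (P i) (P j) =
    if i == j then 0 else if (i == 0%N) || (j == 0%N) then K / 4 else 3 / 4 * K.
  by case: i => [|[|[|[|i]]]] //; case: j => [|[|[|[|j]]]] // _ _;
    rewrite /P /sqd /=; lra.
move=> i j k hi hj hk; rewrite /tri !dP // e4 {dP}; move: i j k hi hj hk.
case=> [|[|[|[|i]]]] // [|[|[|[|j]]]] // [|[|[|[|k]]]] // _ _ _ hd;
  first [ by vm_compute in hd | rewrite /perm3 /=; clear -K0; lra ].
Qed.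

Lemma rainbow_perm3 (f : nat -> R) i j k : rainbow i j k ->
  perm3 (f i) (f j) (f k) (f 1%N) (f 2%N) (f 3%N).
Proof.
rewrite /rainbow => hp.
have mem l : l \in [:: i; j; k] -> [\/ l = 1, l = 2 | l = 3]%N.
  by rewrite (perm_mem hp) !inE => /or3P[] /eqP->; [apply: Or31|apply: Or32|apply: Or33].
have [mi [mj mk]] : [\/ i = 1, i = 2 | i = 3]%N /\ [\/ j = 1, j = 2 | j = 3]%N /\
    [\/ k = 1, k = 2 | k = 3]%N.
  by split; [|split]; apply: mem; rewrite !inE eqxx ?orbT.
by move: hp; case: mi => ->; case: mj => ->; case: mk => -> // _; rewrite /perm3; tauto.
Qed.

Lemma isosceles_perm3 (f : nat -> R) i j k : perm_eq [:: i; j; k] [:: 1; 1; 2]%N ->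
  perm3 (f i) (f j) (f k) (f 1%N) (f 1%N) (f 2%N).
Proof.
move=> hp.
have mem l : l \in [:: i; j; k] -> l = 1%N \/ l = 2%N.
  by rewrite (perm_mem hp) !inE => /or3P[] /eqP->; [left|left|right].
have [mi [mj mk]] : (i = 1 \/ i = 2)%N /\ (j = 1 \/ j = 2)%N /\ (k = 1 \/ k = 2)%N.
  by split; [|split]; apply: mem; rewrite !inE eqxx ?orbT.
by move: hp; case: mi => ->; case: mj => ->; case: mk => -> // _; rewrite /perm3; tauto.
Qed.

(** The circle has squared diameter K, as in [of_type_sines], and x is the inscribed angle over one
    step; the doubling turns it into the central angle. *)
Definition polygon (K x : R) (i : nat) : point :=
  (sqrt K / 2 * cos (2 * (x * INR i)), sqrt K / 2 * sin (2 * (x * INR i))).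

Lemma sqd_polygon K x i j : 0 < K ->
  sqd (polygon K x i) (polygon K x j) =
  K * (sin (x * (INR i - INR j)) * sin (x * (INR i - INR j))).
Proof.
move=> K0; have eK := sqrt_sqrt K ltac:(lra).
have c2 := cos_minus (2 * (x * INR i)) (2 * (x * INR j)).
rewrite (_ : _ - _ = 2 * (x * (INR i - INR j))) in c2; last ring.
rewrite cos_2a_sin in c2.
have h1 := sin2_cos2 (2 * (x * INR i)); have h2 := sin2_cos2 (2 * (x * INR j)).
rewrite /Rsqr in h1 h2; rewrite /sqd /polygon /=.
move: (sin (x * _)) (cos (2 * (x * INR i))) (cos (2 * (x * INR j)))
  (sin (2 * (x * INR i))) (sin (2 * (x * INR j))) c2 h1 h2 => s c c' d d' c2 h1 h2.
rewrite (_ : _ + _ = sqrt K * sqrt K / 4 *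
  ((d * d + c * c) + (d' * d' + c' * c') - 2 * (c * c' + d * d'))); last field.
by rewrite eK h1 h2 -c2; field.
Qed.

(** The hypothesis on x covers x m = pi, the regular polygon, and x m = 2 pi, the star polygon that
    goes round twice. *)
Lemma sin_sqr_cyc_dist m x i j : (i < m)%N -> (j < m)%N ->
  (forall y, sin (x * INR m - y) * sin (x * INR m - y) = sin y * sin y) ->
  sin (x * (INR i - INR j)) * sin (x * (INR i - INR j)) =
  sin (x * INR (cyc_dist m i j)) * sin (x * INR (cyc_dist m i j)).
Proof.
move=> im jm hx.
have neg y : sin (- y) * sin (- y) = sin y * sin y by rewrite sin_neg; ring.
have dist d : (d <= m)%N -> sin (x * INR (minn d (m - d))) * sin (x * INR (minn d (m - d))) =
    sin (x * INR d) * sin (x * INR d).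
  move=> dm; rewrite /minn; case: ifP => // _.
  rewrite minus_INR; last exact/leP.
  by rewrite Rmult_minus_distr_l hx.
rewrite /cyc_dist; have [ji|ij] := leqP j i.
  have dE : ((i + m - j) %% m = i - j)%N.
    by rewrite addnC -addnBA // modnDl modn_small // (leq_ltn_trans (leq_subr _ _)).
  rewrite dE dist; last by rewrite (leq_trans (leq_subr _ _)) // ltnW.
  by rewrite minus_INR //; apply/leP.
have dE : ((i + m - j) %% m = m - (j - i))%N.
  rewrite addnC -subnBA 1?ltnW // modn_small // ltn_subrL subn_gt0 ij.
  exact: leq_ltn_trans im.
rewrite dE dist ?leq_subr // minus_INR; last first.
  by apply/leP; rewrite (leq_trans (leq_subr _ _)) // ltnW.
rewrite [in RHS]Rmult_minus_distr_l hx [in RHS]minus_INR; last by apply/leP/ltnW.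
by rewrite -neg; congr (sin _ * sin _); ring.
Qed.

Lemma sin_sqr_pi_minus y : sin (PI - y) * sin (PI - y) = sin y * sin y.
Proof. by rewrite Rtrigo_facts.sin_pi_minus. Qed.

Lemma sin_sqr_2pi_minus y : sin (2 * PI - y) * sin (2 * PI - y) = sin y * sin y.
Proof. by rewrite sin_minus sin_2PI cos_2PI; ring. Qed.

Lemma h_hepta (n : nat) a b c : is_triangle a b c -> (0 < n)%N -> (7 %| n)%N ->
  of_type a b c (deg (4 * 180 / 7)) (deg (2 * 180 / 7)) (deg (180 / 7)) ->
  (49 * h n a b c <= 2 * n ^ 3)%N -> (49 * h n a b c)%N = (2 * n ^ 3)%N.
Proof.
move=> T n0 mn /(of_type_sines T)[K [K0 per]].
pose x := PI / 7.
have hx y : sin (x * INR 7 - y) * sin (x * INR 7 - y) = sin y * sin y.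
  by rewrite (_ : x * INR 7 = PI) ?sin_sqr_pi_minus // /x /=; field.
pose f k := K * (sin (x * INR k) * sin (x * INR k)).
have {}per : perm3 (f 1%N) (f 2%N) (f 3%N) (a * a) (b * b) (c * c).
  have e1 : f 1%N = K * (sin (deg (180 / 7)) * sin (deg (180 / 7))).
    by rewrite /f /= (_ : x * _ = deg (180 / 7)) // /x /deg; field.
  have e2 : f 2%N = K * (sin (deg (2 * 180 / 7)) * sin (deg (2 * 180 / 7))).
    by rewrite /f /= (_ : x * _ = deg (2 * 180 / 7)) // /x /deg; field.
  (* Cyclic distance 3 has inscribed angle 3 pi/7, the supplement of the largest angle 4 pi/7. *)
  have e3 : f 3%N = K * (sin (deg (4 * 180 / 7)) * sin (deg (4 * 180 / 7))).
    by rewrite /f /= -sin_sqr_pi_minus (_ : PI - x * _ = deg (4 * 180 / 7)) // /x /deg; field.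
  rewrite -e1 -e2 -e3 in per.
  by apply: perm3_trans per; rewrite /perm3; tauto.
apply: (@h_lower_eq n 7 2 49 a b c (polygon K x) hepta_edge) => // i j k hi hj hk hd.
rewrite /tri !sqd_polygon // !(sin_sqr_cyc_dist _ _ hx) //.
exact: perm3_trans (rainbow_perm3 f hd) per.
Qed.

Lemma h_penta (n : nat) a b c : is_triangle a b c -> (0 < n)%N -> (5 %| n)%N ->
  of_type a b c (deg 108) (deg 36) (deg 36) \/ of_type a b c (deg 72) (deg 72) (deg 36) ->
  (25 * h n a b c <= n ^ 3)%N -> (25 * h n a b c)%N = (n ^ 3)%N.
Proof.
move=> T n0 mn hT; rewrite -{1 2}[(n ^ 3)%N]mul1n.
(* The angle x = pi/5 gives the pentagon for 108, 36, 36, and x = 2 pi/5 the pentagram for 72, 72,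
   36; in both, cyclic distance 1 belongs to the two equal sides. *)
have [K [x [K0 hx per]]] : exists K x, [/\ 0 < K,
    forall y, sin (x * INR 5 - y) * sin (x * INR 5 - y) = sin y * sin y &
    perm3 (K * (sin (x * INR 1) * sin (x * INR 1))) (K * (sin (x * INR 1) * sin (x * INR 1)))
      (K * (sin (x * INR 2) * sin (x * INR 2))) (a * a) (b * b) (c * c)].
  case: hT => /(of_type_sines T)[K [K0 per]]; exists K; [exists (PI / 5)|exists (2 * PI / 5)];
    split=> //.
  - by move=> y; rewrite (_ : _ * INR 5 = PI) ?sin_sqr_pi_minus //=; field.
  - rewrite (_ : PI / 5 * INR 1 = deg 36); last by rewrite /deg /=; field.
    rewrite -(sin_sqr_pi_minus (_ * INR 2)) (_ : PI - _ = deg 108); last by rewrite /deg /=; field.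
    by apply: perm3_trans per; rewrite /perm3; tauto.
  - by move=> y; rewrite (_ : _ * INR 5 = 2 * PI) ?sin_sqr_2pi_minus //=; field.
  - rewrite (_ : 2 * PI / 5 * INR 1 = deg 72); last by rewrite /deg /=; field.
    rewrite -(sin_sqr_pi_minus (_ * INR 2)) (_ : PI - _ = deg 36); last by rewrite /deg /=; field.
    by apply: perm3_trans per; rewrite /perm3; tauto.
apply: (@h_lower_eq n 5 1 25 a b c (polygon K x) penta_edge) => // i j k hi hj hk hd.
rewrite /tri !sqd_polygon // !(sin_sqr_cyc_dist _ _ hx) //.
exact: perm3_trans (isosceles_perm3 (fun k => K * (sin (x * INR k) * sin (x * INR k))) hd) per.
Qed.

End LowerBounds.

Section Types.
Local Open Scope R_scope.

Lemma of_type_inj a b c al be ga al' be' ga' : of_type a b c al be ga ->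
  of_type a b c al' be' ga' -> al = al' /\ be = be' /\ ga = ga'.
Proof.
move=> [h1 [h2 h3]] [k1 [k2 k3]]; move: h3 k3 => /=.
move: (angleA a b c) (angleB a b c) (angleC a b c) => x y z h3 k3.
by case: h3 => [|[|[|[|[|]]]]] [? [? ?]]; case: k3 => [|[|[|[|[|]]]]] [? [? ?]]; lra.
Qed.

Lemma deg_neq x y : x <> y -> deg x <> deg y.
Proof. by move=> xy; rewrite /deg => e; apply: xy; have := PI_RGT_0; nra. Qed.

Lemma of_type_not_right a b c x y z : of_type a b c (deg x) (deg y) (deg z) ->
  x <> 90 -> y <> 90 -> z <> 90 -> ~ right_angled a b c.
Proof.
move=> [_ [_ h]] /deg_neq hx /deg_neq hy /deg_neq hz r; move: h => /=.
by case: r => [r|[r|r]]; case=> [|[|[|[|[|]]]]] [e1 [e2 e3]]; congruence.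
Qed.

End Types.

Theorem theorem1p2 (n : nat) (hn : (0 < n)%N) :
  (* (a) *)
  (forall a b c : R, is_triangle a b c -> right_angled a b c ->
     (16 * h n a b c <= n ^ 3)%N /\ ((4 %| n)%N -> (16 * h n a b c)%N = (n ^ 3)%N)) /\
  (* (b) *)
  (forall a b c : R, is_triangle a b c ->
     of_type a b c (deg 120) (deg 30) (deg 30) ->
     (81 * h n a b c <= 4 * n ^ 3)%N /\
     ((9 %| n)%N -> (81 * h n a b c)%N = (4 * n ^ 3)%N)) /\
  (* (c) *)
  (forall a b c : R, is_triangle a b c ->
     of_type a b c (deg (4 * 180 / 7)) (deg (2 * 180 / 7)) (deg (180 / 7)) ->
     (49 * h n a b c <= 2 * n ^ 3)%N /\
     ((7 %| n)%N -> (49 * h n a b c)%N = (2 * n ^ 3)%N)) /\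
  (* (d) *)
  (forall a b c : R, is_triangle a b c ->
     (of_type a b c (deg 108) (deg 36) (deg 36) \/
      of_type a b c (deg 72) (deg 72) (deg 36)) ->
     (25 * h n a b c <= n ^ 3)%N /\
     ((5 %| n)%N -> (25 * h n a b c)%N = (n ^ 3)%N)) /\
  (* (e) *)
  (forall a b c : R, is_triangle a b c ->
     ~ right_angled a b c ->
     ~ of_type a b c (deg 120) (deg 30) (deg 30) ->
     ~ of_type a b c (deg (4 * 180 / 7)) (deg (2 * 180 / 7)) (deg (180 / 7)) ->
     ~ of_type a b c (deg 108) (deg 36) (deg 36) ->
     ~ of_type a b c (deg 72) (deg 72) (deg 36) ->
     (27 * h n a b c <= n ^ 3)%N /\
     ((3 %| n)%N -> (27 * h n a b c)%N = (n ^ 3)%N)).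
Proof.
split; [|split; [|split; [|split]]].
- move=> a b c T rt; have up := h_right n T rt.
  by split=> // d; apply: h_rectangle.
- move=> a b c T ty.
  have nr : ~ right_angled a b c by apply: (of_type_not_right ty); lra.
  have up : (81 * h n a b c <= 4 * n ^ 3)%N.
    apply: (@h_nonright n a b c T 4 81).
    + by [].
    + exact: nr.
    + by vm_compute.
    + by move=> _; vm_compute.
    + by move=> _; vm_compute.
    + by move=> _; vm_compute.
  by split=> // d; apply: h_star.
- move=> a b c T ty.
  have nr : ~ right_angled a b c by apply: (of_type_not_right ty); lra.
  have up : (49 * h n a b c <= 2 * n ^ 3)%N.
    apply: (@h_nonright n a b c T 2 49).
    + by [].
    + exact: nr.
    + by vm_compute.
    + move/(alg_120_type T)/(of_type_inj ty) => [e _]; exfalso.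
      by case: (deg_neq _ e); lra.
    + by move=> _; vm_compute.
    + by move=> _; vm_compute.
  by split=> // d; apply: h_hepta.
- move=> a b c T ty.
  have nr : ~ right_angled a b c.
    by case: ty => /of_type_not_right; apply; lra.
  have up : (25 * h n a b c <= n ^ 3)%N.
    rewrite -[leqRHS]mul1n; apply: (@h_nonright n a b c T 1 25).
    + by [].
    + exact: nr.
    + by vm_compute.
    + move/(alg_120_type T) => h120; exfalso.
      by case: ty => /(of_type_inj h120)[e _]; case: (deg_neq _ e); lra.
    + by move=> _; vm_compute.
    + move/(alg_hepta_type T) => h7; exfalso.
      by case: ty => /(of_type_inj h7)[e _]; case: (deg_neq _ e); lra.
  by split=> // d; apply: h_penta.
- move=> a b c T nr n120 nhepta n108 n72.
  have up : (27 * h n a b c <= n ^ 3)%N.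
    rewrite -[leqRHS]mul1n; apply: (@h_nonright n a b c T 1 27).
    + by [].
    + exact: nr.
    + by vm_compute.
    + by move=> h120; case: n120; apply: alg_120_type.
    + by move=> h5; exfalso; case: (alg_penta_type T h5).
    + by move=> h7; case: nhepta; apply: alg_hepta_type.
  by split=> // d; apply: h_triangle.
Qed.
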